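(* Let $\xi\in(0,1)$ and let $\nu$ be either a real number with $0\le\nu<\frac12$ or a purely imaginary number. Let $\mathsf{K}_{\nu,\xi}$ be the correlation kernel of the point process $\mathbf{P}_{\nu,\xi}$ on $\mathbb{Z}_{>0}$ (see context). Then for all $x,y\in\mathbb{Z}_{>0}$ $$\mathsf{K}_{\nu,\xi}(x,y)=\frac{2\,\Xi(x,y)\sqrt{xy}}{x+y}\sum_{j=0}^{\infty}\frac{\xi^{j+(x+y)/2}(1-\xi)^{-2j}\,\phi_{j+1}(x)\phi_{j+1}(y)}{2^{\delta(j)}(x+j)!\,(y+j)!\,\Gamma(\frac12-\nu-j)\Gamma(\frac12+\nu-j)},$$ where $\delta(j)=1$ if $j=0$ and $\delta(j)=0$ otherwise.
   Context: $\mathbb{Z}_{>0}=\{1,2,\dots\}$. $\mathbf{P}_{\nu,\xi}$ is the probability measure on finite subsets of $\mathbb{Z}_{>0}$ given by $$\mathbf{P}_{\nu,\xi}(\{x_1,\dots,x_N\})=\mathit{const}\cdot\prod_{1\le i<j\le N}\Big(\frac{x_i-x_j}{x_i+x_j}\Big)^2\prod_{i=1}^N\psi_{\nu,\xi}(x_i),\qquad \psi_{\nu,\xi}(x)=\frac{\xi^x\cos(\pi\nu)}{2\pi}\frac{\Gamma(\frac12-\nu+x)\Gamma(\frac12+\nu+x)}{(x!)^2},$$ where $\mathit{const}$ is the normalizing constant (empty products equal $1$). This process is determinantal, i.e. the probability that the random configuration contains a given finite set $\{x_1,\dots,x_n\}$ of distinct points is $\det[\mathsf{K}_{\nu,\xi}(x_i,x_j)]_{i,j=1}^n$,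 with correlation kernel $\mathsf{K}_{\nu,\xi}=\mathsf{L}_{\nu,\xi}(1+\mathsf{L}_{\nu,\xi})^{-1}$, where $\mathsf{L}_{\nu,\xi}$ is the trace class operator in $\ell^2(\mathbb{Z}_{>0})$ with matrix $\mathsf{L}_{\nu,\xi}(x,y)=\frac{2\sqrt{xy\,\psi_{\nu,\xi}(x)\psi_{\nu,\xi}(y)}}{x+y}$. Notation: $\phi_i(x)={}_2F_1\big(-\frac12-\nu+i,-\frac12+\nu+i;x+i;\frac{\xi}{\xi-1}\big)$ for $i=0,1,2,\dots$, where ${}_2F_1$ is the Gauss hypergeometric function (analytically continued to $\mathbb{C}\setminus[1,+\infty)$ in its argument); $\Xi(x,y)=\big\{\Gamma(\frac12-\nu+x)\Gamma(\frac12+\nu+x)\Gamma(\frac12-\nu+y)\Gamma(\frac12+\nu+y)\big\}^{1/2}$ (positive square root of a positive number). *)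

(* Defs.v *)
From HB Require Import structures.
From mathcomp Require Import all_boot all_order all_algebra.
From mathcomp Require Import complex.
From mathcomp Require Import all_classical all_reals all_analysis.

Set Implicit Arguments.
Unset Strict Implicit.
Unset Printing Implicit Defensive.

Import Order.TTheory GRing.Theory Num.Theory.
Import numFieldNormedType.Exports.

Local Open Scope classical_set_scope.
Local Open Scope ring_scope.
Local Open Scope complex_scope.

(* R[i] carries no topology in the library; this gives it the topology of its
   norm, the one every numFieldType has through its regular copy.  Only the
   scalar-free part is copied: R[i] already has a module structure over R. *)
HB.instance Definition _ (R : realType) :=
  PseudoMetricNormedZmod.copy R[i] R[i]^o.

Definition cexp (R : realType) (z : R[i]) : R[i] :=
  (expR (complex.Re z))%:C * (cos (complex.Im z) +i* sin (complex.Im z)).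

Definition ccos (R : realType) (z : R[i]) : R[i] :=
  (cexp ('i * z) + cexp (- ('i * z))) / 2.

(* Euler-Gauss definition of the Gamma function,
     Gamma(z) = lim_n n! n^z / (z (z + 1) ... (z + n)),
   valid for every complex z other than 0, -1, -2, ... *)
Definition Gamma (R : realType) (z : R[i]) : R[i] :=
  limn (fun n : nat => n`!%:R * cexp (z * (ln (n%:R : R))%:C)
                         / \prod_(0 <= k < n.+1) (z + k%:R)).

Definition pochhammer (R : realType) (a : R[i]) (n : nat) : R[i] :=
  \prod_(0 <= k < n) (a + k%:R).

Definition hyp2F1_coef (R : realType) (a b c : R[i]) (n : nat) : R[i] :=
  pochhammer a n * pochhammer b n / (pochhammer c n * n`!%:R).

Definition analytic_at (R : realType) (F : R[i] -> R[i]) (z0 : R[i]) : Prop :=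
  exists (a : nat -> R[i]) (r : R), 0 < r /\
    forall z : R[i], `|z - z0| < r%:C ->
      series (fun n => a n * (z - z0) ^+ n) @ \oo --> F z.

(* In the order of R[i], 1 <= z holds exactly when z is real and at least 1,
   so this is C \ [1, +oo[. *)
Definition slit_plane (R : realType) : set R[i] := [set z | ~ (1 <= z)].

Definition is_hyp2F1 (R : realType) (a b c : R[i]) (F : R[i] -> R[i]) : Prop :=
  (forall z : R[i], z \in @slit_plane R -> analytic_at F z) /\
  (forall z : R[i], `|z| < 1 ->
     series (fun n => hyp2F1_coef a b c n * z ^+ n) @ \oo --> F z).

(* Value at z in the slit plane of the analytic continuation of the Gauss
   series; c must not be one of 0, -1, -2, ... *)
Definition hyp2F1 (R : realType) (a b c z : R[i]) : R[i] :=
  xget 0 [set w | exists2 F : R[i] -> R[i], is_hyp2F1 a b c F & F z = w].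

Section Kernel.
Variables (R : realType) (nu : R[i]) (xi : R).

Definition psi (x : nat) : R[i] :=
  xi%:C ^+ x * ccos (pi%:C * nu) / (2 * pi%:C)
  * (Gamma (2^-1 - nu + x%:R) * Gamma (2^-1 + nu + x%:R)) / x`!%:R ^+ 2.

(* sqrtC maps a nonnegative real to its nonnegative square root. *)
Definition Lmx (x y : nat) : R[i] :=
  2 * sqrtC (x%:R * y%:R * psi x * psi y) / (x + y)%:R.

(* A vector indexed by the positive integers is a function on nat that
   vanishes at 0. *)
Definition ell2 : set (nat -> R[i]) :=
  [set f : nat -> R[i] |
     f 0%N = 0 /\ cvgn (series (fun n => (`|f n| ^+ 2 : R[i])))].

Definition mxop (A : nat -> nat -> R[i]) (f : nat -> R[i]) : nat -> R[i] :=
  fun x => limn (fun n : nat => \sum_(1 <= y < n) A x y * f y).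

(* Both Lmx 0 y and Lmx x 0 are 0, so L maps into vectors vanishing at 0. *)
Definition Lop : (nat -> R[i]) -> (nat -> R[i]) := mxop Lmx.

(* L (1 + L)^-1, where (1 + L)^-1 is the inverse of the map 1 + L on ell2. *)
Definition Kop (f : nat -> R[i]) : nat -> R[i] :=
  Lop ('pinv_(fun=> (fun=> 0)) ell2 (fun g => g + Lop g) f).

Definition Kmx (x y : nat) : R[i] := Kop (fun z => (z == y)%:R) x.

Definition phi (i x : nat) : R[i] :=
  hyp2F1 (- 2^-1 - nu + i%:R) (- 2^-1 + nu + i%:R) (x + i)%:R
         (xi / (xi - 1))%:C.

Definition Xi (x y : nat) : R[i] :=
  sqrtC (Gamma (2^-1 - nu + x%:R) * Gamma (2^-1 + nu + x%:R)
         * Gamma (2^-1 - nu + y%:R) * Gamma (2^-1 + nu + y%:R)).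

Definition kernel_term (x y j : nat) : R[i] :=
  (xi `^ (j%:R + (x + y)%:R / 2) * (1 - xi) ^- (2 * j))%:C
  * (phi j.+1 x * phi j.+1 y)
  / (2 ^+ (j == 0%N) * ((x + j)`!%:R * (y + j)`!%:R)
     * (Gamma (2^-1 - nu - j%:R) * Gamma (2^-1 + nu - j%:R))).

End Kernel.

(* Main.v *)
From HB Require Import structures.
Require Import Defs.
From mathcomp Require Import all_boot all_order all_algebra.
From mathcomp Require Import complex finmap.
From mathcomp Require Import all_classical all_reals all_analysis.
From mathcomp Require Import ring lra zify.

Set Implicit Arguments.
Unset Strict Implicit.
Unset Printing Implicit Defensive.

Import Order.TTheory GRing.Theory Num.Theory.
Import numFieldNormedType.Exports.

Local Open Scope classical_set_scope.
Local Open Scope ring_scope.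
Local Open Scope complex_scope.

(** Let r_x be the square root of x psi(x). The functional equation and the
    reflection formula for Gamma give psi(x) = xi^x alpha_x / (2 x!^2) with
    alpha_x = (1/2 - nu)_x (1/2 + nu)_x, and L(x, y) = 2 r_x r_y / (x + y).

    The idea is to differentiate in xi. Since r_x is a multiple of xi^(x/2),
    applying xi d/dxi to L(x, y) gives r_x r_y, a kernel of rank one; therefore
    xi d/dxi applied to K = L (1 + L)^-1 gives g_x g_y with g = (1 + L)^-1 r. The
    vector g is explicit: g_x = r_x f_x, f_x being a Gauss function of xi. On the
    other hand the functions phi_j are linked by contiguity relations that raise
    or lower j, and these make xi d/dxi of the j-th term of the series a
    difference of two neighbouring expressions. The sum telescopes to a multiple
    of g_x g_y, so the series and K have the same derivative, and both vanish at
    xi = 0.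

    These computations take place in formal power series in xi, after division by
    r_x r_y. There ffps_equation states (1 + L) g = r (a partial fraction
    expansion), kfps_equation states K + L K = L for the kernel defined by
    its derivative g_x g_y, and kfps_sum is the telescoping. Absolute bounds for
    the coefficients carry them to a given xi in (0, 1): kappa_equation and
    kappa_sum.

    Three points link this to the statement.
    - phi_(j+1)(x) is a value of the analytic continuation of the Gauss series, at
      xi/(xi - 1), which is outside of the unit disc for xi > 1/2. After the
      substitution z = v/(1 + qv) the series is a binomial factor times the
      generating function of the moments of (t - q)^l for a formal beta
      distribution, which converges for |v| max(|q|, |1 - q|) < 1; as q varies
      these domains cover the slit plane, and they are glued by the identity
      theorem (hyp2F1E). The case q = 1 evaluates phi_(j+1)(x) (phi_ev).
    - (1 + L)^-1 is the inverse of a map on square summable vectors. Its value at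
      delta_y is delta_y minus the column y of K, once 1 + L is known to be
      injective; this too follows from K + L K = L (resolvent_inj, KmxE).
    - The Euler products for Gamma converge (gam_seq_cvg), and their product at
      1/2 - nu and 1/2 + nu is the limit of n!^2 n / alpha_(n+1). It is pi / cos (pi nu),
      by comparing the integrals of cos^n t and of cos (2 nu t) cos^n t over
      (0, pi/2) (wallis_limit, reflection). *)

(** * The modulus of a complex number *)

Section Modulus.
Variable R : realType.
Local Notation C := R[i].
Implicit Types z w : C.

Definition mag (z : C) : R := Normc.normc z.

Lemma normE z : `|z| = (mag z)%:C.
Proof. by rewrite normc_def; case: z. Qed.

Lemma mag_ge0 z : 0 <= mag z.
Proof. by rewrite -lecR -normE normr_ge0. Qed.

Lemma magM z w : mag (z * w) = mag z * mag w.
Proof. exact: Normc.normcM. Qed.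

Lemma magV z : mag z^-1 = (mag z)^-1.
Proof. exact: Normc.normcV. Qed.

Lemma magN z : mag (- z) = mag z.
Proof. exact: normcN. Qed.

Lemma magBC z w : mag (z - w) = mag (w - z).
Proof. by rewrite -magN opprB. Qed.

Lemma magD z w : mag (z + w) <= mag z + mag w.
Proof. exact: le_normcD. Qed.

Lemma magB z w : mag (z - w) <= mag z + mag w.
Proof. by rewrite (le_trans (magD _ _))// magN. Qed.

Lemma mag0 : mag 0 = 0. Proof. exact: Normc.normc0. Qed.
Lemma mag1 : mag 1 = 1. Proof. exact: Normc.normc1. Qed.

Lemma mag_eq0 z : (mag z == 0) = (z == 0).
Proof. by rewrite -[RHS]normr_eq0 normE -(inj_eq (@complexI R)). Qed.

Lemma mag_gt0 z : (0 < mag z) = (z != 0).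
Proof. by rewrite lt_def mag_ge0 mag_eq0 andbT. Qed.

Lemma magX z n : mag (z ^+ n) = mag z ^+ n.
Proof. by elim: n => [|n IH]; rewrite ?expr0 ?mag1// !exprS magM IH. Qed.

Lemma mag_real (r : R) : mag r%:C = `|r|.
Proof. by rewrite /mag /= expr0n /= addr0 sqrtr_sqr. Qed.

Lemma mag_nat n : mag n%:R = n%:R.
Proof. by rewrite -(rmorph_nat (@real_complex R)) mag_real ger0_norm. Qed.

Lemma mag_sum (I : Type) (s : seq I) (P : pred I) (F : I -> C) :
  mag (\sum_(i <- s | P i) F i) <= \sum_(i <- s | P i) mag (F i).
Proof.
elim/big_rec2: _ => [|i a b _ h]; first by rewrite mag0.
by rewrite (le_trans (magD _ _))// lerD2l.
Qed.

Lemma mag_prod (I : Type) (s : seq I) (P : pred I) (F : I -> C) :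
  mag (\prod_(i <- s | P i) F i) = \prod_(i <- s | P i) mag (F i).
Proof. by apply: (big_morph mag magM mag1). Qed.

Lemma magE z : mag z = Num.sqrt (complex.Re z ^+ 2 + complex.Im z ^+ 2).
Proof. by case: z. Qed.

Lemma mag_sqr z : mag z ^+ 2 = complex.Re z ^+ 2 + complex.Im z ^+ 2.
Proof. by rewrite magE sqr_sqrtr// addr_ge0// sqr_ge0. Qed.

Lemma mag_Re z : `|complex.Re z| <= mag z.
Proof.
by rewrite magE -sqrtr_sqr ler_wsqrtr// lerDl sqr_ge0.
Qed.

Lemma mag_Im z : `|complex.Im z| <= mag z.
Proof.
by rewrite magE -sqrtr_sqr ler_wsqrtr// lerDr sqr_ge0.
Qed.

Lemma mag_le_ReIm z : mag z <= `|complex.Re z| + `|complex.Im z|.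
Proof.
rewrite magE -(ler_pXn2r (n := 2))// ?nnegrE ?sqrtr_ge0 ?addr_ge0//.
rewrite sqr_sqrtr ?addr_ge0 ?sqr_ge0// sqrrD !real_normK ?num_real//.
by rewrite lerD2r lerDl mulrn_wge0// mulr_ge0.
Qed.

Lemma lt_mag z (r : R) : (`|z| < r%:C) = (mag z < r).
Proof. by rewrite normE ltcR. Qed.

Lemma cvgCP (u : nat -> C) (l : C) :
  u @ \oo --> l <->
  (forall e : R, 0 < e -> exists N, forall n, (N <= n)%N -> mag (u n - l) < e).
Proof.
split=> [/cvgrPdist_lt h e e0|h].
  have /h [N _ hN] : 0 < e%:C by rewrite ltcR.
  exists N => n nN; have := hN n nN; rewrite /= lt_mag => H.
  by rewrite magBC.
apply/cvgrPdist_lt => e e0.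
have [r re] : exists r : R, e = r%:C.
  by apply/complex_realP; rewrite realE (ltW e0).
move: e0; rewrite re ltcR => /h [N hN].
by exists N => // n nN; rewrite /= lt_mag magBC hN.
Qed.

Lemma cvgC_lim (u : nat -> C) (l : C) : u @ \oo --> l -> limn u = l.
Proof. by move=> h; apply: cvg_lim. Qed.

End Modulus.

(** * Unconditional summation *)

Section UnconditionalSums.
Variable R : realType.
Local Notation C := R[i].

(** Convergence along the finite subsets of I, ordered by inclusion:
    rearrangements and interchanges of sums then need no enumeration of I. *)
Definition has_sum (I : choiceType) (u : I -> C) (l : C) : Prop :=
  forall e : R, 0 < e -> exists s0 : {fset I}, forall s : {fset I},
    (s0 `<=` s)%fset -> mag (\sum_(i <- s) u i - l) < e.

Definition abs_bound (I : choiceType) (u : I -> C) (B : R) : Prop :=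
  forall s : {fset I}, \sum_(i <- s) mag (u i) <= B.

Definition csum (I : choiceType) (u : I -> C) : C :=
  xget 0 [set l | has_sum u l].

Section Basics.
Variable I : choiceType.
Implicit Types u v : I -> C.

Lemma has_sum_uniq u l l' : has_sum u l -> has_sum u l' -> l = l'.
Proof.
move=> h h'; apply/eqP; rewrite -subr_eq0 -mag_eq0; apply/negPn/negP => n0.
have e0 : 0 < mag (l - l') / 2 by rewrite divr_gt0// lt_def n0 mag_ge0.
have [s0 hs] := h _ e0; have [s1 hs'] := h' _ e0.
have /hs H1 : (s0 `<=` s0 `|` s1)%fset by apply: fsubsetUl.
have /hs' H2 : (s1 `<=` s0 `|` s1)%fset by apply: fsubsetUr.
set S := \sum_(i <- _) _ in H1 H2.
have : mag (l - l') <= mag (S - l) + mag (S - l').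
  have -> : l - l' = (S - l') - (S - l) by ring.
  by rewrite [leRHS]addrC magB.
by move=> ?; lra.
Qed.

Lemma has_sumD u v l m : has_sum u l -> has_sum v m ->
  has_sum (fun i => u i + v i) (l + m).
Proof.
move=> h h' e e0; have e2 : 0 < e / 2 by lra.
have [s0 hs] := h _ e2; have [s1 hs'] := h' _ e2.
exists (s0 `|` s1)%fset => s /fsubUsetP [/hs H1 /hs' H2].
rewrite big_split /= opprD addrACA.
by rewrite (le_lt_trans (magD _ _))//; lra.
Qed.

Lemma has_sum0 : has_sum (fun _ : I => 0) 0.
Proof. by move=> e e0; exists fset0 => s _; rewrite big1// subr0 mag0. Qed.

Lemma has_sumZ c u l : has_sum u l -> has_sum (fun i => c * u i) (c * l).
Proof.
have [->|c0] := eqVneq c 0.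
  move=> _; under [X in has_sum X]eq_fun do rewrite mul0r.
  by rewrite mul0r; apply: has_sum0.
move=> h e e0; have c1 : 0 < mag c by rewrite mag_gt0.
have [s0 hs] := h _ (divr_gt0 e0 c1); exists s0 => s /hs.
by rewrite -mulr_sumr -mulrBr magM ltr_pdivlMr// mulrC.
Qed.

Lemma has_sum_fin u (s0 : {fset I}) : (forall i, i \notin s0 -> u i = 0) ->
  has_sum u (\sum_(i <- s0) u i).
Proof.
move=> u0 e e0; exists s0 => s ss; rewrite -(big_fset_incl _ ss) ?subrr ?mag0//.
by move=> i _; apply: u0.
Qed.

Lemma has_sum_le u l B : abs_bound u B -> has_sum u l -> mag l <= B.
Proof.
move=> uB ul; apply/ler_addgt0Pr => e e0; have [s /(_ s (fsubset_refl _)) h] := ul _ e0.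
have -> : l = \sum_(i <- s) u i - (\sum_(i <- s) u i - l) by ring.
rewrite (le_trans (magB _ _))// lerD// ?(ltW h)//.
by rewrite (le_trans _ (uB s))// mag_sum.
Qed.

Lemma abs_bound_ge0 u B : abs_bound u B -> 0 <= B.
Proof. by move=> /(_ fset0); rewrite big_seq_fset0. Qed.

Lemma abs_bound_le u v B : (forall i, mag (u i) <= mag (v i)) ->
  abs_bound v B -> abs_bound u B.
Proof. by move=> uv vB s; rewrite (le_trans _ (vB s))// ler_sum. Qed.

Lemma abs_boundW u B B' : B <= B' -> abs_bound u B -> abs_bound u B'.
Proof. by move=> BB uB s; rewrite (le_trans (uB s)). Qed.

Lemma abs_bound_term u B i : abs_bound u B -> mag (u i) <= B.
Proof. by move=> /(_ [fset i]%fset); rewrite big_seq_fset1. Qed.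

Lemma abs_boundD u v A B : abs_bound u A -> abs_bound v B ->
  abs_bound (fun i => u i + v i) (A + B).
Proof.
move=> uA vB s; apply: le_trans (lerD (uA s) (vB s)).
by rewrite -big_split ler_sum// => i _; apply: magD.
Qed.

Lemma abs_boundZ c u B : abs_bound u B ->
  abs_bound (fun i => c * u i) (mag c * B).
Proof.
move=> uB s; under eq_bigr do rewrite magM.
by rewrite -mulr_sumr ler_wpM2l// mag_ge0.
Qed.

(** Over an ordered field with suprema, a nonnegative family with bounded
    finite sums converges to the supremum of these sums. *)
Lemma has_sum_ge0 (v : I -> R) B : (forall i, 0 <= v i) ->
  (forall s : {fset I}, \sum_(i <- s) v i <= B) ->
  exists l : R, has_sum (fun i => (v i)%:C) l%:C.
Proof.
move=> v0 vB; pose A := [set x : R | exists s : {fset I}, x = \sum_(i <- s) v i].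
have A1 : has_sup A.
  split; first by exists (\sum_(i <- (fset0 : {fset I})) v i), fset0.
  by exists B => _ [s ->].
exists (sup A) => e e0; have [_ [s0 ->] hs0] := sup_adherent e0 A1.
exists s0 => s ss; rewrite -(rmorph_sum (@real_complex R)) -rmorphB mag_real ltr_norml.
have h1 : \sum_(i <- s0) v i <= \sum_(i <- s) v i.
  rewrite (big_fsetID _ (mem s0) s) /=.
  rewrite (_ : [fset x in s | x \in s0]%fset = s0) ?lerDl ?sumr_ge0//.
  by apply/fsetP => i; rewrite !inE /= andb_idl// => /(fsubsetP ss).
have h2 : \sum_(i <- s) v i <= sup A by apply: (sup_upper_bound A1); exists s.
by apply/andP; split; lra.
Qed.

(** Real and imaginary parts are each the difference of two nonnegative families
    with bounded finite sums. *)
Lemma has_sum_ex u B : abs_bound u B -> exists l, has_sum u l.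
Proof.
move=> uB.
have pos (v : I -> R) : (forall i, `|v i| <= mag (u i)) ->
    exists l, has_sum (fun i => (v i)%:C) l.
  move=> vu.
  have [|s|a ha] := @has_sum_ge0 (fun i => Num.max (v i) 0) B.
  - by move=> i; rewrite le_max lexx orbT.
  - rewrite (le_trans _ (uB s))// ler_sum// => i _.
    by rewrite ge_max mag_ge0 andbT (le_trans _ (vu i))// ler_norm.
  have [|s|b hb] := @has_sum_ge0 (fun i => Num.max (- v i) 0) B.
  - by move=> i; rewrite le_max lexx orbT.
  - rewrite (le_trans _ (uB s))// ler_sum// => i _.
    by rewrite ge_max mag_ge0 andbT (le_trans _ (vu i))// -normrN ler_norm.
  exists (a%:C + (-1) * b%:C).
  have := has_sumD ha (has_sumZ (-1) hb); congr has_sum; apply/funext => i /=.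
  rewrite mulN1r -rmorphN -rmorphD /=; congr (_%:C).
  have [vi|/ltW vi] := leP 0 (v i).
    by rewrite max_r ?oppr_le0// subr0.
  by rewrite max_l ?oppr_ge0// sub0r opprK.
have [a ha] := pos (fun i => complex.Re (u i)) (fun i => mag_Re _).
have [b hb] := pos (fun i => complex.Im (u i)) (fun i => mag_Im _).
exists (a + 'i%C * b); have := has_sumD ha (has_sumZ 'i%C hb).
by congr has_sum; apply/funext => i; rewrite -complexE.
Qed.

Lemma csum_unique u l : has_sum u l -> csum u = l.
Proof.
move=> h; rewrite /csum; case: xgetP => [x _ hx|/(_ l)//].
exact: has_sum_uniq hx h.
Qed.

Lemma csumP u B : abs_bound u B -> has_sum u (csum u).
Proof. by move=> /has_sum_ex [l h]; rewrite (csum_unique h). Qed.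

End Basics.

(** Finite sums of a family that vanishes outside of the range of an injection
    are finite sums over the source of this injection. *)
Lemma fset_preimage (I J : choiceType) (h : I -> J) (t : {fset J}) :
  injective h -> exists2 s : {fset I},
    (forall i, h i \in t -> i \in s) &
    forall (V : nmodType) (F : J -> V), (forall j, (forall i, j != h i) -> F j = 0) ->
      \sum_(j <- t) F j = \sum_(i <- s) F (h i).
Proof.
move=> hi.
pose t1 : {fset J} := [fset j in t | `[< exists i, j = h i >]]%fset.
have t1t : (t1 `<=` t)%fset by apply: fset_sub.
have hex (j : J) : exists i : option I, forall k, j = h k -> i = Some k.
  have [[i ->]|n] := pselect (exists k, j = h k).
    by exists (Some i) => k /hi ->.
  by exists None => k jk; case: n; exists k.
have [g hg] := choice hex.
have hgK k : g (h k) = Some k by apply: hg.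
pose s : {fset I} := [fset i | i in pmap g t1]%fset.
have ts : t1 = [fset h i | i in s]%fset.
  apply/fsetP => j; apply/idP/imfsetP => [jt| [i ]].
    move: (jt); rewrite !inE /= => /andP[_ /asboolP [i ji]]; exists i => //=.
    rewrite !inE /= mem_pmap; apply/mapP; exists j => //.
    by rewrite ji hgK.
  rewrite /= !inE /= mem_pmap => /mapP [j' j't].
  move: (j't); rewrite !inE /= => /andP[_ /asboolP [i' ji']] + ->.
  by move: j't; rewrite ji' hgK => + [->]; rewrite !inE.
exists s => [i hit|V F F0].
  have : h i \in t1 by rewrite !inE /= hit /=; apply/asboolP; exists i.
  by rewrite ts => /imfsetP [k /= ks /hi ->].
rewrite -(big_fset_incl _ t1t); last first.
  move=> j jt; rewrite !inE /= jt /= => /asboolPn n.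
  by apply: F0 => i; apply/eqP => ji; apply: n; exists i.
by rewrite ts big_imfset //= => ? ? _ _; apply: hi.
Qed.

Lemma has_sum_inj (I J : choiceType) (h : I -> J) (v : J -> C) l :
  injective h -> (forall j, (forall i, j != h i) -> v j = 0) ->
  has_sum (v \o h) l -> has_sum v l.
Proof.
move=> hi v0 hs e e0; have [s0 hs0] := hs _ e0.
exists [fset h i | i in s0]%fset => t ht.
have [s sP ->//] := fset_preimage t hi.
apply: hs0; apply/fsubsetP => i is0; apply: sP.
by rewrite (fsubsetP ht)// in_imfset.
Qed.

Lemma abs_bound_ext (I J : choiceType) (h : I -> J) (v : J -> C) B :
  injective h -> (forall j, (forall i, j != h i) -> v j = 0) ->
  abs_bound (v \o h) B -> abs_bound v B.
Proof.
move=> hi v0 vB t; have [s _ ->] := fset_preimage t hi; first exact: vB.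
by move=> j /v0 ->; rewrite mag0.
Qed.

Lemma abs_bound_inj (I J : choiceType) (h : I -> J) (v : J -> C) B :
  injective h -> abs_bound v B -> abs_bound (v \o h) B.
Proof.
move=> hi vB s; have := vB [fset h i | i in s]%fset.
by rewrite big_imfset //= => ? ? _ _; apply: hi.
Qed.

Lemma in_fset_iota N i : (i \in [fset i | i in iota 0 N]%fset) = (i < N)%N.
Proof.
apply/imfsetP/idP; first by case=> j /= + ->; rewrite mem_iota.
by move=> iN; exists i; rewrite //= mem_iota.
Qed.

Lemma sum_fset_iota (V : nmodType) N (F : nat -> V) :
  \sum_(i <- iota 0 N) F i = \sum_(i <- [fset i | i in iota 0 N]%fset) F i.
Proof.
apply: perm_big; apply: uniq_perm; rewrite ?iota_uniq ?fset_uniq// => i.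
by rewrite in_fset_iota mem_iota.
Qed.

Lemma abs_bound_nat (u : nat -> C) B :
  (forall N, \sum_(n < N) mag (u n) <= B) -> abs_bound u B.
Proof.
move=> uB s.
pose N := (\max_(i <- s) i).+1.
have sN : (s `<=` [fset i | i in iota 0 N])%fset.
  apply/fsubsetP => i si; have iN : (i < N)%N.
    by rewrite ltnS (big_rem i) //= leq_maxl.
  by rewrite in_fset_iota.
apply: le_trans (uB N).
rewrite -(big_mkord xpredT (fun n => mag (u n))) /index_iota subn0.
have -> : \sum_(i <- iota 0 N) mag (u i) =
    \sum_(i <- [fset i | i in iota 0 N]%fset) mag (u i).
  exact: sum_fset_iota.
rewrite (big_fsetID _ (mem s) [fset i | i in iota 0 N]%fset) /=.
rewrite (_ : [fset x in _ | x \in s]%fset = s).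
  by rewrite lerDl sumr_ge0// => i _; apply: mag_ge0.
apply/fsetP => i; apply/imfsetP/idP => [ [j /= + ->]|si].
  by rewrite inE => /andP[].
by exists i => //; rewrite inE /= si andbT (fsubsetP sN).
Qed.

Lemma has_sum_series (u : nat -> C) l : has_sum u l -> series u @ \oo --> l.
Proof.
move=> h; apply/cvgCP => e e0; have [s0 hs0] := h _ e0.
exists (\max_(i <- s0) i).+1 => n sn; rewrite /series /= /index_iota subn0.
have -> : \sum_(i <- iota 0 n) u i =
    \sum_(i <- [fset i | i in iota 0 n]%fset) u i.
  exact: sum_fset_iota.
apply: hs0; apply/fsubsetP => i is0; have iN : (i < n)%N.
  by apply: leq_trans sn; rewrite ltnS (big_rem i) //= leq_maxl.
by rewrite in_fset_iota.
Qed.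

Lemma sum_fset_rect (V : nmodType) (I J : choiceType) (t : {fset I}) (K : {fset J})
    (F : I * J -> V) :
  \sum_(p <- [fset ((i, j) : I * J) | i in t, j in K]%fset) F p =
  \sum_(i <- t) \sum_(j <- K) F (i, j).
Proof. by rewrite big_imfset2 //= => -[? ?] [? ?] _ _ /= [-> ->]. Qed.

(** The auxiliary K0 lets the chosen columns contain those of any rectangle
    given beforehand. *)
Lemma has_sum_finitely_many (I J : choiceType) (u : I * J -> C) (r : I -> C)
    (t : {fset I}) (K0 : {fset J}) (d : R) :
  (forall i, has_sum (fun j => u (i, j)) (r i)) -> 0 < d ->
  exists2 K : {fset J}, (K0 `<=` K)%fset &
    forall i, i \in t -> mag (\sum_(j <- K) u (i, j) - r i) < d.
Proof.
move=> hr d0; have [S hS] := choice (fun i => hr i _ d0).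
exists (K0 `|` \bigcup_(i <- t) S i)%fset => [|i it]; first exact: fsubsetUl.
by apply: hS; rewrite (fsubset_trans _ (fsubsetUr _ _))// bigfcup_sup.
Qed.

(** Summation by rows: rows of a large finite rectangle are close to the full
    row sums, uniformly in the finitely many rows at hand. *)
Lemma has_sum_rows (I J : choiceType) (u : I * J -> C) (r : I -> C) l :
  has_sum u l -> (forall i, has_sum (fun j => u (i, j)) (r i)) -> has_sum r l.
Proof.
move=> hu hr e e0; have e2 : 0 < e / 2 by lra.
have [s0 hs0] := hu _ e2.
exists [fset p.1 | p in s0]%fset => t ht.
pose d := e / 2 / (size t).+1%:R.
have d0 : 0 < d by rewrite divr_gt0.
have [K K0 hK] := has_sum_finitely_many t [fset p.2 | p in s0]%fset hr d0.
pose W : {fset I * J} := [fset ((i, j) : I * J) | i in t, j in K]%fset.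
have sW : (s0 `<=` W)%fset.
  apply/fsubsetP => -[i j] ps; apply/imfset2P; exists i => /=.
    by apply: (fsubsetP ht); apply/imfsetP; exists (i, j).
  exists j => //=; apply: (fsubsetP K0).
  by apply/imfsetP; exists (i, j).
have := hs0 _ sW; rewrite sum_fset_rect => h1.
have h2 : mag (\sum_(i <- t) r i - \sum_(i <- t) \sum_(j <- K) u (i, j)) <= e / 2.
  rewrite -sumrB (le_trans (mag_sum _ _ _))//.
  apply: (@le_trans _ _ (\sum_(i <- t) d)).
    rewrite big_seq [leRHS]big_seq ler_sum// => i it.
    by rewrite magBC ltW// hK.
  rewrite big_const_seq count_predT iter_addr_0 -[leLHS]mulr_natr /d.
  rewrite -[leLHS]mulrA; apply: ler_piMr; first exact: ltW.
  by rewrite ler_pdivrMl ?ltr0n// mulr1 ler_nat.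
rewrite (_ : _ - l = (\sum_(i <- t) r i - \sum_(i <- t) \sum_(j <- K) u (i, j)) +
  (\sum_(i <- t) \sum_(j <- K) u (i, j) - l)); last by ring.
by rewrite (le_lt_trans (magD _ _))//; lra.
Qed.

Lemma abs_bound_rows (I J : choiceType) (u : I * J -> C) (r : I -> C) B :
  abs_bound u B -> (forall i, has_sum (fun j => u (i, j)) (r i)) -> abs_bound r B.
Proof.
move=> uB hr t; apply/ler_addgt0Pr => e e0.
pose d := e / (size t).+1%:R.
have d0 : 0 < d by rewrite divr_gt0.
have [K _ hK] := has_sum_finitely_many t fset0 hr d0.
have := uB [fset ((i, j) : I * J) | i in t, j in K]%fset.
rewrite sum_fset_rect => h1.
apply: (@le_trans _ _ (\sum_(i <- t) (\sum_(j <- K) mag (u (i, j)) + d))).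
  rewrite big_seq [leRHS]big_seq ler_sum// => i it.
  rewrite (_ : r i = \sum_(j <- K) u (i, j) - (\sum_(j <- K) u (i, j) - r i)); last by ring.
  by rewrite (le_trans (magB _ _))// lerD ?mag_sum// ltW// hK.
rewrite big_split lerD//= big_const_seq count_predT iter_addr_0 -[leLHS]mulr_natr /d.
rewrite -[leLHS]mulrA; apply: ler_piMr; first exact: ltW.
by rewrite ler_pdivrMl ?ltr0n// mulr1 ler_nat.
Qed.

Lemma abs_bound_row (I J : choiceType) (u : I * J -> C) B i :
  abs_bound u B -> abs_bound (fun j => u (i, j)) B.
Proof. by move=> uB; apply: (@abs_bound_inj _ _ (pair i) u) => // ? ? []. Qed.

Lemma abs_bound_swap (I J : choiceType) (u : I * J -> C) B :
  abs_bound u B -> abs_bound (fun p => u (p.2, p.1)) B.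
Proof.
by move=> uB; apply: (@abs_bound_inj _ _ (fun p => (p.2, p.1)) u) => // -[? ?] [? ?] [-> ->].
Qed.

Lemma abs_bound_pair (I J : choiceType) (u : I * J -> C) (b : I -> R) B :
  (forall i, abs_bound (fun j => u (i, j)) (b i)) ->
  (forall s : {fset I}, \sum_(i <- s) b i <= B) -> abs_bound u B.
Proof.
move=> ub bB s; pose t : {fset I} := [fset p.1 | p in s]%fset.
rewrite (partition_big_imfset _ fst).
rewrite (le_trans _ (bB t))// ler_sum// => i _.
have := ub i [fset p.2 | p in [fset p in s | p.1 == i]]%fset.
rewrite big_imfset /=; last first.
  by move=> [a b1] [a' b'] /=; rewrite !inE /= => /andP[_ /eqP->] /andP[_ /eqP->] ->.
rewrite big_fset /=; apply: le_trans.
by rewrite le_eqVlt; apply/orP; left; apply/eqP; apply: eq_bigr => -[a b1] /= /eqP ->.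
Qed.

(** Both iterated sums compute the sum of the double family, once by rows and
    once by columns. *)
Lemma csum_fubini (I J : choiceType) (u : I * J -> C) B : abs_bound u B ->
  exists l, has_sum (fun i => csum (fun j => u (i, j))) l
         /\ has_sum (fun j => csum (fun i => u (i, j))) l.
Proof.
move=> uB; have [l hl] := has_sum_ex uB; exists l; split.
  by apply: (has_sum_rows hl) => i; apply: csumP (abs_bound_row i uB).
have hl' : has_sum (fun p => u (p.2, p.1)) l.
  pose sw := fun p : J * I => (p.2, p.1).
  apply: (@has_sum_inj _ _ (fun p : I * J => (p.2, p.1)) (u \o sw)).
  - by move=> [? ?] [? ?] [-> ->].
  - by move=> [j i] /(_ (i, j)); rewrite eqxx.
  - by move: hl; congr has_sum; apply/funext => -[].
apply: (has_sum_rows hl') => j.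
exact: csumP (abs_bound_row j (abs_bound_swap uB)).
Qed.

Lemma abs_bound_mul (I J : choiceType) (u : I -> C) (v : J -> C) A B :
  abs_bound u A -> abs_bound v B ->
  abs_bound (fun p : I * J => u p.1 * v p.2) (A * B).
Proof.
move=> uA vB; apply: (@abs_bound_pair _ _ _ (fun i => mag (u i) * B)).
  by move=> i; have := abs_boundZ (u i) vB.
by move=> s; rewrite -mulr_suml ler_wpM2r// (abs_bound_ge0 vB).
Qed.

Lemma has_sum_mul (I J : choiceType) (u : I -> C) (v : J -> C) A B l m :
  abs_bound u A -> abs_bound v B -> has_sum u l -> has_sum v m ->
  has_sum (fun p : I * J => u p.1 * v p.2) (l * m).
Proof.
move=> uA vB ul vm; have uv := abs_bound_mul uA vB.
have [k hk] := has_sum_ex uv.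
suff -> : l * m = k by [].
have h : has_sum (fun i => u i * m) k.
  by apply: (has_sum_rows hk) => i; have := has_sumZ (u i) vm.
apply: (has_sum_uniq _ h); rewrite mulrC.
by have := has_sumZ m ul; congr has_sum; apply/funext => i; rewrite mulrC.
Qed.

End UnconditionalSums.

(** * Formal power series *)

Section PowerSeries.
Variable K : comNzRingType.

(** Formal power series over K, as coefficient sequences with the Cauchy
    product; a fresh name keeps them apart from functions with the pointwise
    product. *)
Definition fps : Type := nat -> K.

HB.instance Definition _ := gen_eqMixin fps.
HB.instance Definition _ := gen_choiceMixin fps.

Implicit Types a b c : fps.

Definition fps_add a b : fps := fun n => a n + b n.
Definition fps_opp a : fps := fun n => - a n.
Definition fps_mul a b : fps := fun n => \sum_(i < n.+1) a i * b (n - i)%N.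
Definition fpsC (x : K) : fps := fun n => if n == 0%N then x else 0.

Fact fps_addA : associative fps_add.
Proof. by move=> a b c; apply/funext => n; rewrite /fps_add addrA. Qed.
Fact fps_addC : commutative fps_add.
Proof. by move=> a b; apply/funext => n; rewrite /fps_add addrC. Qed.
Fact fps_add0 : left_id (fpsC 0) fps_add.
Proof. by move=> a; apply/funext => n; rewrite /fps_add /fpsC if_same add0r. Qed.
Fact fps_addN : left_inverse (fpsC 0) fps_opp fps_add.
Proof.
by move=> a; apply/funext => n; rewrite /fps_add /fpsC if_same addNr.
Qed.

HB.instance Definition _ :=
  GRing.isZmodule.Build fps fps_addA fps_addC fps_add0 fps_addN.

(** Up to any given order, the Cauchy product is the product of truncations;
    this transports the ring laws from polynomials. *)
Fact fps_mul_trunc N a b n : (n <= N)%N ->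
  fps_mul a b n = ((\poly_(i < N.+1) a i) * (\poly_(i < N.+1) b i))`_n.
Proof.
move=> nN; rewrite coefM; apply: eq_bigr => -[i /= iN] _.
have le_in : (i <= n)%N by rewrite -ltnS.
by rewrite !coef_poly !ltnS (leq_trans le_in nN) (leq_trans (leq_subr i n) nN).
Qed.

Fact fps_mulC : commutative fps_mul.
Proof.
by move=> a b; apply/funext => n; rewrite !(@fps_mul_trunc n)// mulrC.
Qed.

Fact fps_mulA : associative fps_mul.
Proof.
have tri a b c n : fps_mul (fps_mul a b) c n =
    ((\poly_(i < n.+1) a i) * (\poly_(i < n.+1) b i) * (\poly_(i < n.+1) c i))`_n.
  rewrite coefM [LHS]/fps_mul; apply: eq_bigr => -[i /= iN] _.
  by rewrite (@fps_mul_trunc n) -1?ltnS// coef_poly ltnS leq_subr.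
move=> a b c; apply/funext => n.
by rewrite fps_mulC !tri mulrC mulrA.
Qed.

Fact fps_mul1 : left_id (fpsC 1) fps_mul.
Proof.
move=> a; apply/funext => n; rewrite /fps_mul big_ord_recl /= mul1r subn0.
by rewrite big1 ?addr0// => i _; rewrite mul0r.
Qed.

Fact fps_mulDl : left_distributive fps_mul fps_add.
Proof.
move=> a b c; apply/funext => n; rewrite /fps_add /fps_mul -big_split /=.
by apply: eq_bigr => i _; rewrite mulrDl.
Qed.

Fact fps_1neq0 : fpsC 1 != fpsC 0.
Proof.
by apply/eqP => /(congr1 (fun f : fps => f 0%N))/eqP; rewrite /fpsC /= oner_eq0.
Qed.

HB.instance Definition _ := GRing.Zmodule_isComNzRing.Build fps
  fps_mulA fps_mulC fps_mul1 fps_mulDl fps_1neq0.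

Lemma fps_ext a b : (forall n, a n = b n) -> a = b.
Proof. by move=> h; apply/funext. Qed.

Lemma fpsD a b n : (a + b) n = a n + b n. Proof. by []. Qed.
Lemma fpsB a b n : (a - b) n = a n - b n. Proof. by []. Qed.
Lemma fps0 n : (0 : fps) n = 0. Proof. by rewrite -[0]/(fpsC 0) /fpsC if_same. Qed.
Lemma fps1 n : (1 : fps) n = (n == 0%N)%:R.
Proof. by rewrite -[1]/(fpsC 1) /fpsC; case: eqP. Qed.
Lemma fpsM a b n : (a * b) n = \sum_(i < n.+1) a i * b (n - i)%N.
Proof. by []. Qed.

Lemma fps_sum (I : Type) (s : seq I) (P : pred I) (F : I -> fps) n :
  (\sum_(i <- s | P i) F i) n = \sum_(i <- s | P i) F i n.
Proof. by elim/big_rec2: _ => [|i a b _ <-]; rewrite ?fps0. Qed.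

Lemma fpsCM x a n : (fpsC x * a) n = x * a n.
Proof.
rewrite fpsM big_ord_recl /= subn0 big1 ?addr0// => i _.
by rewrite /fpsC mul0r.
Qed.

Lemma fpsC_zmod : zmod_morphism fpsC.
Proof.
by move=> x y; apply: fps_ext => n; rewrite fpsB /fpsC; case: eqP => _; rewrite ?subr0.
Qed.

Lemma fpsC_monoid : monoid_morphism fpsC.
Proof.
by split=> // x y; apply: fps_ext => n; rewrite fpsCM /fpsC; case: eqP; rewrite ?mulr0.
Qed.

HB.instance Definition _ := GRing.isZmodMorphism.Build K fps fpsC fpsC_zmod.
HB.instance Definition _ := GRing.isMonoidMorphism.Build K fps fpsC fpsC_monoid.

Definition fpsX : fps := fun n => (n == 1%N)%:R.

Lemma fpsXM a n : (fpsX * a) n = if n is m.+1 then a m else 0.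
Proof.
case: n => [|n]; first by rewrite fpsM big_ord1 /fpsX mul0r.
rewrite fpsM big_ord_recl /fpsX mul0r add0r big_ord_recl /= mul1r.
by rewrite big1 ?addr0 ?subSS ?subn0// => i _; rewrite mul0r.
Qed.

Lemma fpsXnM k a n : (fpsX ^+ k * a) n = if (n < k)%N then 0 else a (n - k)%N.
Proof.
elim: k n => [|k IH] n; first by rewrite expr0 mul1r subn0.
rewrite exprS -mulrA fpsXM; case: n => [//|n].
by rewrite IH ltnS subSS.
Qed.

(** The geometric series 1/(1 - wX). *)
Definition fps_geom (w : K) : fps := fun n => w ^+ n.

Lemma fps_geomE w : (1 - fpsC w * fpsX) * fps_geom w = 1.
Proof.
rewrite mulrBl mul1r -mulrA; apply: fps_ext => n.
rewrite fpsB fpsCM fpsXM fps1 /fps_geom; case: n => [|n].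
  by rewrite mulr0 subr0 expr0.
by rewrite exprS subrr.
Qed.

(** The Euler derivation X d/dX. *)
Definition theta a : fps := fun n => n%:R * a n.

Lemma theta_zmod : zmod_morphism theta.
Proof. by move=> a b; apply: fps_ext => n; rewrite /theta !fpsB mulrBr. Qed.

HB.instance Definition _ := GRing.isZmodMorphism.Build fps fps theta theta_zmod.

Lemma thetaM a b : theta (a * b) = theta a * b + a * theta b.
Proof.
apply: fps_ext => n; rewrite fpsD /theta !fpsM mulr_sumr -big_split /=.
apply: eq_bigr => -[i /= iN] _.
have -> : (n%:R : K) = i%:R + (n - i)%:R by rewrite -natrD subnKC.
by ring.
Qed.

Lemma thetaC x : theta (fpsC x) = 0.
Proof.
by apply: fps_ext => -[|n]; rewrite /theta fps0 ?mul0r// /fpsC mulr0.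
Qed.

Lemma thetaX : theta fpsX = fpsX.
Proof.
by apply: fps_ext => -[|[|n]]; rewrite /theta /fpsX ?mul0r ?mul1r// mulr0.
Qed.

Lemma thetaXn k : theta (fpsX ^+ k) = fpsC k%:R * fpsX ^+ k.
Proof.
apply: fps_ext => n; rewrite fpsCM /theta.
rewrite -[fpsX ^+ k]mulr1 fpsXnM fps1; case: ltnP => kn; first by rewrite !mulr0.
have [/eqP e|_] := boolP (n - k == 0)%N; last by rewrite !mulr0.
by have -> : n = k by lia.
Qed.

End PowerSeries.

Arguments fpsX {K}.

(** * Absolutely convergent power series *)

Section Evaluation.
Variable R : realType.
Local Notation C := R[i].
Local Notation fps := (fps R[i]).
Implicit Types (a b : fps) (z : C) (r : R).

(** The weighted l1 norm of a power series is at most B: the Banach algebra in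
    which all power series below converge. *)
Definition bnd a r (B : R) : Prop := abs_bound (fun n => a n * r%:C ^+ n) B.

Definition ev a z : C := csum (fun n => a n * z ^+ n).

Lemma bnd_nat a r B : 0 <= r ->
  (forall N, \sum_(n < N) mag (a n) * r ^+ n <= B) -> bnd a r B.
Proof.
move=> r0 h; apply: abs_bound_nat => N; apply: le_trans (h N).
by rewrite ler_sum// => i _; rewrite magM magX mag_real ger0_norm.
Qed.

Lemma bnd_abs a r B z : bnd a r B -> mag z <= r ->
  abs_bound (fun n => a n * z ^+ n) B.
Proof.
move=> aB zr; apply: abs_bound_le aB => n; rewrite !magM !magX mag_real.
rewrite ler_wpM2l ?mag_ge0// lerXn2r ?nnegrE ?mag_ge0//.
by rewrite (le_trans zr) ?ler_norm.
Qed.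

Lemma bndS a r r' B : 0 <= r' <= r -> bnd a r B -> bnd a r' B.
Proof.
by move=> /andP[r0 rr] aB; apply: (bnd_abs aB); rewrite mag_real ger0_norm.
Qed.

Lemma bndW a r B B' : B <= B' -> bnd a r B -> bnd a r B'.
Proof. exact: abs_boundW. Qed.

Lemma bnd_le a b r B : (forall n, mag (a n) <= mag (b n)) -> bnd b r B -> bnd a r B.
Proof.
by move=> h; apply: abs_bound_le => n; rewrite !magM ler_wpM2r ?mag_ge0.
Qed.

Lemma bnd_ge0 a r B : bnd a r B -> 0 <= B.
Proof. exact: abs_bound_ge0. Qed.

Lemma ev_hs a r B z : bnd a r B -> mag z <= r ->
  has_sum (fun n => a n * z ^+ n) (ev a z).
Proof. by move=> aB zr; apply: csumP (bnd_abs aB zr). Qed.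

Lemma ev_le a r B z : bnd a r B -> mag z <= r -> mag (ev a z) <= B.
Proof. by move=> aB zr; apply: has_sum_le (bnd_abs aB zr) (ev_hs aB zr). Qed.

Lemma bndD a b r A B : bnd a r A -> bnd b r B -> bnd (a + b) r (A + B).
Proof.
move=> aA bB; have := abs_boundD aA bB.
by congr abs_bound; apply/funext => n; rewrite -mulrDl.
Qed.

Lemma evD a b r A B z : bnd a r A -> bnd b r B -> mag z <= r ->
  ev (a + b) z = ev a z + ev b z.
Proof.
move=> aA bB zr; apply: csum_unique.
have := has_sumD (ev_hs aA zr) (ev_hs bB zr).
by congr has_sum; apply/funext => n; rewrite -mulrDl.
Qed.

Lemma bndZ c a r B : bnd a r B -> bnd (fpsC c * a) r (mag c * B).
Proof.
move=> aB; have := abs_boundZ c aB.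
by congr abs_bound; apply/funext => n; rewrite fpsCM mulrA.
Qed.

Lemma evZ c a r B z : bnd a r B -> mag z <= r ->
  ev (fpsC c * a) z = c * ev a z.
Proof.
move=> aB zr; apply: csum_unique; have := has_sumZ c (ev_hs aB zr).
by congr has_sum; apply/funext => n; rewrite fpsCM mulrA.
Qed.

Lemma ev_fin a N z : (forall n, (N <= n)%N -> a n = 0) ->
  ev a z = \sum_(n < N) a n * z ^+ n.
Proof.
move=> a0; apply: csum_unique.
rewrite -(big_mkord xpredT (fun n => a n * z ^+ n)) /index_iota subn0.
rewrite sum_fset_iota; apply: has_sum_fin => n; rewrite in_fset_iota -leqNgt => h.
by rewrite a0// mul0r.
Qed.

Lemma bnd_fin a N r : 0 <= r -> (forall n, (N <= n)%N -> a n = 0) ->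
  bnd a r (\sum_(n < N) mag (a n) * r ^+ n).
Proof.
move=> r0 a0; apply: bnd_nat => // M.
rewrite -!(big_mkord xpredT (fun n => mag (a n) * r ^+ n)).
have [MN|/ltnW NM] := leqP M N.
  rewrite (big_cat_nat (leq0n M) MN)//= lerDl sumr_ge0// => i _.
  by rewrite mulr_ge0 ?mag_ge0 ?exprn_ge0.
rewrite (big_cat_nat (leq0n N) NM)//= [X in _ + X]big1_seq ?addr0// => i /andP[_].
by rewrite mem_index_iota => /andP[h _]; rewrite a0// mag0 mul0r.
Qed.

Lemma evC c z : ev (fpsC c) z = c.
Proof.
rewrite (@ev_fin _ 1) => [|[]//]; by rewrite big_ord1 /fpsC mulr1.
Qed.

Lemma bndC c r : 0 <= r -> bnd (fpsC c) r (mag c).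
Proof.
move=> r0; have : forall n, (1 <= n)%N -> fpsC c n = 0 by case.
by move=> /(bnd_fin r0); rewrite big_ord1 /fpsC /= mulr1.
Qed.

Lemma evX z : ev fpsX z = z.
Proof.
rewrite (@ev_fin _ 2) => [|[|[]]//]; rewrite big_ord_recl big_ord1 /fpsX /=.
by rewrite mul0r add0r mul1r.
Qed.

Lemma bnd_X r : 0 <= r -> bnd fpsX r r.
Proof.
move=> r0; have : forall n, (2 <= n)%N -> (fpsX : fps) n = 0 by case=> [|[]].
move=> /(bnd_fin r0); rewrite big_ord_recl big_ord1.
have -> : mag ((fpsX : fps) (ord0 : 'I_2)) = 0 by apply: mag0.
have -> : mag ((fpsX : fps) (lift ord0 (ord0 : 'I_1))) = 1 by apply: mag1.
by rewrite mul0r add0r mul1r.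
Qed.

(** Antidiagonals: the coefficients of a product are the finite antidiagonal
    sums of the absolutely summable family of products of terms. *)
Definition diag_idx (p : nat * nat) : nat * nat := ((p.1 + p.2)%N, p.1).

Definition diag_fam (u : nat * nat -> C) (p : nat * nat) : C :=
  if (p.2 <= p.1)%N then u (p.2, (p.1 - p.2)%N) else 0.

Lemma diag_idx_inj : injective diag_idx.
Proof. by move=> [i j] [i' j'] [+ ii]; rewrite ii => /addnI ->. Qed.

Lemma diag_fam_idx u : diag_fam u \o diag_idx = u.
Proof.
by apply/funext => -[i j]; rewrite /diag_fam /diag_idx /= leq_addr addKn.
Qed.

Lemma diag_fam_out u p : (forall q, p != diag_idx q) -> diag_fam u p = 0.
Proof.
case: p => n i h; rewrite /diag_fam /=; case: leqP => // ni.
by move: (h (i, (n - i)%N)); rewrite /diag_idx /= subnKC// eqxx.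
Qed.

Lemma diag_row u n : has_sum (fun i => diag_fam u (n, i))
  (\sum_(i < n.+1) u (val i, (n - i)%N)).
Proof.
have -> : \sum_(i < n.+1) u (val i, (n - i)%N) =
    \sum_(i <- [fset i | i in iota 0 n.+1]%fset) diag_fam u (n, i).
  rewrite -sum_fset_iota -[in iota _ _](subn0 n.+1) -/(index_iota _ _) big_mkord.
  by apply: eq_bigr => i _; rewrite /diag_fam /= -ltnS ltn_ord.
apply: has_sum_fin => i; rewrite in_fset_iota ltnS /diag_fam /= => /negbTE ->.
by [].
Qed.

Lemma abs_bound_diag (u : nat * nat -> C) B : abs_bound u B ->
  abs_bound (fun n => \sum_(i < n.+1) u (val i, (n - i)%N)) B.
Proof.
move=> uB; apply: (@abs_bound_rows _ _ _ (diag_fam u)); last exact: diag_row.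
by apply: (abs_bound_ext diag_idx_inj (@diag_fam_out u)); rewrite diag_fam_idx.
Qed.

Lemma has_sum_diag (u : nat * nat -> C) l : has_sum u l ->
  has_sum (fun n => \sum_(i < n.+1) u (val i, (n - i)%N)) l.
Proof.
move=> ul; apply: (@has_sum_rows _ _ _ (diag_fam u)); last exact: diag_row.
by apply: (has_sum_inj diag_idx_inj (@diag_fam_out u)); rewrite diag_fam_idx.
Qed.

Let prod_diag a b z n :
  \sum_(i < n.+1) a (val i) * z ^+ i * (b (n - i)%N * z ^+ (n - i)) =
  (a * b) n * z ^+ n.
Proof.
rewrite fpsM mulr_suml; apply: eq_bigr => -[i /= iN] _.
have -> : z ^+ n = z ^+ i * z ^+ (n - i) by rewrite -exprD subnKC.
by ring.
Qed.

(** Young's inequality for the weighted l1 norm. *)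
Lemma bndM a b r A B : bnd a r A -> bnd b r B -> bnd (a * b) r (A * B).
Proof.
move=> aA bB; have := abs_bound_diag (abs_bound_mul aA bB).
by congr abs_bound; apply/funext => n /=; apply: prod_diag.
Qed.

Lemma evM a b r A B z : bnd a r A -> bnd b r B -> mag z <= r ->
  ev (a * b) z = ev a z * ev b z.
Proof.
move=> aA bB zr; apply: csum_unique.
have := has_sum_diag (has_sum_mul (bnd_abs aA zr) (bnd_abs bB zr)
  (ev_hs aA zr) (ev_hs bB zr)).
by congr has_sum; apply/funext => n /=; apply: prod_diag.
Qed.

Lemma bnd_exp a r A n : 0 <= r -> bnd a r A -> bnd (a ^+ n) r (A ^+ n).
Proof.
move=> r0 aA; elim: n => [|n IH]; last by rewrite !exprS; apply: bndM.
by have := bndC 1 r0; rewrite mag1.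
Qed.

Lemma ev_exp a r A z n : 0 <= r -> bnd a r A -> mag z <= r ->
  ev (a ^+ n) z = ev a z ^+ n.
Proof.
move=> r0 aA zr; elim: n => [|n IH]; first exact: evC.
by rewrite !exprS (evM aA (bnd_exp n r0 aA) zr) IH.
Qed.

Lemma bndXnM a r B k : 0 <= r -> bnd a r B -> bnd (fpsX ^+ k * a) r (r ^+ k * B).
Proof. by move=> r0 aB; apply: bndM aB; apply: bnd_exp => //; apply: bnd_X. Qed.

Lemma evXnM a r B z k : 0 <= r -> bnd a r B -> mag z <= r ->
  ev (fpsX ^+ k * a) z = z ^+ k * ev a z.
Proof.
move=> r0 aB zr; rewrite (evM (bnd_exp k r0 (bnd_X r0)) aB zr).
by rewrite (ev_exp k r0 (bnd_X r0) zr) evX.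
Qed.

Lemma bnd_geom w r : 0 <= r -> mag w * r < 1 ->
  bnd (fps_geom w) r (1 - mag w * r)^-1.
Proof.
move=> r0 wr; apply: bnd_nat => // N; have d0 : 0 < 1 - mag w * r by lra.
have -> : \sum_(n < N) mag (fps_geom w n) * r ^+ n = \sum_(n < N) (mag w * r) ^+ n.
  by apply: eq_bigr => i _; rewrite /fps_geom magX exprMn.
set q := mag w * r in wr d0 *; have q0 : 0 <= q by rewrite mulr_ge0 ?mag_ge0.
rewrite -[leRHS]mul1r ler_pdivlMr//; set S := \sum_(n < N) _.
have -> : S * (1 - q) = 1 - q ^+ N by rewrite -[RHS]opprB subrX1 -/S; ring.
by rewrite gerBl exprn_ge0.
Qed.

Lemma ev_geom w r z : 0 <= r -> mag w * r < 1 -> mag z <= r ->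
  ev (fps_geom w) z = (1 - w * z)^-1.
Proof.
move=> r0 wr zr; have bg := bnd_geom r0 wr.
have b1 : bnd (1 - fpsC w * fpsX) r (mag 1 + mag (-w) * r).
  rewrite -[1](rmorph1 (@fpsC _)) -mulNr -rmorphN.
  by apply: bndD; [apply: bndC|apply: bndZ; apply: bnd_X].
have := evM b1 bg zr; rewrite fps_geomE -[1](rmorph1 (@fpsC _)) evC.
have -> : ev (fpsC 1 - fpsC w * fpsX) z = 1 - w * z.
  rewrite -mulNr -rmorphN (evD (bndC _ r0) (bndZ _ (bnd_X r0)) zr) evC.
  by rewrite (evZ _ (bnd_X r0) zr) evX mulNr.
move=> h; have n0 : 1 - w * z != 0.
  by apply/eqP => e; move: h => /eqP; rewrite e mul0r oner_eq0.
by apply: (mulfI n0); rewrite -h mulfV.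
Qed.

(** Termwise summation of a sequence of power series that converges absolutely
    in the weighted l1 norm. *)
Section SeriesOfSeries.
Variables (G : nat -> fps) (r : R) (B : nat -> R) (Btot : R).
Hypothesis r_gt0 : 0 < r.
Hypothesis GB : forall j, bnd (G j) r (B j).
Hypothesis B_le : forall N, \sum_(j < N) B j <= Btot.

Let B_fset (s : {fset nat}) : \sum_(j <- s) B j <= Btot.
Proof.
have := @abs_bound_nat _ (fun j => (B j)%:C) Btot.
have e j : mag (B j)%:C = B j by rewrite mag_real ger0_norm// (bnd_ge0 (GB j)).
move=> /(_ _ s); under eq_bigr do rewrite e; apply => N.
by under eq_bigr do rewrite e.
Qed.

Let fam z (p : nat * nat) : C := G p.1 p.2 * z ^+ p.2.

Let fam_bound z : mag z <= r -> abs_bound (fam z) Btot.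
Proof.
move=> zr; apply: (@abs_bound_pair _ _ _ _ B) => // j.
exact: (bnd_abs (GB j) zr).
Qed.

Definition fps_csum : fps := fun n => csum (fun j => G j n).

Let col_hs n : has_sum (fun j => G j n) (fps_csum n).
Proof.
apply: (@csumP _ _ _ (Btot * (r ^+ n)^-1)) => s.
rewrite ler_pdivlMr ?exprn_gt0// mulr_suml; apply: le_trans (B_fset s).
apply: ler_sum => j _; have := abs_bound_term n (GB j).
by rewrite magM magX mag_real gtr0_norm.
Qed.

Let fam_col z n : has_sum (fun j => fam z (j, n)) (fps_csum n * z ^+ n).
Proof.
rewrite mulrC; have := has_sumZ (z ^+ n) (col_hs n).
by congr has_sum; apply/funext => j; rewrite mulrC.
Qed.

Lemma bnd_csum : bnd fps_csum r Btot.
Proof.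
apply: (@abs_bound_rows _ _ _ (fun p => fam r%:C (p.2, p.1))).
  by apply: abs_bound_swap; apply: fam_bound; rewrite mag_real gtr0_norm.
by move=> n; apply: fam_col.
Qed.

Lemma ev_csum z : mag z <= r -> has_sum (fun j => ev (G j) z) (ev fps_csum z).
Proof.
move=> zr; have [l [h1 h2]] := csum_fubini (fam_bound zr).
suff -> : ev fps_csum z = l by [].
apply: csum_unique; move: h2; congr has_sum; apply/funext => n.
exact: csum_unique (fam_col z n).
Qed.

(** If G j = O(X^j), no infinite sum enters the coefficients. *)
Lemma fps_csumE : (forall j n, (n < j)%N -> G j n = 0) ->
  forall n, fps_csum n = \sum_(j < n.+1) G j n.
Proof.
move=> G0 n; apply: csum_unique.
rewrite -(big_mkord xpredT (fun j => G j n)) /index_iota subn0.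
rewrite sum_fset_iota; apply: has_sum_fin => j; rewrite in_fset_iota -leqNgt => h.
exact: G0.
Qed.

End SeriesOfSeries.

(** Composition of power series; by absolute convergence it represents the
    composed function without any condition on the constant term of V. *)
Definition fps_comp (d V : fps) : fps := fps_csum (fun n => fpsC (d n) * V ^+ n).

Section Composition.
Variables (d V : fps) (r s D : R).
Hypothesis r_gt0 : 0 < r.
Hypothesis V_bnd : bnd V r s.
Hypothesis d_bnd : bnd d s D.

Let term_bnd n : bnd (fpsC (d n) * V ^+ n) r (mag (d n) * s ^+ n).
Proof. by apply: bndZ; apply: bnd_exp V_bnd; apply: ltW. Qed.

Let term_sum N : \sum_(n < N) mag (d n) * s ^+ n <= D.
Proof.
have s0 := bnd_ge0 V_bnd.
apply: le_trans (d_bnd [fset i | i in iota 0 N]%fset).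
rewrite -sum_fset_iota -[in iota _ _](subn0 N) -/(index_iota _ _) big_mkord.
by apply: ler_sum => n _; rewrite magM magX mag_real ger0_norm.
Qed.

Lemma bnd_comp : bnd (fps_comp d V) r D.
Proof. exact: bnd_csum r_gt0 term_bnd term_sum. Qed.

Lemma ev_comp z : mag z <= r -> ev (fps_comp d V) z = ev d (ev V z).
Proof.
move=> zr; have := ev_csum r_gt0 term_bnd term_sum zr.
have h : has_sum (fun n => d n * ev V z ^+ n) (ev d (ev V z)).
  by apply: ev_hs d_bnd _; apply: ev_le V_bnd zr.
move=> /has_sum_uniq; apply; move: h; congr has_sum; apply/funext => n.
rewrite (evZ _ (bnd_exp n (ltW r_gt0) V_bnd) zr).
by rewrite (ev_exp n (ltW r_gt0) V_bnd zr).
Qed.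

End Composition.

Lemma fps_compE (d V : fps) : V 0%N = 0 ->
  forall n, fps_comp d V n = \sum_(k < n.+1) d k * (V ^+ k) n.
Proof.
move=> V0 n; rewrite /fps_comp fps_csumE.
  by apply: eq_bigr => k _; rewrite fpsCM.
move=> j {}n nj; have -> : V = fpsX * (fun n => V n.+1).
  by apply: fps_ext => -[|m]; rewrite fpsXM.
by rewrite exprMn fpsCM fpsXnM nj mulr0.
Qed.

(** The negative binomial series; its coefficients dominate those of any series
    with polynomial times geometric growth. *)
Lemma geom_expE (w : C) m n : (fps_geom w ^+ m.+1) n = 'C(n + m, m)%:R * w ^+ n.
Proof.
elim: m n => [|m IH] n; first by rewrite expr1 addn0 bin0 mul1r.
rewrite exprS mulrC fpsM.
transitivity (\sum_(i < n.+1) 'C(i + m, m)%:R * w ^+ n).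
  apply: eq_bigr => -[i /= iN] _; rewrite IH /fps_geom -mulrA -exprD subnKC//.
rewrite -mulr_suml; congr (_ * _); rewrite -natr_sum; congr (_%:R).
elim: n => [|n IHn]; first by rewrite big_ord1 !add0n !binn.
by rewrite big_ord_recr /= IHn [in RHS]addSn binS addSnnS.
Qed.

Lemma bnd_binomial (w r : R) m : 0 <= r -> 0 <= w -> w * r < 1 ->
  bnd (fun n => ('C(n + m, m)%:R * w ^+ n)%:C) r ((1 - w * r)^-1 ^+ m.+1).
Proof.
move=> r0 w0 wr; have h : mag w%:C * r < 1 by rewrite mag_real ger0_norm.
have := bnd_exp m.+1 r0 (bnd_geom r0 h); rewrite mag_real ger0_norm//.
apply: bnd_le => n; by rewrite geom_expE rmorphM rmorphXn rmorph_nat.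
Qed.

End Evaluation.

(** * Analytic functions and the identity theorem *)

Section Analytic.
Variable R : realType.
Local Notation C := R[i].
Local Notation fps := (fps R[i]).
Implicit Types (F G : C -> C) (z h : C) (a b : fps).

Lemma series_unique (u : nat -> C) (l l' : C) :
  series u @ \oo --> l -> series u @ \oo --> l' -> l = l'.
Proof. by move=> /cvgC_lim <- /cvgC_lim <-. Qed.

(** The terms of a convergent series are bounded, and halving the radius gains a
    geometric factor. *)
Lemma series_bnd a (r : R) (l : C) : 0 < r ->
  series (fun n => a n * r%:C ^+ n) @ \oo --> l -> exists B, bnd a (r / 2) B.
Proof.
move=> r0 /cvgCP /(_ 1 ltr01) [N hN].
pose u n := mag (a n) * r ^+ n.
have u_ge0 n : 0 <= u n by rewrite mulr_ge0 ?mag_ge0 ?exprn_ge0 ?ltW.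
pose M := 2 + \sum_(n < N) u n.
have uM n : u n <= M.
  have [Nn|nN] := leqP N n; last first.
    by rewrite /M (bigD1 (Ordinal nN))//= addrCA lerDl addr_ge0// sumr_ge0.
  have h1 := hN n Nn; have h2 := hN n.+1 (leqW Nn).
  have e : u n = mag (series (fun n => a n * r%:C ^+ n) n.+1
                      - series (fun n => a n * r%:C ^+ n) n).
    by rewrite /series /= big_nat_recr//= addrAC subrr add0r magM magX mag_real gtr0_norm.
  rewrite e; set x := series _ _ in h2 *; set y := series _ _ in h1 *.
  apply: (@le_trans _ _ 2); last by rewrite /M lerDl sumr_ge0.
  have -> : x - y = (x - l) - (y - l) by ring.
  by rewrite (le_trans (magB _ _))//; lra.
exists (M * 2); apply: bnd_nat => [|K]; first by lra.
have -> : \sum_(n < K) mag (a n) * (r / 2) ^+ n = \sum_(n < K) u n * 2^-1 ^+ n.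
  by apply: eq_bigr => i _; rewrite exprMn mulrA.
apply: (@le_trans _ _ (\sum_(n < K) M * 2^-1 ^+ n)).
  by apply: ler_sum => n _; rewrite ler_wpM2r// exprn_ge0.
rewrite -mulr_sumr ler_wpM2l//; first by rewrite addr_ge0// sumr_ge0.
set S := \sum_(n < K) _; have e := subrX1 (2^-1 : R) K; rewrite -/S in e.
have : 0 <= (2^-1 : R) ^+ K by rewrite exprn_ge0.
by move: e; set q := _ ^+ K; lra.
Qed.

(** At the price of a smaller radius, expansions can be taken with a bound on
    the weighted norm. *)
Lemma analytic_atP F z0 : analytic_at F z0 <->
  exists (a : fps) (r B : R), [/\ 0 < r, bnd a r B &
    forall h, mag h <= r -> F (z0 + h) = ev a h].
Proof.
split=> [[a [r [r0 h]]]|[a [r [B [r0 aB h]]]]].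
  have r20 : 0 < r / 2 by lra.
  have h2 : `|(z0 + (r / 2)%:C) - z0| < r%:C.
    by rewrite addrC addKr lt_mag mag_real gtr0_norm//; lra.
  have := h _ h2; rewrite [_ + _ - z0]addrC addKr => /(series_bnd r20) [B aB].
  exists a, (r / 2 / 2), B; split=> // [|k kr]; first by lra.
  have h3 : `|(z0 + k) - z0| < r%:C by rewrite addrC addKr lt_mag; lra.
  have := h _ h3; rewrite [_ + _ - z0]addrC addKr => /series_unique; apply.
  exact: has_sum_series (ev_hs aB kr).
exists a, r; split=> // z; rewrite lt_mag => /ltW zr.
have := h _ zr; rewrite addrC subrK => ->.
exact: has_sum_series (ev_hs aB zr).
Qed.

Lemma bnd_shift a (r B : R) : 0 < r -> bnd a r B -> bnd (fun n => a n.+1) r (B / r).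
Proof.
move=> r0 aB.
have h := abs_boundZ r^-1%:C (@abs_bound_inj _ _ _ succn _ _ succn_inj aB).
have -> : B / r = mag (r^-1)%:C * B by rewrite mag_real gtr0_norm ?invr_gt0// mulrC.
move: h; congr abs_bound; apply/funext => n /=.
rewrite exprS mulrCA; congr (_ * _); rewrite mulrA -rmorphM mulVf ?gt_eqF//.
by rewrite mul1r.
Qed.

Lemma ev_shift a (r B : R) h : 0 < r -> bnd a r B -> mag h <= r ->
  ev a h = a 0%N + h * ev (fun n => a n.+1) h.
Proof.
move=> r0 aB hr; have r1 := ltW r0.
have e : a = fpsC (a 0%N) + fpsX * (fun n => a n.+1).
  by apply: fps_ext => -[|n]; rewrite fpsD fpsXM /fpsC ?addr0// add0r.
rewrite {1}e (evD (bndC _ r1) (bndM (bnd_X r1) (bnd_shift r0 aB)) hr) evC.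
by rewrite (evM (bnd_X r1) (bnd_shift r0 aB) hr) evX.
Qed.

(** Write a(h) = a_0 + h b(h) with b bounded near 0: a zero h close to 0 forces
    a_0 to be smaller than any positive number. *)
Lemma ev_isolated0 a (r B : R) : 0 < r -> bnd a r B ->
  (forall e : R, 0 < e -> exists h, [/\ h != 0, mag h < e & ev a h = 0]) ->
  a 0%N = 0.
Proof.
move=> r0 aB hz; apply/eqP; rewrite -mag_eq0; apply/negPn/negP => n0.
have n1 : 0 < mag (a 0%N) by rewrite lt_def n0 mag_ge0.
have B1 := bnd_ge0 (bnd_shift r0 aB).
have d0 : 0 < Num.min r (mag (a 0%N) / (B / r + 1)).
  by rewrite lt_min r0 divr_gt0//; lra.
have [h [h0]] := hz _ d0; rewrite lt_min => /andP[/ltW hr].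
rewrite ltr_pdivlMr; last by lra.
rewrite (ev_shift r0 aB hr) => hs /eqP; rewrite addr_eq0 => /eqP e0'.
move: hs; rewrite e0' magN magM.
have := ev_le (bnd_shift r0 aB) hr; set x := mag (ev _ _) => xB.
by have := mag_ge0 h; nra.
Qed.

(** The constant term vanishes by the previous lemma; dividing by the variable
    and repeating gives the other coefficients. *)
Lemma ev_isolated a (r B : R) : 0 < r -> bnd a r B ->
  (forall e : R, 0 < e -> exists h, [/\ h != 0, mag h < e & ev a h = 0]) ->
  forall n, a n = 0.
Proof.
move=> r0 + + n; elim: n a B => [|n IH] a B aB hz; first exact: (ev_isolated0 r0 aB hz).
apply: (IH (fun n => a n.+1) _ (bnd_shift r0 aB)) => e e0.
have d0 : 0 < Num.min r e by rewrite lt_min r0.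
have [h [h0]] := hz _ d0; rewrite lt_min => /andP[/ltW hr he].
rewrite (ev_shift r0 aB hr) (ev_isolated0 r0 aB hz) add0r => /eqP.
rewrite mulf_eq0 (negbTE h0) /= => /eqP eh.
by exists h; split.
Qed.

Definition agree_near F G z : Prop :=
  exists2 e : R, 0 < e & forall w, mag (w - z) < e -> F w = G w.

(** Identity theorem along the segment from 0 to z: the set of parameters up to
    which F and G agree locally is open and closed. *)
Lemma analytic_segment F G z :
  (forall t : R, 0 <= t <= 1 -> analytic_at F (t%:C * z)) ->
  (forall t : R, 0 <= t <= 1 -> analytic_at G (t%:C * z)) ->
  agree_near F G 0 -> F z = G z.
Proof.
move=> hF hG A0; have [->|z0] := eqVneq z 0.
  by case: A0 => e e0; apply; rewrite subrr mag0.
have mz : 0 < mag z by rewrite mag_gt0.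
pose A (t : R) := agree_near F G (t%:C * z).
pose S := [set t : R | 0 <= t <= 1 /\ forall t', 0 <= t' <= t -> A t'].
have S0 : S 0.
  split; first by rewrite lexx ler01.
  move=> t' ht; have -> : t' = 0 by lra.
  by rewrite /A mul0r.
have Ssup : has_sup S by split; [exists 0|exists 1 => t [/andP[]]].
pose s := sup S.
have s0 : 0 <= s by apply: sup_upper_bound.
have s1 : s <= 1 by apply: ge_sup; [exists 0|move=> t [/andP[]]].
have s01 : 0 <= s <= 1 by rewrite s0.
have /analytic_atP [a [ra [Ba [ra0 aB Fa]]]] := hF _ s01.
have /analytic_atP [b [rb [Bb [rb0 bB Gb]]]] := hG _ s01.
pose r := Num.min ra rb.
have r0 : 0 < r by rewrite lt_min ra0.
have rra : r <= ra by rewrite ge_min lexx.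
have rrb : r <= rb by rewrite ge_min lexx orbT.
have {}aB : bnd a r Ba by apply: bndS aB; rewrite rra ltW.
have {}bB : bnd b r Bb by apply: bndS bB; rewrite rrb ltW.
have dB : bnd (a + fpsC (-1) * b) r (Ba + mag (-1) * Bb).
  by apply: bndD => //; apply: bndZ.
have evd h : mag h <= r -> ev (a + fpsC (-1) * b) h = F (s%:C * z + h) - G (s%:C * z + h).
  move=> hr; rewrite (evD aB (bndZ (-1) bB) hr) (evZ _ bB hr) Fa ?Gb ?(le_trans hr)//.
  by rewrite mulN1r.
have mtz (t u : R) : mag (t%:C * z - u%:C * z) = `|t - u| * mag z.
  by rewrite -mulrBl magM -rmorphB mag_real.
have FGs h : mag h <= r -> F (s%:C * z + h) = G (s%:C * z + h).
  move=> hr; apply/eqP; rewrite -subr_eq0 -evd//.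
  rewrite (_ : _ + _ = 0) ?(@ev_fin _ 0 0) ?big_ord0//; first by move=> n _; rewrite fps0.
  apply: fps_ext => n; rewrite fps0; apply: (ev_isolated r0 dB) => e e0.
  pose d := Num.min e r / mag z.
  have er0 : 0 < Num.min e r by rewrite lt_min e0.
  have d0 : 0 < d by rewrite divr_gt0.
  have [t St] := sup_adherent d0 Ssup; rewrite -/s => ts.
  have tS : t <= s by apply: sup_upper_bound.
  have [t01 At] := St; have t00 : 0 <= t <= t by rewrite lexx; case/andP: t01 => ->.
  have [e' e'0 FG] := At _ t00.
  have key h' : h' != 0 -> mag h' < Num.min e r -> mag (s%:C * z + h' - t%:C * z) < e' ->
      exists h0, [/\ h0 != 0, mag h0 < e & ev (a + fpsC (-1) * b) h0 = 0].
    rewrite lt_min => h'0 /andP[h'e h'r] ht; exists h'; split=> //.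
    by rewrite evd ?(ltW h'r)// FG// subrr.
  have [tse|tsn] := eqVneq t s.
    pose d' := Num.min (Num.min e r) e' / 2.
    have d'0 : 0 < d' by rewrite divr_gt0// lt_min er0.
    have d'1 : d' < Num.min (Num.min e r) e' by rewrite /d' ltr_pdivrMr//; have := d'0; rewrite /d'; lra.
    apply: (key d'%:C).
    - by rewrite -mag_eq0 mag_real normr_eq0 gt_eqF.
    - by rewrite mag_real gtr0_norm// (lt_le_trans d'1)// ge_min lexx.
    - by rewrite tse addrC addKr mag_real gtr0_norm// (lt_le_trans d'1)// ge_min lexx orbT.
  have ts' : t < s by rewrite lt_neqAle tsn.
  apply: (key (t%:C * z - s%:C * z)).
  - by rewrite -mag_eq0 mtz mulf_neq0 ?gt_eqF// normr_gt0 subr_eq0.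
  - rewrite mtz ltr0_norm; last by lra.
    by rewrite -ltr_pdivlMr// -/d; lra.
  - by rewrite addrCA subrr addr0 subrr mag0.
have Anear t : `|t - s| < r / mag z -> A t.
  rewrite ltr_pdivlMr// -mtz => tr.
  exists (r - mag (t%:C * z - s%:C * z)); first by lra.
  move=> w hw; have -> : w = s%:C * z + (w - s%:C * z) by ring.
  apply: FGs; have -> : w - s%:C * z = (w - t%:C * z) + (t%:C * z - s%:C * z) by ring.
  by rewrite (le_trans (magD _ _))//; lra.
pose d := r / mag z.
have d0 : 0 < d by rewrite divr_gt0.
have [t0 [t01 At0]] := sup_adherent d0 Ssup; rewrite -/s => t0s.
have Sm : S (Num.min 1 (s + d / 2)).
  split; first by rewrite le_min ler01 ge_min lexx /= andbT; lra.
  move=> t' /andP[t'0]; rewrite le_min => /andP[t'1 t's].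
  have [h|h] := leP t' t0; first by apply: At0; rewrite t'0.
  by apply: Anear; rewrite -/d ltr_norml; lra.
have : Num.min 1 (s + d / 2) <= s by apply: sup_upper_bound.
rewrite ge_min => /orP[s1'|sd]; last by exfalso; lra.
have se : s = 1 by lra.
have := FGs 0; rewrite mag0 addr0 se mul1r; apply; exact: ltW.
Qed.

End Analytic.

(** * Rising factorials and binomial series *)

Section Pochhammer.
Variable R : realType.
Local Notation C := R[i].
Implicit Types a b : C.

Lemma poch0 a : pochhammer a 0 = 1.
Proof. by rewrite /pochhammer big_geq. Qed.

Lemma pochS a n : pochhammer a n.+1 = pochhammer a n * (a + n%:R).
Proof. by rewrite /pochhammer big_nat_recr. Qed.

Lemma pochD a m n :
  pochhammer a (m + n) = pochhammer a m * pochhammer (a + m%:R) n.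
Proof.
elim: n => [|n IH]; first by rewrite addn0 poch0 mulr1.
by rewrite addnS !pochS IH natrD addrA mulrA.
Qed.

Lemma pochSl a n : pochhammer a n.+1 = a * pochhammer (a + 1) n.
Proof. by rewrite -add1n pochD pochS poch0 addr0 mul1r. Qed.

Lemma fact_neq0 n : n`!%:R != 0 :> C.
Proof. by rewrite pnatr_eq0 -lt0n fact_gt0. Qed.

Lemma poch_nat p n : p`!%:R * pochhammer p.+1%:R n = (p + n)`!%:R :> C.
Proof.
elim: n => [|n IH]; first by rewrite poch0 addn0 mulr1.
by rewrite pochS mulrA IH -natrD addSn addnS factS natrM mulrC.
Qed.

Lemma poch1 n : pochhammer 1 n = n`!%:R :> C.
Proof. by have := poch_nat 0 n; rewrite mul1r. Qed.

Lemma poch_nat_neq0 p n : pochhammer p.+1%:R n != 0 :> C.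
Proof.
apply/eqP => h; have := poch_nat p n; rewrite h mulr0 => /esym/eqP.
by rewrite (negbTE (fact_neq0 _)).
Qed.

Lemma mag_poch a n : mag (pochhammer a n) = \prod_(0 <= k < n) mag (a + k%:R).
Proof. exact: mag_prod. Qed.

Lemma mag_poch_le a p n : mag a <= p.+1%:R ->
  mag (pochhammer a n / n`!%:R) <= 'C(n + p, p)%:R.
Proof.
move=> ap; have h : mag (pochhammer a n) <= mag (pochhammer (p.+1%:R : C) n).
  rewrite !mag_poch ler_prod// => k _; rewrite mag_ge0 /= -natrD mag_nat.
  by rewrite (le_trans (magD _ _))// mag_nat natrD lerD2r.
have e : mag (pochhammer (p.+1%:R : C) n) = (p + n)`!%:R / p`!%:R.
  have := congr1 (@mag R) (poch_nat p n); rewrite magM !mag_nat => <-.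
  by rewrite mulrC mulKf// pnatr_eq0 -lt0n fact_gt0.
rewrite magM magV mag_nat ler_pdivrMr ?ltr0n ?fact_gt0//.
rewrite (le_trans h)// e ler_pdivrMr ?ltr0n ?fact_gt0// -!natrM ler_nat.
have := bin_fact (leq_addl n p); rewrite addnK => E.
by rewrite addnC -{1}E; lia.
Qed.

End Pochhammer.

Section Binomial.
Variable R : realType.
Local Notation C := R[i].
Local Notation fps := (fps R[i]).
Implicit Types (a b w : C).

(** The binomial series (1 - wX)^(-a). *)
Definition bin_fps a w : fps := fun n => pochhammer a n / n`!%:R * w ^+ n.

Lemma bin_fps0 a w : bin_fps a w 0%N = 1.
Proof. by rewrite /bin_fps poch0 fact0 divr1 mulr1. Qed.

Lemma theta_bin a w : theta (bin_fps a w) =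
  fpsC w * fpsX * (theta (bin_fps a w) + fpsC a * bin_fps a w).
Proof.
apply: fps_ext => -[|n].
  by rewrite -mulrA fpsCM fpsXM mulr0 /theta mul0r.
rewrite -mulrA fpsCM fpsXM fpsD fpsCM /theta /bin_fps pochS factS natrM exprS.
have := fact_neq0 R n; have : (n.+1%:R : C) != 0 by rewrite pnatr_eq0.
move: (pochhammer a n) => P n1 f0; field.
by rewrite f0 addrC natr1.
Qed.

(** The equation reads n c_n = w (n - 1 + a) c_(n-1) on coefficients, so the
    constant term determines everything. *)
Lemma binomial_ode (P Q : fps) a w : P 0%N = Q 0%N ->
  theta P = fpsC w * fpsX * (theta P + fpsC a * P) ->
  theta Q = fpsC w * fpsX * (theta Q + fpsC a * Q) -> P = Q.
Proof.
move=> h0 hP hQ; apply: fps_ext; elim=> [//|n IH].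
have e (S : fps) : theta S = fpsC w * fpsX * (theta S + fpsC a * S) ->
    n.+1%:R * S n.+1 = w * (n%:R * S n + a * S n).
  move=> /(congr1 (fun f : fps => f n.+1)).
  by rewrite -mulrA fpsCM fpsXM fpsD fpsCM.
apply: (mulfI (_ : n.+1%:R != 0)); first by rewrite pnatr_eq0.
by rewrite (e _ hP) (e _ hQ) IH.
Qed.

(** Both sides satisfy the first order equation of (1 - wX)^(- a - b). *)
Lemma bin_fpsD a b w : bin_fps a w * bin_fps b w = bin_fps (a + b) w.
Proof.
apply: (@binomial_ode _ _ (a + b) w); last exact: theta_bin.
  by rewrite fpsM big_ord1 !bin_fps0 mulr1.
rewrite thetaM {1}(theta_bin a w) {1}(theta_bin b w) rmorphD; ring.
Qed.

Lemma bin_fps_geom w : bin_fps 1 w = fps_geom w.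
Proof.
by apply: fps_ext => n; rewrite /bin_fps poch1 mulfV ?fact_neq0// mul1r.
Qed.

Lemma bin_fps_0 w : bin_fps 0 w = 1.
Proof.
apply: fps_ext => -[|n]; first by rewrite bin_fps0 fps1.
by rewrite /bin_fps pochSl !mul0r fps1.
Qed.

Lemma bin_fps_nat k w : bin_fps k%:R w = fps_geom w ^+ k.
Proof.
elim: k => [|k IH]; first by rewrite bin_fps_0 expr0.
by rewrite exprS -IH -bin_fps_geom bin_fpsD -natr1 addrC.
Qed.

Lemma bnd_bin a w r : 0 <= r -> mag w * r < 1 -> exists B, bnd (bin_fps a w) r B.
Proof.
move=> r0 wr; have [p ap] : exists p, mag a <= p.+1%:R.
  exists (Num.truncn (mag a)); rewrite ltW//.
  exact: (truncnS_gt (mag a)).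
eexists; apply: bnd_le (bnd_binomial p r0 (mag_ge0 w) wr) => n.
rewrite magM magX mag_real ger0_norm ?mulr_ge0 ?exprn_ge0 ?mag_ge0//.
by rewrite ler_wpM2r ?exprn_ge0 ?mag_ge0// mag_poch_le.
Qed.

(** The coefficient of X^n in (1 - X)^(-a) (1 - X)^(-b) = (1 - X)^(- a - b). *)
Lemma vandermonde_poch a b n : \sum_(k < n.+1)
  'C(n, k)%:R * (pochhammer a k * pochhammer b (n - k)) = pochhammer (a + b) n.
Proof.
have := congr1 (fun f : fps => f n * n`!%:R) (bin_fpsD a b 1).
rewrite /= [X in _ = X * _]/bin_fps expr1n mulr1 divfK ?fact_neq0// => <-.
rewrite fpsM mulr_suml; apply: eq_bigr => -[k /= kn] _.
have kn' : (k <= n)%N by [].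
rewrite /bin_fps !expr1n -(bin_fact kn') !natrM.
have := fact_neq0 R k; have := fact_neq0 R (n - k).
move: (pochhammer _ _) (pochhammer b _) => P Q h1 h2; field.
by rewrite h1.
Qed.

End Binomial.

Lemma sum_pascal (V : pzSemiRingType) (G : nat -> nat -> V) l :
  \sum_(k < l.+2) 'C(l.+1, k)%:R * G k (l.+1 - k)%N =
  \sum_(k < l.+1) 'C(l, k)%:R * (G k.+1 (l - k)%N + G k (l - k).+1).
Proof.
rewrite big_ord_recl /= bin0 subn0.
under eq_bigr do rewrite /bump /= add1n binS subSS natrD mulrDl.
under [RHS]eq_bigr do rewrite mulrDr.
rewrite !big_split /= addrA addrC; congr (_ + _).
rewrite [RHS]big_ord_recl /= bin0 subn0; congr (_ + _).
rewrite big_ord_recr /= bin_small// mul0r addr0.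
apply: eq_bigr => -[k /= kl] _; rewrite /bump /= add1n.
by rewrite subnSK.
Qed.

(** * Infinite sums of formal power series *)

Section TriangularSums.
Variable K : comNzRingType.
Local Notation fps := (fps K).

(** For G k = O(X^k) this is the sum of all the G k: the terms k > n do not
    contribute to the coefficient of order n. *)
Definition fps_tsum (G : nat -> fps) : fps := fun n => \sum_(k < n.+1) G k n.

Definition triangular (G : nat -> fps) := forall k n, (n < k)%N -> G k n = 0.

Lemma fps_tsum_trunc (G : nat -> fps) N n : triangular G -> (n <= N)%N ->
  fps_tsum G n = (\sum_(k < N.+1) G k) n.
Proof.
move=> G0 nN; rewrite fps_sum /fps_tsum.
rewrite -!(big_mkord xpredT (fun k => G k n)).
rewrite (@big_cat_nat _ _ _ n.+1 0 N.+1)//= [X in _ + X]big_nat_cond.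
by rewrite [X in _ + X]big1 ?addr0// => k; rewrite andbT => /andP[h _]; apply: G0.
Qed.

Lemma triangularM (c : fps) G : triangular G -> triangular (fun k => c * G k).
Proof.
move=> G0 k n nk; rewrite fpsM big1// => -[i /= iN] _.
by rewrite G0 ?mulr0// (leq_ltn_trans (leq_subr _ _) nk).
Qed.

Lemma fps_tsumM (c : fps) G : triangular G ->
  c * fps_tsum G = fps_tsum (fun k => c * G k).
Proof.
move=> G0; apply: fps_ext => n.
rewrite (fps_tsum_trunc (triangularM c G0) (leqnn n)) -mulr_sumr !fpsM.
apply: eq_bigr => -[i /= iN] _; rewrite (@fps_tsum_trunc _ n)// leq_subr//.
Qed.

End TriangularSums.

(** * The Pfaff transformation *)

Section Pfaff.
Variable R : realType.
Local Notation C := R[i].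
Local Notation fps := (fps R[i]).
Variables a b c : C.
Hypothesis c_poch : forall n, pochhammer c n != 0.

(** Moments t^j (1 - t)^m -> (b)_j (c - b)_m / (c)_(j + m) of the (possibly
    complex) beta distribution behind the Euler integral. *)
Definition beta_moment j m : C :=
  pochhammer b j * pochhammer (c - b) m / pochhammer c (j + m).

Lemma beta_momentD j m :
  beta_moment j.+1 m + beta_moment j m.+1 = beta_moment j m.
Proof.
have := c_poch (j + m).+1; rewrite /beta_moment addnS addSn !pochS natrD mulf_eq0.
rewrite negb_or => /andP[h1 h2].
move: (pochhammer c _) (pochhammer b j) (pochhammer _ m) h1 => P Q S h1.
by field; rewrite h1.
Qed.

(** Moments of (t - q)^l, expanded in two ways: in powers of t, and, writing
    t - q = (1 - q) t - q (1 - t), in powers of t and 1 - t. Only the second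
    expansion gives the sharp growth rate max(|q|, |1 - q|)^l. *)
Lemma shifted_moment q l j m :
  \sum_(k < l.+1) 'C(l, k)%:R * ((- q) ^+ (l - k) * beta_moment (j + k) m) =
  \sum_(k < l.+1) 'C(l, k)%:R *
    ((1 - q) ^+ k * (- q) ^+ (l - k) * beta_moment (j + k) (m + (l - k))).
Proof.
elim: l j m => [|l IH] j m.
  by rewrite !big_ord1 !subnn !expr0 !addn0 !mul1r.
rewrite (sum_pascal (fun k d => (- q) ^+ d * beta_moment (j + k) m)).
rewrite (sum_pascal (fun k d => (1 - q) ^+ k * (- q) ^+ d * beta_moment (j + k) (m + d))).
transitivity (\sum_(k < l.+1) 'C(l, k)%:R * ((- q) ^+ (l - k) * beta_moment (j.+1 + k) m)
  - q * \sum_(k < l.+1) 'C(l, k)%:R * ((- q) ^+ (l - k) * beta_moment (j + k) m)).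
  rewrite mulr_sumr -sumrB; apply: eq_bigr => k _; rewrite exprS addnS addSn; ring.
rewrite !IH mulr_sumr -sumrB; apply: eq_bigr => k _.
rewrite -(beta_momentD (j + k)) !exprS !addnS addSn; ring.
Qed.

Definition hyp_fps : fps := hyp2F1_coef a b c.

Definition pfaff_fps q : fps := fun l =>
  pochhammer a l / l`!%:R *
  \sum_(k < l.+1) 'C(l, k)%:R * ((- q) ^+ (l - k) * beta_moment k 0).

Definition mobius_fps q : fps := fpsX * fps_geom (- q).

(** Expanding the binomial series and collecting the powers of v produces the
    moments of (t - q)^l. *)
Lemma pfaff_tsum q : pfaff_fps q =
  fps_tsum (fun k => fpsC (hyp_fps k) * (fpsX ^+ k * bin_fps (a + k%:R) (- q))).
Proof.
apply: fps_ext => l; rewrite /pfaff_fps mulr_sumr; apply: eq_bigr => -[k /= kl] _.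
have kl' : (k <= l)%N by [].
rewrite fpsCM fpsXnM ltnNge kl' /= /bin_fps /hyp_fps /hyp2F1_coef.
rewrite -(bin_fact kl') -{1}(subnKC kl') pochD.
rewrite /beta_moment poch0 addn0 mulr1 !natrM.
have := fact_neq0 R k; have := fact_neq0 R (l - k); have := c_poch k.
have : 'C(l, k)%:R != 0 :> C by rewrite pnatr_eq0 -lt0n bin_gt0.
move: (pochhammer _ _) (pochhammer _ _) (pochhammer _ _) (pochhammer _ _) => P Q S T.
by move=> h1 h2 h3 h4; field; rewrite h1 h2 h3 h4.
Qed.

(** The k-th power of v/(1 + qv) is v^k (1 + qv)^(-k); pulling the factor (1 +
    qv)^(-a) out leaves the binomial series of the previous lemma. *)
Lemma pfaff_comp q :
  fps_comp hyp_fps (mobius_fps q) = bin_fps (- a) (- q) * pfaff_fps q.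
Proof.
rewrite pfaff_tsum fps_tsumM; last first.
  by move=> k n nk; rewrite fpsCM fpsXnM nk mulr0.
apply: fps_ext => n; rewrite fps_compE; last by rewrite /mobius_fps fpsXM.
apply: eq_bigr => k _; rewrite /mobius_fps exprMn -bin_fps_nat.
rewrite mulrCA fpsCM; congr (_ * _); rewrite mulrCA bin_fpsD.
by rewrite addKr.
Qed.

End Pfaff.

(** * Analytic continuation of the Gauss series *)

Section Continuation.
Variable R : realType.
Local Notation C := R[i].
Local Notation fps := (fps R[i]).
Variables (a b c : C) (M : R).
Implicit Types (q z : C).
Hypothesis c_poch : forall n, pochhammer c n != 0.
Hypothesis moment_bound : forall l,
  \sum_(k < l.+1) 'C(l, k)%:R * mag (beta_moment b c k (l - k)) <= M * l.+1%:R.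

(** The reciprocal of the distance, in the variable v = z/(1 - qz), from 0 to
    the nearest of the images of z = infinity and z = 1. *)
Definition mob_rate q : R := Num.max (mag q) (mag (1 - q)).

Lemma mob_rate_gt0 q : 0 < mob_rate q.
Proof.
rewrite lt_max !mag_gt0; apply/orP; have [->|] := eqVneq q 0; last by left.
by right; rewrite subr0 oner_neq0.
Qed.

Let M_ge0 : 0 <= M.
Proof.
have := moment_bound 0; rewrite big_ord1 mulr1; apply: le_trans.
by rewrite mulr_ge0 ?mag_ge0.
Qed.

(** Bounding the moments of (t - q)^l by those of the absolute values gives
    max(|q|, |1 - q|)^l; the rest grows polynomially in l. *)
Lemma mag_pfaff_fps q l p : mag a <= p.+1%:R -> mag (pfaff_fps a b c q l) <=
  M * p.+1%:R * ('C(l + p.+1, p.+1)%:R * mob_rate q ^+ l).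
Proof.
move=> ap; have := shifted_moment b c_poch q l 0 0.
rewrite /pfaff_fps magM => ->.
set S := \sum_(k < _) _.
have SB : mag S <= mob_rate q ^+ l * (M * l.+1%:R).
  have r0 : 0 <= mob_rate q ^+ l by rewrite exprn_ge0 ?ltW ?mob_rate_gt0.
  apply: le_trans (ler_wpM2l r0 (moment_bound l)).
  rewrite mulr_sumr (le_trans (mag_sum _ _ _))// ler_sum// => -[k /= kl] _.
  rewrite !add0n magM mag_nat [mag (_ * beta_moment _ _ _ _)]magM [mag (_ ^+ _ * _)]magM [leRHS]mulrCA ler_wpM2l// ler_wpM2r ?mag_ge0// !magX magN.
  have -> : mob_rate q ^+ l = mob_rate q ^+ k * mob_rate q ^+ (l - k).
    by rewrite -exprD subnKC.
  rewrite ler_pM ?exprn_ge0 ?mag_ge0 ?lerXn2r ?nnegrE ?mag_ge0 ?(ltW (mob_rate_gt0 _))//.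
    by rewrite le_max lexx orbT.
  by rewrite le_max lexx.
apply: le_trans (ler_pM (mag_ge0 _) (mag_ge0 _) (mag_poch_le l ap) SB) _.
have e : ('C(l + p, p) * l.+1 <= p.+1 * 'C(l + p.+1, p.+1))%N.
  by rewrite -mul_bin_diag addnS /= mulnC leq_mul2r ltnS leq_addr orbT.
set m := mob_rate q ^+ l; have m0 : 0 <= m by rewrite exprn_ge0 ?ltW ?mob_rate_gt0.
have -> : 'C(l + p, p)%:R * (m * (M * l.+1%:R)) = M * m * ('C(l + p, p) * l.+1)%:R.
  by rewrite natrM; ring.
have -> : M * p.+1%:R * ('C(l + p.+1, p.+1)%:R * m) =
    M * m * (p.+1 * 'C(l + p.+1, p.+1))%:R by rewrite natrM; ring.
by rewrite ler_wpM2l ?mulr_ge0// ler_nat.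
Qed.

Lemma bnd_pfaff q s : 0 <= s -> mob_rate q * s < 1 ->
  exists B, bnd (pfaff_fps a b c q) s B.
Proof.
move=> s0 qs; have [p ap] : exists p, mag a <= p.+1%:R.
  by exists (Num.truncn (mag a)); rewrite ltW// truncnS_gt.
have h := bndZ (M * p.+1%:R)%:C (bnd_binomial p.+1 s0 (ltW (mob_rate_gt0 q)) qs).
eexists; apply: bnd_le h => l; apply: le_trans (mag_pfaff_fps q l ap) _.
rewrite fpsCM -rmorphM mag_real ler_norm//.
Qed.

Lemma bnd_hyp_comp q s : 0 <= s -> mob_rate q * s < 1 ->
  exists B, bnd (fps_comp (hyp_fps a b c) (mobius_fps q)) s B.
Proof.
move=> s0 qs; rewrite pfaff_comp//.
have qs' : mag (- q) * s < 1.
  by rewrite magN (le_lt_trans _ qs)// ler_wpM2r// le_max lexx.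
have [B1 h1] := bnd_bin (- a) s0 qs'; have [B2 h2] := bnd_pfaff s0 qs.
by exists (B1 * B2); apply: bndM.
Qed.

Lemma pfaff_fps0 : pfaff_fps a b c 0 = hyp_fps a b c.
Proof.
apply: fps_ext => l; rewrite /pfaff_fps big_ord_recr /= big1 => [|i _]; last first.
  by rewrite oppr0 expr0n subn_eq0 leqNgt ltn_ord /= mul0r mulr0.
rewrite subnn expr0 binn add0r !mul1r /beta_moment poch0 addn0 mulr1.
rewrite /hyp_fps /hyp2F1_coef; have := fact_neq0 R l; have := c_poch l.
by move: (pochhammer _ _) (pochhammer _ _) (pochhammer _ _) => P Q S h1 h2; field; rewrite h1 h2.
Qed.

Lemma hyp_comp0 : fps_comp (hyp_fps a b c) (mobius_fps 0) = hyp_fps a b c.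
Proof.
rewrite pfaff_comp// pfaff_fps0 -[RHS]mul1r; congr (_ * _).
apply: fps_ext => -[|n]; first by rewrite bin_fps0 fps1.
by rewrite /bin_fps oppr0 exprS mul0r mulr0 fps1.
Qed.

Lemma mob_rate0 : mob_rate 0 = 1.
Proof. by rewrite /mob_rate subr0 mag0 mag1 max_r. Qed.

Lemma bnd_hyp s : 0 <= s < 1 -> exists B, bnd (hyp_fps a b c) s B.
Proof.
move=> /andP[s0 s1]; rewrite -pfaff_fps0; apply: bnd_pfaff => //.
by rewrite mob_rate0 mul1r.
Qed.

Definition hyp_cont q z : C :=
  ev (fps_comp (hyp_fps a b c) (mobius_fps q)) (z / (1 - z * q)).

(** The condition |v| mob_rate q < 1 on v = z/(1 - qz), cleared of the
    denominator. *)
Definition hyp_dom q z : Prop := mag z * mob_rate q < mag (1 - z * q).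

Lemma mobius_shift (z h q D : C) : D = 1 - z * q -> D != 0 -> 1 - q / D * h != 0 ->
  (z + h) / (1 - (z + h) * q) = (z / D + D^-1 * h) / (1 - q / D * h).
Proof.
move=> De D0 x0; have e : D * (q / D * h) = q * h by field.
have -> : 1 - (z + h) * q = D * (1 - q / D * h).
  by rewrite mulrBr mulr1 e De; ring.
by rewrite invfM mulrA mulrDl [D^-1 * h]mulrC.
Qed.

(** A translation of z becomes a Mobius map in v, whose power series keeps the
    values in a disc where the series in v converges absolutely. *)
Lemma hyp_dom_analytic q z : hyp_dom q z -> analytic_at (hyp_cont q) z.
Proof.
move=> hz; have r0 := mob_rate_gt0 q.
pose D := 1 - z * q; have D0 : 0 < mag D.
  by rewrite (le_lt_trans _ hz)// mulr_ge0 ?mag_ge0 ?ltW.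
have D1 : D != 0 by rewrite -mag_gt0.
have [s /andP[s1 s2]] : exists s : R, mag z / mag D < s < (mob_rate q)^-1.
  exists ((mag z / mag D + (mob_rate q)^-1) / 2).
  have : mag z / mag D < (mob_rate q)^-1 by rewrite ltr_pdivrMr// mulrC ltr_pdivlMr.
  by lra.
have z0 := mag_ge0 z; have q0 := mag_ge0 q.
have s0 : 0 < s by rewrite (le_lt_trans _ s1)// divr_ge0// ltW.
have qs : mob_rate q * s < 1 by rewrite mulrC -ltr_pdivlMr// mul1r.
have [B hB] := bnd_hyp_comp (ltW s0) qs.
rewrite ltr_pdivrMr// in s1.
pose r := (s * mag D - mag z) / (1 + s * mag q).
have d0 : 0 < 1 + s * mag q by rewrite ltr_wpDr// mulr_ge0// ltW.
have rr0 : 0 < r by rewrite divr_gt0//; lra.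
have re : r * (1 + s * mag q) = s * mag D - mag z by rewrite divfK// gt_eqF.
have bq : mag (q / D) * r < 1.
  rewrite magM magV mulrAC ltr_pdivrMr// mul1r -(ltr_pM2l s0).
  by nra.
pose V : fps := (fpsC (z / D) + fpsC D^-1 * fpsX) * fps_geom (q / D).
have V1 := bndD (bndC (z / D) (ltW rr0)) (bndZ D^-1 (bnd_X (ltW rr0))).
have Vb : bnd V r s.
  apply: bndW (bndM V1 (bnd_geom (ltW rr0) bq)).
  rewrite -/(_ / _) ler_pdivrMr; last by lra.
  rewrite !magM !magV mulrBr mulr1 mulrC -mulrDr mulrC ler_pdivrMr//.
  have -> : (s - s * (mag q / mag D * r)) * mag D = s * mag D - s * mag q * r.
    by field; rewrite gt_eqF.
  by lra.
apply/analytic_atP; exists (fps_comp (fps_comp (hyp_fps a b c) (mobius_fps q)) V), r, B.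
split; [exact: rr0|exact: (bnd_comp rr0 Vb hB)|move=> h hr].
rewrite (ev_comp rr0 Vb hB hr) /hyp_cont; congr ev.
rewrite (evM V1 (bnd_geom (ltW rr0) bq) hr) (ev_geom (ltW rr0) bq hr).
rewrite (evD (bndC (z / D) (ltW rr0)) (bndZ D^-1 (bnd_X (ltW rr0))) hr) evC.
rewrite (evZ _ (bnd_X (ltW rr0)) hr) evX.
have h1 : 1 - q / D * h != 0.
  apply/eqP => /eqP; rewrite subr_eq0 => /eqP e.
  have := mag_ge0 (q / D); have := mag_ge0 h.
  have : mag (q / D) * mag h = 1 by rewrite -magM -e mag1.
  have := ler_wpM2l (mag_ge0 (q / D)) hr.
  by move: bq; set x := mag (q / D); lra.
exact: mobius_shift.
Qed.

(** For small v the composed series may be evaluated in two steps, and v/(1 +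
    qv) = z. *)
Lemma hyp_cont_gauss q : exists2 e : R, 0 < e & forall z, mag z < e ->
  hyp_cont q z = ev (hyp_fps a b c) z.
Proof.
have q0 := mag_ge0 q.
pose r := (4 * (1 + mag q))^-1.
have r0 : 0 < r by rewrite invr_gt0; lra.
have re : 4 * (1 + mag q) * r = 1 by rewrite mulfV//; lra.
have qr0 := mulr_ge0 q0 (ltW r0).
have qr : mag (- q) * r < 1 by rewrite magN; lra.
have Vb : bnd (mobius_fps q) r 2^-1.
  apply: bndW (bndM (bnd_X (ltW r0)) (bnd_geom (ltW r0) qr)).
  by rewrite magN in qr *; rewrite ler_pdivrMr; lra.
have [B hB] := @bnd_hyp 2^-1 ltac:(lra).
pose e := r / 2; have e0 : 0 < e by rewrite divr_gt0.
have e2 : e * 2 = r by rewrite divfK.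
exists e; [exact: e0|move=> z ze].
have zq : mag (z * q) < 2^-1.
  have h1 := ler_wpM2r q0 (ltW ze); have h2 : e * mag q * 2 = r * mag q by rewrite -e2; ring.
  by rewrite magM; lra.
have n0 : 1 - z * q != 0.
  apply/eqP => /eqP; rewrite subr_eq0 => /eqP E.
  by move: zq; rewrite -E mag1; lra.
have lo : 2^-1 < mag (1 - z * q).
  have := magD (1 - z * q) (z * q); rewrite subrK mag1; lra.
have vr : mag (z / (1 - z * q)) <= r.
  rewrite magM magV ler_pdivrMr; last by lra.
  by have := ler_wpM2l (ltW r0) (ltW lo); lra.
rewrite /hyp_cont (ev_comp r0 Vb hB vr) /mobius_fps; congr ev.
rewrite (evM (bnd_X (ltW r0)) (bnd_geom (ltW r0) qr) vr) evX.
rewrite (ev_geom (ltW r0) qr vr); move: n0; set x := 1 - z * q => x0.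
have h : 1 - - q * (z / x) = x^-1.
  by apply: (mulIf x0); rewrite mulVf// mulrBl mul1r mulNr mulNr opprK -mulrA divfK// /x; ring.
by rewrite h invrK divfK.
Qed.

Lemma hyp_dom_star q z (t : R) : 0 <= t <= 1 -> hyp_dom q z -> hyp_dom q (t%:C * z).
Proof.
rewrite /hyp_dom => /andP[t0 t1]; have [->|tn] := eqVneq t 0.
  by rewrite !mul0r mag0 mul0r subr0 mag1.
have tp : 0 < t by rewrite lt_def tn.
set m := mob_rate q; have m0 : 0 < m := mob_rate_gt0 q.
have sq (x y : R) : 0 <= x -> 0 <= y -> (x < y) = (x ^+ 2 < y ^+ 2).
  by move=> x0 y0; rewrite ltr_pXn2r.
have zm0 : 0 <= mag z * m by rewrite mulr_ge0 ?mag_ge0 ?(ltW m0).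
rewrite -[_%:C * z * q]mulrA [mag (_ * z)]magM mag_real ger0_norm// -mulrA.
move=> hz; rewrite (sq _ _ (mulr_ge0 t0 zm0) (mag_ge0 _)) exprMn.
move: hz; rewrite (sq _ _ zm0 (mag_ge0 _)); set w := z * q.
have wm : mag w ^+ 2 <= (mag z * m) ^+ 2.
  by rewrite lerXn2r ?nnegrE ?mag_ge0// magM ler_wpM2l ?mag_ge0// le_max lexx.
set X := (mag z * m) ^+ 2 in wm *; clearbody X.
rewrite !mag_sqr in wm *; case: w wm => x y /=.
rewrite !mul0r !subr0 ?addr0 ?oppr0 ?add0r ?sub0r => wm h.
suff : 0 < (1 - t * x) ^+ 2 + (t * y) ^+ 2 - t ^+ 2 * X by lra.
have -> : (1 - t * x) ^+ 2 + (t * y) ^+ 2 - t ^+ 2 * X =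
  (1 - t) + t * (1 - t) * (X - (x ^+ 2 + y ^+ 2)) + t * ((1 - x) ^+ 2 + y ^+ 2 - X) by ring.
rewrite sqrrN in h; have u0 : 0 <= 1 - t by lra.
have v0 : 0 <= X - (x ^+ 2 + y ^+ 2) by lra.
have w0 : 0 < (1 - x) ^+ 2 + y ^+ 2 - X by lra.
by have := mulr_gt0 tp w0; have := mulr_ge0 (mulr_ge0 t0 u0) v0; lra.
Qed.

(** The two expansions agree with the Gauss series near 0, and their common
    domain is starshaped about 0. *)
Lemma hyp_cont_eq q q' z : hyp_dom q z -> hyp_dom q' z -> hyp_cont q z = hyp_cont q' z.
Proof.
move=> hq hq'; apply: analytic_segment => [t t01|t t01|].
- exact/hyp_dom_analytic/hyp_dom_star.
- exact/hyp_dom_analytic/hyp_dom_star.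
have [e e0 he] := hyp_cont_gauss q; have [e' e'0 he'] := hyp_cont_gauss q'.
exists (Num.min e e') => [|w]; first by rewrite lt_min e0.
by rewrite subr0 lt_min => /andP[/he -> /he' ->].
Qed.

(** For Re q = 1/2 the two moduli in the rate agree and the domain becomes the
    half plane Re (zq) < 1/2; turning q covers the slit plane. *)
Lemma slit_hyp_dom z : z \in @slit_plane R -> exists q, hyp_dom q z.
Proof.
rewrite inE /slit_plane /= lecE /=.
(* For y != 0 this t gives Re (zq) = x/2 - y t = 0; for y = 0 the condition
   Re (zq) < 1/2 is x < 1. *)
case: z => x y /= h; pose t := if y == 0 then 0 else x / (2 * y).
have ht : x / 2 - y * t < 2^-1.
  rewrite /t; case: eqVneq h => [->|y0] h.
    rewrite mulr0 subr0; have [|//] := ltP x 1; lra.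
  have e : y * (x / (2 * y)) = x / 2 by field.
  by lra.
exists (2^-1 +i* t).
rewrite /hyp_dom; have -> : mob_rate (2^-1 +i* t) = mag (2^-1 +i* t).
  rewrite /mob_rate max_l// !magE /= sub0r sqrrN.
  by rewrite (_ : 1 - 2^-1 = 2^-1 :> R)//; lra.
rewrite -magM.
rewrite -(ltr_pXn2r (n := 2)) ?nnegrE ?mag_ge0// !mag_sqr /=.
by nra.
Qed.

Lemma hyp_dom_open q z : hyp_dom q z -> exists2 e : R, 0 < e &
  forall w, mag (w - z) < e -> hyp_dom q w.
Proof.
rewrite /hyp_dom => hz; set m := mob_rate q in hz *.
have m0 : 0 < m := mob_rate_gt0 q; have q0 := mag_ge0 q.
pose e := (mag (1 - z * q) - mag z * m) / (m + mag q).
have e0 : 0 < e by rewrite divr_gt0//; lra.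
have ee : e * (m + mag q) = mag (1 - z * q) - mag z * m by rewrite divfK//; lra.
exists e => // w we.
have h1 : mag w <= mag z + mag (w - z).
  by have := magD z (w - z); rewrite addrC subrK.
have h2 : mag (1 - z * q) <= mag (1 - w * q) + mag (w - z) * mag q.
  by rewrite -magM; have := magD (1 - w * q) ((w - z) * q); congr (mag _ <= _); ring.
by have := mag_ge0 (w - z); nra.
Qed.

Lemma slit_star z (t : R) : 0 <= t <= 1 -> z \in @slit_plane R ->
  t%:C * z \in @slit_plane R.
Proof.
rewrite !inE /slit_plane /= !lecE /=; case: z => x y /= /andP[t0 t1] h [].
rewrite !mul0r subr0 addr0 => /andP[/eqP ty tx]; apply: h.
have tp : 0 < t by rewrite lt_def t0 andbT; apply/eqP => e; move: tx; rewrite e; lra.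
move: ty => /eqP; rewrite mulf_eq0 gt_eqF//= => ->; rewrite /=.
by nra.
Qed.

(** The local expansions glue to a function that is analytic on the slit plane,
    and any other continuation coincides with it along segments from 0. *)
Lemma hyp2F1E q z : z \in @slit_plane R -> hyp_dom q z ->
  hyp2F1 a b c z = ev (fps_comp (hyp_fps a b c) (mobius_fps q)) (z / (1 - z * q)).
Proof.
move=> sz hq.
have [Q hQ] : exists Q : C -> C, forall w, w \in @slit_plane R -> hyp_dom (Q w) w.
  have ex w : exists p, w \in @slit_plane R -> hyp_dom p w.
    have [/slit_hyp_dom [p hp]|n] := pselect (w \in @slit_plane R); first by exists p.
    by exists 0 => /n.
  by have [Q hQ] := choice ex; exists Q.
pose F w := hyp_cont (Q w) w.
have gauss F' w : is_hyp2F1 a b c F' -> mag w < 1 -> F' w = ev (hyp_fps a b c) w.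
  move=> [_ h] w1; have /h hw : `|w| < 1 by rewrite -[1]/(1%:C) lt_mag.
  have [B hB] := @bnd_hyp (mag w) ltac:(by rewrite mag_ge0).
  exact: (series_unique hw (has_sum_series (ev_hs hB (lexx _)))).
have slit_open w : w \in @slit_plane R -> exists2 e : R, 0 < e &
    forall w', mag (w' - w) < e -> w' \in @slit_plane R /\ hyp_dom (Q w) w'.
  move=> hw; have [e e0 he] := hyp_dom_open (hQ w hw).
  have : exists2 d : R, 0 < d & forall w', mag (w' - w) < d -> w' \in @slit_plane R.
    move: hw; rewrite inE /slit_plane /= lecE /=; case: w {e e0 he} => x y /= hw.
    have [y0|y0] := eqVneq y 0.
      have x1 : 0 < 1 - x.
        by rewrite subr_gt0 ltNge; apply/negP => x1; apply: hw; rewrite y0 eqxx.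
      exists (1 - x) => // -[x' y'] hw'; rewrite inE /slit_plane /= lecE /= => /andP[_].
      have h : x' - x <= mag ((x' +i* y') - (x +i* y)).
        exact: le_trans (ler_norm _) (mag_Re ((x' +i* y') - (x +i* y))).
      by lra.
    exists `|y|; first by rewrite normr_gt0.
    move=> [x' y'] hw'; rewrite inE /slit_plane /= lecE /= => /andP[/eqP y'0 _].
    have h : `|y' - y| <= mag ((x' +i* y') - (x +i* y)).
      exact: mag_Im ((x' +i* y') - (x +i* y)).
    by rewrite y'0 sub0r normrN -[y in _ +i* y]y'0 in h; lra.
  move=> [d d0 hd]; exists (Num.min e d) => [|w']; first by rewrite lt_min e0.
  by rewrite lt_min => /andP[/he ? /hd].
have FP : is_hyp2F1 a b c F.
  split=> [w hw|w w1].
    have /analytic_atP [A [r [B [r0 AB hA]]]] := hyp_dom_analytic (hQ w hw).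
    have [e e0 he] := slit_open w hw.
    have m0 : 0 < Num.min r (e / 2) by rewrite lt_min r0 divr_gt0.
    apply/analytic_atP; exists A, (Num.min r (e / 2)), B; split.
    - exact: m0.
    - by apply: bndS AB; rewrite ltW// ge_min lexx.
    move=> h; rewrite le_min => /andP[hr heh]; rewrite -(hA _ hr) /F.
    have /he [s1 s2] : mag (w + h - w) < e by rewrite addrAC subrr add0r; lra.
    by apply: hyp_cont_eq => //; apply: hQ.
  have {}w1 : mag w < 1 by move: w1; rewrite -[1]/(1%:C) lt_mag.
  have [B hB] := @bnd_hyp (mag w) ltac:(by rewrite mag_ge0).
  have sw : w \in @slit_plane R.
    rewrite inE /slit_plane /= lecE /= => /andP[_ h].
    by have := le_trans (ler_norm _) (mag_Re w); lra.
  have dw : hyp_dom 0 w by rewrite /hyp_dom mob_rate0 mulr0 subr0 mag1 mulr1.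
  suff -> : F w = ev (hyp_fps a b c) w by apply: has_sum_series (ev_hs hB (lexx _)).
  rewrite /F (hyp_cont_eq (hQ _ sw) dw) /hyp_cont mulr0 subr0 divr1.
  by rewrite hyp_comp0.
rewrite /hyp2F1; case: xgetP => [w _ [F' hF' <-]|/(_ (F z)) []]; last by exists F.
rewrite -/(hyp_cont q z) -(hyp_cont_eq (hQ _ sz) hq) -/(F z).
apply: analytic_segment => [t t01|t t01|].
- by apply: hF'.1; apply: slit_star.
- by apply: FP.1; apply: slit_star.
exists 1; first exact: ltr01.
by move=> w'; rewrite subr0 => w1; rewrite (gauss _ _ hF' w1) (gauss _ _ FP w1).
Qed.

End Continuation.

(** * Ladder relations and the telescoping sum *)

(** Algebra of the ladder relations, in a commutative ring with a derivation D;
    in the application D is the Euler derivation of formal power series. *)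
Section Ladder.
Variables (S : comNzRingType) (D : S -> S).
Hypothesis D_mul : forall a b, D (a * b) = D a * b + a * D b.
Hypothesis D_add : forall a b, D (a + b) = D a + D b.

Lemma ladder_up (X U Z A Zk r r1 x k a : S) :
  (1 - X) * U = 1 -> Z = X * U -> D Zk = k * Zk * U -> D A = - (a * Z * A) ->
  r = (x + k) * r1 - (x + a) * X * r1 + (1 - X) * D r1 ->
  D (Zk * (A * r1)) + x * (Zk * (A * r1)) = U * (Zk * (A * r)).
Proof.
move=> UE -> hZ hA ->; rewrite !D_mul hZ hA.
transitivity (Zk * (A * (U * ((x + k) * r1 - (x + a) * X * r1) + ((1 - X) * U) * D r1)));
  last by ring.
rewrite UE mul1r.
have -> : x * (Zk * (A * r1)) = (1 - X) * U * x * (Zk * (A * r1)) by rewrite UE mul1r.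
by ring.
Qed.

Variables (p q2 : S) (h1 h2 al be : nat -> S) (x y : S).
Hypothesis q2E : q2 + q2 = 1.
Hypothesis D_q2 : D q2 = 0.
Hypothesis D_al : forall j, D (al j) = 0.
Hypothesis alS : forall j, al j.+1 = al j * be j.
Hypothesis al0 : al 0%N = 1.
Hypothesis down1 : forall j, D (h1 j) = - (p * be j * h1 j.+1).
Hypothesis down2 : forall j, D (h2 j) = - (p * be j * h2 j.+1).
Hypothesis up1 : forall j,
  D (p ^+ j.+1 * h1 j.+1) + x * (p ^+ j.+1 * h1 j.+1) = p ^+ j.+1 * h1 j.
Hypothesis up2 : forall j,
  D (p ^+ j.+1 * h2 j.+1) + y * (p ^+ j.+1 * h2 j.+1) = p ^+ j.+1 * h2 j.

Definition ladder_term j : S :=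
  (if j == 0%N then q2 else 1) * (al j * (p ^+ j * (h1 j * h2 j))).

Definition ladder_rest j : S :=
  q2 * (al j.+1 * (p ^+ j.+1 * (h1 j * h2 j.+1 + h1 j.+1 * h2 j))).

(** With T_j the ladder terms and W_j the rests, (D + (x + y)/2) T_j = W_(j-1) -
    W_j for j > 0, by one descending and one ascending relation for each factor;
    the weight 1/2 of T_0 makes the first difference come out as a multiple of
    h_0(x) h_0(y). *)
Lemma ladder_sum N :
  D (\sum_(j < N.+1) ladder_term j) + q2 * (x + y) * \sum_(j < N.+1) ladder_term j =
  q2 * q2 * (x + y) * (h1 0 * h2 0) - ladder_rest N.
Proof.
elim: N => [|N IH].
  rewrite big_ord1 /ladder_term /ladder_rest /= alS al0 !expr0 expr1 !D_mul.
  have D1 : D 1 = 0.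
    by apply: (addrI (D 1)); rewrite addr0 -{3}[1]mulr1 D_mul mulr1 mul1r.
  by rewrite D_q2 D1 down1 down2; ring.
rewrite big_ord_recr /= D_add mulrDr addrACA IH.
suff : D (ladder_term N.+1) + q2 * (x + y) * ladder_term N.+1 =
  ladder_rest N - ladder_rest N.+1 by move=> ->; ring.
rewrite /ladder_term /ladder_rest /= mul1r [D (al _ * _)]D_mul D_al mul0r add0r.
have e1 : D (p ^+ N.+1 * (h1 N.+1 * h2 N.+1)) + x * (p ^+ N.+1 * (h1 N.+1 * h2 N.+1)) =
    p ^+ N.+1 * (h1 N * h2 N.+1) - p ^+ N.+2 * be N.+1 * (h1 N.+1 * h2 N.+2).
  have -> : p ^+ N.+1 * (h1 N * h2 N.+1) = (p ^+ N.+1 * h1 N) * h2 N.+1 by ring.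
  rewrite -up1 [p ^+ N.+2]exprS; have := down2 N.+1; move: (p ^+ N.+1) => P d2.
  by rewrite mulrA D_mul d2; ring.
have e2 : D (p ^+ N.+1 * (h1 N.+1 * h2 N.+1)) + y * (p ^+ N.+1 * (h1 N.+1 * h2 N.+1)) =
    p ^+ N.+1 * (h1 N.+1 * h2 N) - p ^+ N.+2 * be N.+1 * (h1 N.+2 * h2 N.+1).
  have -> : p ^+ N.+1 * (h1 N.+1 * h2 N) = (p ^+ N.+1 * h2 N) * h1 N.+1 by ring.
  rewrite -up2 [p ^+ N.+2]exprS; have := down1 N.+1; move: (p ^+ N.+1) => P d1.
  have -> : P * (h1 N.+1 * h2 N.+1) = P * h2 N.+1 * h1 N.+1 by ring.
  by rewrite [D (_ * h1 _)]D_mul d1; ring.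
set d := D _ in e1 e2 *; set t := p ^+ N.+1 * (h1 N.+1 * h2 N.+1) in e1 e2 *.
transitivity (q2 * al N.+1 * ((d + x * t) + (d + y * t))).
  by rewrite -[al N.+1 * d]mul1r -q2E; ring.
by rewrite e1 e2 (alS N.+1); ring.
Qed.

End Ladder.

Section FormalKernel.
Variable R : realType.
Local Notation C := R[i].
Local Notation fps := (fps R[i]).

#[local] Opaque fps_mul fps_add fps_geom fpsX fpsC.

Lemma natC_neq0 n : (n.+1%:R : C) != 0. Proof. by rewrite pnatr_eq0. Qed.

Lemma natC_gt0 n : (0 < n)%N -> (n%:R : C) != 0.
Proof. by case: n => // n _; apply: natC_neq0. Qed.

Lemma poch_fact x n : pochhammer x.+1%:R n = (x + n)`!%:R / x`!%:R :> C.
Proof. by rewrite -poch_nat mulrC mulKf// fact_neq0. Qed.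

Lemma theta1 : theta (1 : fps) = 0.
Proof. by rewrite -[1](rmorph1 (@fpsC C)) thetaC. Qed.

Section TsumTheory.
Implicit Types (G : nat -> fps).

Lemma fps_tsumD G G' : fps_tsum (fun k => G k + G' k) = fps_tsum G + fps_tsum G'.
Proof. by apply: fps_ext => n; rewrite fpsD -big_split. Qed.

Lemma fps_tsumB G G' : fps_tsum (fun k => G k - G' k) = fps_tsum G - fps_tsum G'.
Proof. by apply: fps_ext => n; rewrite fpsB -sumrB. Qed.

Lemma theta_tsum G : theta (fps_tsum G) = fps_tsum (fun k => theta (G k)).
Proof. by apply: fps_ext => n; rewrite /theta /fps_tsum mulr_sumr. Qed.

Lemma fps_tsum_exchange (G : nat -> nat -> fps) :
  fps_tsum (fun x => fps_tsum (G x)) = fps_tsum (fun z => fps_tsum (G ^~ z)).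
Proof. by apply: fps_ext => n; rewrite /fps_tsum exchange_big. Qed.

Lemma triangularCX (c : nat -> C) G : triangular (fun k => fpsC (c k) * (fpsX ^+ k * G k)).
Proof. by move=> k n nk; rewrite fpsCM fpsXnM nk mulr0. Qed.

End TsumTheory.

(** U is 1/(1 - X). *)
Definition fpsU : fps := fps_geom 1.

Lemma fpsU_geom : fpsU = fps_geom 1. Proof. by []. Qed.

#[local] Opaque fpsU.

Lemma fpsUE : (1 - fpsX) * fpsU = 1.
Proof. by have := fps_geomE (1 : C); rewrite rmorph1 mul1r fpsU_geom. Qed.

Lemma fpsU_def : fpsU = 1 + fpsX * fpsU.
Proof. by rewrite -{1}fpsUE; ring. Qed.

Lemma theta_mulU (a b : fps) : (1 - fpsX) * a = b -> a = fpsU * b.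
Proof. by move=> <-; rewrite mulrA [fpsU * _]mulrC fpsUE mul1r. Qed.

Lemma thetaU : theta fpsU = fpsX * fpsU ^+ 2.
Proof.
have h : (1 - fpsX) * theta fpsU = fpsX * fpsU.
  have := congr1 (@theta _) fpsUE; rewrite thetaM raddfB /= thetaX.
  rewrite -[1](rmorph1 (@fpsC C)) !thetaC sub0r mulNr addrC => /eqP.
  by rewrite subr_eq0 => /eqP.
by rewrite (theta_mulU h); ring.
Qed.

(** The series X/(1 - X), that is - z for the argument z = xi/(xi - 1) of the
    functions phi. *)
Definition fpsZ : fps := fpsX * fpsU.

Lemma fpsZE : fpsZ = fpsX * fpsU. Proof. by []. Qed.

#[local] Opaque fpsZ.

Lemma thetaZ : theta fpsZ = fpsZ * fpsU.
Proof.
rewrite fpsZE thetaM thetaX thetaU -[in RHS]mulrA; transitivity (fpsX * fpsU * (1 + fpsX * fpsU)); first ring.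
by rewrite -fpsU_def; ring.
Qed.

Lemma theta_expE (a b : fps) k : theta a = a * b -> theta (a ^+ k) = fpsC k%:R * a ^+ k * b.
Proof.
move=> h; elim: k => [|k IH]; first by rewrite rmorph0 !mul0r expr0 -[1](rmorph1 (@fpsC C)) thetaC.
by rewrite exprS thetaM IH h -natr1 rmorphD rmorph1; ring.
Qed.

(** The Pfaff transformation for the argument xi/(xi - 1): a change of sign of
    the variable turns 1/(1 + X) into 1/(1 - X). *)
Definition fps_alt (a : fps) : fps := fun n => (- 1) ^+ n * a n.

Lemma fps_altM (a b : fps) : fps_alt (a * b) = fps_alt a * fps_alt b.
Proof.
apply: fps_ext => n; rewrite /fps_alt !fpsM mulr_sumr; apply: eq_bigr => -[i /= ni] _.
have -> : (- 1) ^+ n = (- 1) ^+ i * (- 1) ^+ (n - i) :> C by rewrite -exprD subnKC.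
by ring.
Qed.

Lemma pfaff_alt (a b c : C) : (forall n, pochhammer c n != 0) ->
  fps_alt (fps_comp (hyp_fps a b c) (mobius_fps 1)) =
  bin_fps (- a) 1 * (fun l => pochhammer a l * pochhammer (c - b) l /
                              (pochhammer c l * l`!%:R)).
Proof.
move=> c0; rewrite pfaff_comp// fps_altM; congr (_ * _); apply: fps_ext => l.
  by rewrite /fps_alt /bin_fps mulrCA -exprMn mulNr mulrN mulr1 opprK.
have := shifted_moment b c0 1 l 0 0.
rewrite subrr [RHS]big_ord_recl [X in _ + X]big1 => [|i _]; last by rewrite lift0 exprS !mul0r mulr0.
rewrite /fps_alt /pfaff_fps; under eq_bigr do rewrite add0n; move=> ->.
rewrite bin0 subn0 !add0n expr0 addr0 !mul1r /beta_moment poch0 mul1r add0n.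
rewrite mulrCA; set s := (- 1) ^+ l; have ss : s * s = 1 by rewrite /s -exprMn mulrNN mulr1 expr1n.
rewrite [s * (s * _)]mulrA ss mul1r.
have := fact_neq0 R l; have := c0 l.
by move: (pochhammer _ _) (pochhammer _ _) (pochhammer _ _) => P Q S h1 h2; field; rewrite h1 h2.
Qed.

Lemma pfaffZ (a b c : C) : (forall n, pochhammer c n != 0) ->
  fps_tsum (fun k => fpsC ((- 1) ^+ k * hyp2F1_coef a b c k) * fpsZ ^+ k) =
  bin_fps (- a) 1 * (fun l => pochhammer a l * pochhammer (c - b) l /
                              (pochhammer c l * l`!%:R)).
Proof.
move=> c0; rewrite -pfaff_alt//; apply: fps_ext => n.
rewrite /fps_alt fps_compE; last by rewrite /mobius_fps fpsXM.
rewrite mulr_sumr; apply: eq_bigr => -[k /= kn] _; have kn' : (k <= n)%N by [].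
rewrite fpsCM fpsZE /mobius_fps fpsU_geom !exprMn -(bin_fps_nat k 1) -(bin_fps_nat k (- 1)).
rewrite !fpsXnM ltnNge kn' /=.
rewrite /bin_fps expr1n mulr1 /hyp_fps.
have -> : (- 1) ^+ n = (- 1) ^+ k * (- 1) ^+ (n - k) :> C by rewrite -exprD subnKC.
set s := (- 1) ^+ (n - k); have ss : s * s = 1 by rewrite /s -exprMn mulrNN mulr1 expr1n.
set P := pochhammer _ _ / _; set f := hyp2F1_coef _ _ _ _; set t := (- 1) ^+ k.
have -> : t * s * (f * (P * s)) = t * f * P * (s * s) by ring.
by rewrite ss mulr1.
Qed.

Variable nu : C.
Let a0 : C := 2^-1 - nu.
Let b0 : C := 2^-1 + nu.

Let ab1 : a0 + b0 = 1.
Proof. by rewrite /a0 /b0 addrACA addNr addr0 -[RHS](mulfV (natC_neq0 1)); field. Qed.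

(** By the functional equation this product is the ratio of Gamma(1/2 - nu + j)
    Gamma(1/2 + nu + j) to Gamma(1/2 - nu) Gamma(1/2 + nu). *)
Definition alpha j : C := pochhammer a0 j * pochhammer b0 j.

Lemma alphaS j : alpha j.+1 = alpha j * ((a0 + j%:R) * (b0 + j%:R)).
Proof. by rewrite /alpha !pochS; ring. Qed.

(** These series make up x!/(x+j)! phi_(j+1)(x) after the Pfaff
    transformation has turned the argument xi/(xi - 1) into xi. *)
Definition rfps j x : fps := fun n =>
  x`!%:R * (pochhammer (a0 + j%:R) n * pochhammer (x%:R + a0) n) /
  ((x + j + n)`!%:R * n`!%:R).

Definition afps : fps := bin_fps (- a0) 1.

Definition hfps j x : fps := (1 - fpsX) ^+ j * (afps * rfps j x).

Lemma theta_afps : theta afps = - (fpsC a0 * fpsZ * afps).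
Proof.
have h : (1 - fpsX) * theta afps = - (fpsC a0 * fpsX * afps).
  have := theta_bin (- a0) 1; rewrite -/afps rmorph1 rmorphN mul1r => h.
  by rewrite mulrBl mul1r {1}h; ring.
by rewrite (theta_mulU h) fpsZE; ring.
Qed.

(** A contiguity relation of Gauss, which amounts to a cancellation between
    three consecutive Pochhammer products; likewise for the next one. *)
Lemma rfps_down j x : theta (rfps j x) = fpsZ *
  (fpsC (a0 + j%:R) * rfps j x - fpsC ((a0 + j%:R) * (b0 + j%:R)) * rfps j.+1 x).
Proof.
rewrite fpsZE [fpsX * _]mulrC -mulrA; apply: theta_mulU.
suff h : theta (rfps j x) = fpsX * (theta (rfps j x) + fpsC (a0 + j%:R) * rfps j x
    - fpsC ((a0 + j%:R) * (b0 + j%:R)) * rfps j.+1 x).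
  by rewrite mulrBl mul1r {1}h; ring.
apply: fps_ext => -[|n]; first by rewrite fpsXM /theta mul0r.
rewrite fpsXM fpsB fpsD !fpsCM /theta /rfps.
rewrite [pochhammer (x%:R + a0) n.+1]pochS.
set P' := pochhammer (a0 + j.+1%:R) n; set P := pochhammer (a0 + j%:R) n.+1.
set Pn := pochhammer (a0 + j%:R) n; set Q := pochhammer (x%:R + a0) n.
have eP' : (a0 + j%:R) * P' = P by rewrite /P pochSl /P' -natr1 addrA.
have ePn : Pn * (a0 + j%:R + n%:R) = P by rewrite /P pochS.
have -> : (x + j.+1 + n = (x + j + n).+1)%N by lia.
rewrite addnS !factS !natrM.
have D0 := natC_neq0 (x + j + n); have N0 := natC_neq0 n.
have hD : x%:R + a0 + n%:R = (x + j + n).+1%:R - (b0 + j%:R).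
  by rewrite -natr1 !natrD -ab1; ring.
rewrite hD; move: D0 N0 (fact_neq0 R (x + j + n)) (fact_neq0 R n).
move: (_.+1%:R) (n.+1%:R) ((x + j + n)`!%:R) (n`!%:R) (x`!%:R) => D N f g X0 D0 N0 f0 g0.
transitivity (X0 * P * Q / (f * g) - (b0 + j%:R) * (X0 * P * Q / (D * f * g))).
  by field; rewrite D0 N0 f0 g0.
by rewrite -{1}ePn -eP'; field; rewrite D0 f0 g0.
Qed.

Lemma rfps_up j x : rfps j x = fpsC (x + j.+1)%:R * rfps j.+1 x
  - fpsC (x%:R + a0) * fpsX * rfps j.+1 x + (1 - fpsX) * theta (rfps j.+1 x).
Proof.
suff h : rfps j x = fpsC (x + j.+1)%:R * rfps j.+1 x + theta (rfps j.+1 x)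
    - fpsX * (fpsC (x%:R + a0) * rfps j.+1 x + theta (rfps j.+1 x)).
  by rewrite {1}h; ring.
apply: fps_ext => -[|n].
  rewrite fpsB fpsXM subr0 fpsD fpsCM /theta mul0r addr0 /rfps !poch0 !addn0.
  rewrite addnS factS natrM; move: (fact_neq0 R (x + j)) (natC_neq0 (x + j)) (fact_neq0 R 0).
  move: (_.+1%:R) ((x + j)`!%:R) (0`!%:R) => D f g f0 D0 g0.
  by field; rewrite f0 D0 g0.
rewrite fpsB fpsXM !fpsD !fpsCM /theta /rfps.
rewrite [pochhammer (x%:R + a0) n.+1]pochS.
set P' := pochhammer (a0 + j.+1%:R) n; set P := pochhammer (a0 + j%:R) n.+1.
set P1 := pochhammer (a0 + j.+1%:R) n.+1; set Q := pochhammer (x%:R + a0) n.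
have eP : P = (a0 + j%:R) * P' by rewrite /P pochSl /P' -[j.+1%:R]natr1 addrA.
have eP1 : P1 = P' * (a0 + j%:R + n.+1%:R).
  by rewrite /P1 pochS -/P'; congr (_ * _); rewrite -[j.+1%:R]natr1 -[n.+1%:R]natr1; ring.
have -> : (x + j.+1 + n = (x + j + n).+1)%N by lia.
have -> : (x + j.+1 + n.+1 = (x + j + n).+2)%N by lia.
have -> : (x + j + n.+1 = (x + j + n).+1)%N by lia.
have -> : (x + j.+1)%:R = (x + j + n).+2%:R - n.+1%:R :> C.
  by rewrite -natrB; [congr (_%:R); lia|lia].
move: ((x + j + n).+1) => m; rewrite (factS m) (factS n) !natrM.
have N1 : n.+1%:R = n%:R + 1 :> C by rewrite natr1.
move: (natC_neq0 m) (natC_neq0 n) (fact_neq0 R m) (fact_neq0 R n).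
rewrite eP eP1; move: (m.+1%:R) (n.+1%:R) N1 (m`!%:R) (n`!%:R) (x`!%:R).
move=> D N -> f g X0 D0 N0 f0 g0.
by field; rewrite D0 N0 f0 g0.
Qed.

(** The parameter p = X/(1 - X)^2 in which the sum over j proceeds. With it the
    hypergeometric equation splits into the first order relations
    theta h_j = - p beta_j h_(j+1) and
    (theta + x)(p^(j+1) h_(j+1)) = p^(j+1) h_j. *)
Definition pfps : fps := fpsX * fpsU ^+ 2.

Lemma pfpsE : pfps = fpsX * fpsU ^+ 2. Proof. by []. Qed.

#[local] Opaque pfps rfps.

Lemma pfpsXn j : pfps ^+ j = fpsX ^+ j * (fpsU ^+ 2) ^+ j.
Proof. by rewrite pfpsE exprMn. Qed.

Lemma pfps_h j x : pfps ^+ j * hfps j x = fpsZ ^+ j * (afps * rfps j x).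
Proof.
rewrite /hfps mulrA -exprMn; congr (_ ^+ _ * _).
have -> : pfps * (1 - fpsX) = fpsZ * ((1 - fpsX) * fpsU) by rewrite pfpsE fpsZE; ring.
by rewrite fpsUE mulr1.
Qed.

Lemma pfps_h1 j x : pfps ^+ j.+1 * hfps j x = fpsU * (fpsZ ^+ j.+1 * (afps * rfps j x)).
Proof.
rewrite exprS -mulrA pfps_h exprS.
have -> : pfps = fpsU * fpsZ by rewrite pfpsE fpsZE; ring.
by ring.
Qed.

(** The descending half of the ladder; beta_j = alpha_(j+1) / alpha_j. *)
Lemma hfps_down j x : theta (hfps j x) =
  - (pfps * fpsC ((a0 + j%:R) * (b0 + j%:R)) * hfps j.+1 x).
Proof.
have e1 : theta (1 - fpsX : fps) = (1 - fpsX) * - fpsZ.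
  rewrite raddfB /= thetaX theta1 sub0r.
  have -> : (1 - fpsX) * - fpsZ = - (fpsX * ((1 - fpsX) * fpsU)) by rewrite fpsZE; ring.
  by rewrite fpsUE mulr1.
rewrite /hfps thetaM (theta_expE j e1) thetaM theta_afps rfps_down.
have -> : pfps * fpsC ((a0 + j%:R) * (b0 + j%:R)) * ((1 - fpsX) ^+ j.+1 * (afps * rfps j.+1 x))
  = fpsZ * ((1 - fpsX) * fpsU) * fpsC ((a0 + j%:R) * (b0 + j%:R))
    * ((1 - fpsX) ^+ j * (afps * rfps j.+1 x)) by rewrite exprS pfpsE fpsZE; ring.
by rewrite fpsUE !rmorphD !rmorphM !rmorphD; ring.
Qed.

Lemma hfps_up j x : theta (pfps ^+ j.+1 * hfps j.+1 x) +
    fpsC x%:R * (pfps ^+ j.+1 * hfps j.+1 x) = pfps ^+ j.+1 * hfps j x.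
Proof.
apply: etrans (esym (pfps_h1 j x)).
apply: etrans (congr1 (fun t => theta t + fpsC x%:R * t) (pfps_h j.+1 x)) _.
apply: (ladder_up (@thetaM _) fpsUE fpsZE (theta_expE j.+1 thetaZ) theta_afps).
by rewrite {1}rfps_up natrD !rmorphD.
Qed.

End FormalKernel.

(** * The kernel as a power series in xi *)

Section KernelEquation.
Variable R : realType.
Local Notation C := R[i].
Local Notation fps := (fps R[i]).
Variable nu : C.
Let a0 : C := 2^-1 - nu.
Let b0 : C := 2^-1 + nu.
Local Notation alpha := (alpha nu).

Lemma thetaD (a b : fps) : theta (a + b) = theta a + theta b.
Proof. exact: raddfD. Qed.

Lemma thetaB (a b : fps) : theta (a - b) = theta a - theta b.
Proof. exact: raddfB. Qed.

Definition ffps x : fps := hfps nu 0 x.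

Lemma half_sum (C' : numFieldType) : 2^-1 + 2^-1 = 1 :> C'.
Proof. by field. Qed.

Let subb0 : 1 - b0 = a0.
Proof. by rewrite /a0 /b0 opprD addrA -{1}(half_sum C) addrK. Qed.

(** The variable Z is the negative of the argument of 2F1, whence the signs. *)
Lemma ffps_tsum x : ffps x =
  fps_tsum (fun k => fpsC ((- 1) ^+ k * hyp2F1_coef a0 b0 x.+1%:R k) * (fpsZ R) ^+ k).
Proof.
rewrite pfaffZ; last exact: poch_nat_neq0.
rewrite /ffps /hfps expr0 mul1r; congr (_ * _); apply: fps_ext => l.
rewrite /rfps addn0 addr0 poch_fact.
have -> : x.+1%:R - b0 = x%:R + a0 by rewrite -natr1 -addrA subb0.
rewrite -/a0; move: (fact_neq0 R x) (fact_neq0 R (x + l)) (fact_neq0 R l).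
move: (pochhammer _ _) (pochhammer _ _) ((x + l)`!%:R) (x`!%:R) (l`!%:R) => P Q e f g f0 e0 g0.
by field; rewrite f0 e0 g0.
Qed.

(** Euler's transformation: the factor (1 - X)^(-z) of Z^z is absorbed in the
    binomial prefactor, which makes X^z f_z a series in Z alone. *)
Lemma ffps_shift z : fpsX ^+ z * ffps z = (fpsZ R) ^+ z *
  fps_tsum (fun k => fpsC ((- 1) ^+ k *
    hyp2F1_coef (a0 + z%:R) (b0 + z%:R) z.+1%:R k) * (fpsZ R) ^+ k).
Proof.
rewrite pfaffZ; last exact: poch_nat_neq0.
have -> : (fun l => pochhammer (a0 + z%:R) l * pochhammer (z.+1%:R - (b0 + z%:R)) l /
    (pochhammer z.+1%:R l * l`!%:R)) = rfps nu 0 z.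
  apply: fps_ext => l; rewrite /rfps addn0 addr0 poch_fact.
  have -> : z.+1%:R - (b0 + z%:R) = a0 by rewrite -subb0 -natr1; ring.
  rewrite -/a0 [z%:R + a0]addrC.
  move: (fact_neq0 R z) (fact_neq0 R (z + l)) (fact_neq0 R l).
  move: (pochhammer _ _) (pochhammer _ _) ((z + l)`!%:R) (z`!%:R) (l`!%:R) => P Q e f g f0 e0 g0.
  by field; rewrite f0 e0 g0.
rewrite /ffps /hfps expr0 mul1r /afps -/a0.
have -> : bin_fps (- a0) 1 = bin_fps z%:R 1 * bin_fps (- (a0 + z%:R)) 1.
  by rewrite bin_fpsD; congr bin_fps; ring.
by rewrite bin_fps_nat /fpsZ /fpsU exprMn !mulrA.
Qed.

(** Partial fractions of 1/(x (x+1) ... (x+m)), by induction on m with Pascal's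
    rule. *)
Lemma altsum_inv m x : (0 < x)%N ->
  \sum_(z < m.+1) 'C(m, z)%:R * ((- 1) ^+ z / (x + z)%:R) =
  m`!%:R / pochhammer x%:R m.+1 :> C.
Proof.
elim: m x => [|m IH] x x0.
  by rewrite big_ord1 expr0 addn0 pochS poch0 !mul1r addr0.
rewrite (sum_pascal (fun k _ => (- 1) ^+ k / (x + k)%:R)).
transitivity (\sum_(z < m.+1) 'C(m, z)%:R * ((- 1) ^+ z / (x + z)%:R) -
   \sum_(z < m.+1) 'C(m, z)%:R * ((- 1) ^+ z / (x.+1 + z)%:R) : C).
  by rewrite -sumrB; apply: eq_bigr => k _; rewrite exprS addnS addSn; ring.
rewrite !IH// pochSl natr1 [pochhammer x%:R m.+2]pochSl natr1 !pochS factS natrM.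
have := natC_gt0 R x0; case: x x0 => // x _ x0.
have -> : x.+2%:R = x.+1%:R + 1 :> C by rewrite natr1.
have := poch_nat_neq0 R x.+1 m; rewrite -natr1.
have h1 : x.+1%:R + m.+1%:R != 0 :> C by rewrite -natrD natC_gt0// addSn.
move: h1; rewrite -[m.+1%:R]natr1.
move: (pochhammer _ _) (m`!%:R) x0 => P f; move: (x.+1%:R) => X X0 h1 P0.
have h2 : X + 1 + m%:R != 0 by have -> : X + 1 + m%:R = X + (m%:R + 1) by ring.
by field; rewrite h2 P0 X0.
Qed.

Lemma altsum_frac m x : (0 < x)%N -> (0 < m)%N ->
  \sum_(z < m.+1) 'C(m, z)%:R * ((- 1) ^+ z * (z%:R / (x + z)%:R)) =
  - (m`!%:R / pochhammer x.+1%:R m) :> C.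
Proof.
move=> x0 m0.
have alt0 : \sum_(z < m.+1) 'C(m, z)%:R * (- 1) ^+ z = 0 :> C.
  case: m m0 => // m _; rewrite (sum_pascal (fun k _ => (- 1) ^+ k)) big1// => k _.
  by rewrite exprS mulN1r addNr mulr0.
transitivity (\sum_(z < m.+1) 'C(m, z)%:R * (- 1) ^+ z -
   x%:R * \sum_(z < m.+1) 'C(m, z)%:R * ((- 1) ^+ z / (x + z)%:R) : C).
  rewrite mulr_sumr -sumrB; apply: eq_bigr => k _.
  have h : (x + k)%:R != 0 :> C by rewrite natC_gt0// addn_gt0 x0.
  have -> : k%:R = (x + k)%:R - x%:R :> C by rewrite natrD; ring.
  by move: h; move: ((x + k)%:R) => y h; field.
rewrite alt0 altsum_inv// sub0r; congr (- _); rewrite pochSl natr1.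
have := natC_gt0 R x0; have := poch_nat_neq0 R x m.
by move: (pochhammer _ _) => P P0 X0; field; rewrite P0 X0.
Qed.

(** Twice the value at z of the weight x psi(x), without the power of xi. *)
Definition weight z : C := z%:R * alpha z / z`!%:R ^+ 2.

Lemma weight0 : weight 0 = 0.
Proof. by rewrite /weight !mul0r. Qed.

(** All dependence on m - z recombines into a binomial coefficient, so that the
    sum over z becomes an alternating sum of z/(x + z). *)
Lemma weight_coef x z m : (0 < x)%N -> (z <= m)%N ->
  weight z / (x + z)%:R * ((- 1) ^+ (m - z) *
    hyp2F1_coef (a0 + z%:R) (b0 + z%:R) z.+1%:R (m - z)) =
  (- 1) ^+ m * alpha m / m`!%:R ^+ 2 *
  ('C(m, z)%:R * ((- 1) ^+ z * (z%:R / (x + z)%:R))).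
Proof.
move=> x0 zm; rewrite /weight /hyp2F1_coef poch_fact subnKC//.
have -> : alpha m = alpha z * (pochhammer (a0 + z%:R) (m - z) * pochhammer (b0 + z%:R) (m - z)).
  by rewrite /alpha -/a0 -/b0 -{1 2}(subnKC zm) !pochD; ring.
have -> : (- 1) ^+ m = (- 1) ^+ z * (- 1) ^+ (m - z) :> C by rewrite -exprD subnKC.
have s2 : (- 1) ^+ z * (- 1) ^+ z = 1 :> C by rewrite -exprMn mulrNN mulr1 expr1n.
have -> : m`!%:R = 'C(m, z)%:R * (z`!%:R * (m - z)`!%:R) :> C by rewrite -!natrM bin_fact.
have h : (x + z)%:R != 0 :> C by rewrite natC_gt0// addn_gt0 x0.
have b1 : 'C(m, z)%:R != 0 :> C by rewrite natC_gt0// bin_gt0.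
move: b1 h (fact_neq0 R z) (fact_neq0 R (m - z)) s2.
move: (pochhammer _ _) (pochhammer _ _) (alpha z) => Q P al.
move: ((x + z)%:R) ('C(m, z)%:R) (z`!%:R) ((m - z)`!%:R) (z%:R) => y B f g Z B0 y0 f0 g0.
move: ((- 1) ^+ z) ((- 1) ^+ (m - z)) => s t ss.
have -> : s * t * (al * (P * Q)) / (B * (f * g)) ^+ 2 * (B * (s * (Z / y))) =
  (s * s) * (t * (al * (P * Q)) / (B * (f * g)) ^+ 2 * (B * (Z / y))) by ring.
by rewrite ss; field; rewrite B0 y0 f0 g0.
Qed.

#[local] Opaque fps_mul fps_add fps_geom fpsX fpsC fpsZ rfps hfps.

Lemma ffps_shift_coef z n : (fpsX ^+ z * ffps z) n = \sum_(m < n.+1)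
  (if (z <= m)%N then (- 1) ^+ (m - z) *
     hyp2F1_coef (a0 + z%:R) (b0 + z%:R) z.+1%:R (m - z) else 0) * ((fpsZ R) ^+ m) n.
Proof.
pose e k : C := (- 1) ^+ k * hyp2F1_coef (a0 + z%:R) (b0 + z%:R) z.+1%:R k.
have ZX k : (fpsZ R) ^+ k = fpsX ^+ k * (fpsU R) ^+ k by rewrite fpsZE exprMn.
have tri : triangular (fun k => fpsC (e k) * (fpsZ R) ^+ k).
  by move=> k m mk; rewrite fpsCM ZX fpsXnM mk mulr0.
rewrite ffps_shift (fps_tsumM _ tri) /fps_tsum.
have -> : \sum_(k < n.+1) ((fpsZ R) ^+ z * (fpsC (e k) * (fpsZ R) ^+ k)) n =
    \sum_(k < n.+1) e k * ((fpsZ R) ^+ (k + z)) n.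
  by apply: eq_bigr => k _; rewrite mulrCA fpsCM addnC exprD.
rewrite -(big_mkord xpredT (fun k => e k * ((fpsZ R) ^+ (k + z)) n)).
pose G m := (if (z <= m)%N then e (m - z)%N else 0) * ((fpsZ R) ^+ m) n.
rewrite -[RHS](big_mkord xpredT G).
have [zn|nz] := leqP z n; last first.
  rewrite !big1_seq// => k /andP[_]; rewrite mem_index_iota ltnS => /andP[_ kn].
    by rewrite /G ifF ?mul0r//; apply/negbTE; rewrite -ltnNge (leq_ltn_trans kn nz).
  by rewrite ZX fpsXnM (leq_trans nz (leq_addl _ _)) mulr0.
have -> : \sum_(0 <= m < n.+1) G m = \sum_(0 <= k < n.+1 - z) G (k + z)%N.
  rewrite (@big_cat_nat _ _ _ z 0 n.+1)//=; last by rewrite (leq_trans zn).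
  rewrite [X in X + _]big1_seq ?add0r; last first.
    by move=> k /andP[_]; rewrite mem_index_iota => /andP[_ kz]; rewrite /G leqNgt kz mul0r.
  by rewrite -{1}[z]add0n big_addn.
rewrite (@big_cat_nat _ _ _ (n.+1 - z) 0 n.+1)//= ?leq_subr//.
rewrite [X in _ + X]big1_seq ?addr0; last first.
  move=> k /andP[_]; rewrite mem_index_iota => /andP[kz _].
  by rewrite ZX fpsXnM ifT ?mulr0//; lia.
by apply: eq_bigr => k _; rewrite /G leq_addl addnK.
Qed.

(** The vector r f, r_x being the square root of x psi(x), is (1 + L)^-1 r.
    Expanding in powers of Z turns the sum over z into a partial fraction
    expansion, which gives back the coefficients of f_x of positive order with
    the opposite sign. *)
Lemma ffps_equation x : (0 < x)%N -> ffps x +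
  fps_tsum (fun z => fpsC (weight z / (x + z)%:R) * (fpsX ^+ z * ffps z)) = 1.
Proof.
move=> x0; apply: fps_ext => n; rewrite fpsD.
have -> : fps_tsum (fun z => fpsC (weight z / (x + z)%:R) * (fpsX ^+ z * ffps z)) n =
   \sum_(m < n.+1) (\sum_(z < n.+1) (- 1) ^+ m * alpha m / m`!%:R ^+ 2 *
    ('C(m, z)%:R * ((- 1) ^+ z * (z%:R / (x + z)%:R)))) * ((fpsZ R) ^+ m) n.
  under [RHS]eq_bigr do rewrite mulr_suml.
  rewrite [RHS]exchange_big /=; apply: eq_bigr => z _.
  rewrite fpsCM ffps_shift_coef mulr_sumr; apply: eq_bigr => m _.
  rewrite [LHS]mulrA; congr (_ * _).
  have [zm|zm] := leqP z m; first exact: (weight_coef x0 zm).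
  by rewrite mulr0 bin_small// mul0r mulr0.
rewrite ffps_tsum /fps_tsum -big_split /= big_ord_recl /= big1; last first.
  by move=> i _; case: i => -[|i] h /=; rewrite ?mul0r !mulr0.
rewrite mul0r addr0 [X in _ + X]big1 => [|i _].
  rewrite addr0 fpsCM expr0 mul1r /hyp2F1_coef !poch0 fact0 !mulr1 divr1 mul1r.
  by rewrite expr0.
rewrite fpsCM -mulrDl; set m := bump 0 i; have m0 : (0 < m)%N by [].
have mn : (m < n.+1)%N by rewrite /m /bump add1n ltnS.
rewrite -mulr_sumr.
have -> : \sum_(z < n.+1) 'C(m, z)%:R * ((- 1) ^+ z * (z%:R / (x + z)%:R)) =
    \sum_(z < m.+1) 'C(m, z)%:R * ((- 1) ^+ z * (z%:R / (x + z)%:R)) :> C.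
  pose F z : C := 'C(m, z)%:R * ((- 1) ^+ z * (z%:R / (x + z)%:R)).
  rewrite -(big_mkord xpredT F) -[in RHS](big_mkord xpredT F).
  rewrite (@big_cat_nat _ _ _ m.+1 0 n.+1)//= [X in _ + X]big1_seq ?addr0//.
  move=> z /andP[_]; rewrite mem_index_iota => /andP[mz _].
  by rewrite /F bin_small// mul0r.
rewrite altsum_frac// /hyp2F1_coef -/(alpha m).
move: (fact_neq0 R m) (poch_nat_neq0 R x m) ((fpsZ R ^+ m) n).
move: (m`!%:R) (pochhammer x.+1%:R m) (alpha m) ((- 1) ^+ m) => f P al s f0 P0 t.
have -> : s * (al / (P * f)) + s * al / f ^+ 2 * - (f / P) = 0.
  by field; rewrite f0 P0.
by rewrite mul0r.
Qed.

(** The kernel K(x, y) divided by r_x r_y, where r_x is the square root of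
    x psi(x). Since L(x, y) = 2 r_x r_y / (x + y) and r_x is a multiple of
    xi^(x/2), the derivative of L under xi d/dxi is r_x r_y, of rank one. Hence
    that of K = L (1 + L)^-1 is g_x g_y with g = (1 + L)^-1 r = r f, and after
    division by r_x r_y this reads (theta + (x + y)/2) k = f_x f_y. *)
Definition kfps x y : fps := fun n =>
  (ffps x * ffps y) n / (n%:R + (x + y)%:R / 2).

Lemma half_shift_neq0 n s : (0 < s)%N -> n%:R + s%:R / 2 != 0 :> C.
Proof.
move=> s0; have -> : n%:R + s%:R / 2 = (2 * n + s)%:R / 2 :> C.
  by rewrite natrD natrM; field.
by rewrite mulf_neq0 ?invr_eq0 ?natC_gt0// addn_gt0 s0 orbT.
Qed.

Lemma theta_kfps x y : (0 < x + y)%N ->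
  theta (kfps x y) + fpsC ((x + y)%:R / 2) * kfps x y = ffps x * ffps y.
Proof.
move=> xy; apply: fps_ext => n; rewrite fpsD fpsCM /theta -mulrDl /kfps.
by rewrite mulrC divfK// half_shift_neq0.
Qed.

Definition kfps_term x y j : fps :=
  ladder_term (pfps R) (fpsC 2^-1) (fun j => hfps nu j x) (fun j => hfps nu j y)
    (fun j => fpsC (alpha j)) j.

Lemma kfps_termE x y j : kfps_term x y j =
  (if j == 0%N then fpsC 2^-1 else 1) *
  (fpsC (alpha j) * (pfps R ^+ j * (hfps nu j x * hfps nu j y))).
Proof. by []. Qed.

Lemma pfps_small (c : fps) j n : (n < j)%N -> (pfps R ^+ j * c) n = 0.
Proof. by move=> nj; rewrite pfpsXn -mulrA fpsXnM nj. Qed.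

Lemma kfps_term_triangular x y : triangular (kfps_term x y).
Proof.
move=> j n nj; rewrite kfps_termE; set u := (if _ then _ else _).
have -> : u * (fpsC (alpha j) * (pfps R ^+ j * (hfps nu j x * hfps nu j y))) =
  pfps R ^+ j * (u * (fpsC (alpha j) * (hfps nu j x * hfps nu j y))) by ring.
exact: pfps_small.
Qed.

#[local] Opaque pfps.

(** Both sides have the same image under theta + (x + y)/2, which is injective;
    the rest of the telescoping sum is O(X^(n+1)). *)
Lemma kfps_sum x y : (0 < x + y)%N ->
  kfps x y = fpsC (4 / (x + y)%:R) * fps_tsum (kfps_term x y).
Proof.
move=> xy; apply: fps_ext => n; rewrite fpsCM.
have -> : fps_tsum (kfps_term x y) n = (\sum_(j < n.+1) kfps_term x y j) n by rewrite fps_sum.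
have q2E : fpsC 2^-1 + fpsC 2^-1 = 1 :> fps by rewrite -rmorphD (half_sum C) rmorph1.
have al0 : fpsC (alpha 0) = 1 :> fps by rewrite /alpha !poch0 mulr1 rmorph1.
have alS j : fpsC (alpha j.+1) = fpsC (alpha j) * fpsC ((a0 + j%:R) * (b0 + j%:R)) :> fps.
  by rewrite -rmorphM alphaS.
have D_al j : theta (fpsC (alpha j) : fps) = 0 by apply: thetaC.
have := ladder_sum (@thetaM C) (@raddfD _ _ (@theta C)) q2E (thetaC _) D_al alS al0
  (hfps_down nu ^~ x) (hfps_down nu ^~ y) (hfps_up nu ^~ x) (hfps_up nu ^~ y) n.
move=> /(congr1 (fun f : fps => f n)).
rewrite -[X in theta X]/(\sum_(j < n.+1) kfps_term x y j).
rewrite -[X in _ * X]/(\sum_(j < n.+1) kfps_term x y j).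
set S := \sum_(j < n.+1) _ => H.
have r0 : ladder_rest (pfps R) (fpsC 2^-1) (fun j => hfps nu j x) (fun j => hfps nu j y)
    (fun j => fpsC (alpha j)) n n = 0.
  rewrite /ladder_rest; set h := _ + _.
  have -> : fpsC 2^-1 * (fpsC (alpha n.+1) * (pfps R ^+ n.+1 * h)) =
     pfps R ^+ n.+1 * (fpsC 2^-1 * (fpsC (alpha n.+1) * h)) by ring.
  exact: pfps_small.
have hxy : fpsC x%:R + fpsC y%:R = fpsC (x + y)%:R :> fps by rewrite natrD rmorphD.
move: H; rewrite hxy fpsD fpsB r0 subr0 -!rmorphM !fpsCM /theta -mulrDl.
rewrite /kfps -/(ffps x) -/(ffps y) => H.
have h1 := half_shift_neq0 n xy; have h2 := natC_gt0 R xy.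
apply: (mulIf h1); rewrite divfK//.
have -> : (ffps x * ffps y) n =
    4 / (x + y)%:R * (2^-1 * 2^-1 * (x + y)%:R * (ffps x * ffps y) n).
  by move: h2; move: ((x + y)%:R) ((ffps x * ffps y) n) => t u h2; field.
by rewrite -H; ring.
Qed.

(** K + L K = L at the level of power series in xi. Its defect E satisfies
    (theta + (x + y)/2) E_xy = H_y and H_y = sum_x (weight x)/2 X^x f_x E_xy,
    which makes every coefficient of E vanish by induction. *)
Lemma kfps_equation x y : (0 < x)%N -> (0 < y)%N -> kfps x y +
  fps_tsum (fun z => fpsC (weight z / (x + z)%:R) * (fpsX ^+ z * kfps z y)) =
  fpsC (2 / (x + y)%:R).
Proof.
move=> + y0; move: x.
pose LK x := fps_tsum (fun z => fpsC (weight z / (x + z)%:R) * (fpsX ^+ z * kfps z y)).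
pose E x : fps := kfps x y + LK x - fpsC (2 / (x + y)%:R).
pose M := fps_tsum (fun z => fpsC (weight z / 2) * (fpsX ^+ z * kfps z y)).
pose H : fps := ffps y + M - 1.
have EH x : (0 < x)%N -> theta (E x) + fpsC ((x + y)%:R / 2) * E x = H.
  move=> x0; have xy : (0 < x + y)%N by rewrite addn_gt0 x0.
  have term z : theta (fpsC (weight z / (x + z)%:R) * (fpsX ^+ z * kfps z y)) +
      fpsC ((x + y)%:R / 2) * (fpsC (weight z / (x + z)%:R) * (fpsX ^+ z * kfps z y)) =
      ffps y * (fpsC (weight z / (x + z)%:R) * (fpsX ^+ z * ffps z)) +
      fpsC (weight z / 2) * (fpsX ^+ z * kfps z y).
    have zy : (0 < z + y)%N by rewrite addn_gt0 y0 orbT.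
    have xz : (x + z)%:R != 0 :> C by rewrite natC_gt0// addn_gt0 x0.
    have tk : theta (kfps z y) = ffps z * ffps y - fpsC ((z + y)%:R / 2) * kfps z y.
      by rewrite -(theta_kfps zy) addrK.
    rewrite thetaM thetaC mul0r add0r thetaM thetaXn tk.
    have -> : fpsC (weight z / 2) = fpsC (weight z / (x + z)%:R) * fpsC ((x + z)%:R / 2) :> fps.
      by rewrite -rmorphM; congr fpsC; move: xz; move: ((x + z)%:R) => t h; field.
    have -> : fpsC ((x + z)%:R / 2) = fpsC z%:R + fpsC ((x + y)%:R / 2) - fpsC ((z + y)%:R / 2) :> fps.
      by rewrite -rmorphD -rmorphB; congr fpsC; rewrite !natrD; field.
    by ring.
  rewrite /E thetaB thetaC subr0 thetaD.
  have tLK : theta (LK x) + fpsC ((x + y)%:R / 2) * LK x = ffps y * (1 - ffps x) + M.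
    rewrite -(ffps_equation x0) [ffps x + _]addrC addrK /LK /M theta_tsum.
    rewrite !fps_tsumM -?fps_tsumD; [|exact: triangularCX..].
    by congr fps_tsum; apply/funext => z; apply: term.
  have c1 : fpsC ((x + y)%:R / 2) * fpsC (2 / (x + y)%:R) = 1 :> fps.
    rewrite -rmorphM -[RHS](rmorph1 (@fpsC C)); congr fpsC.
    by have := natC_gt0 R xy; move: ((x + y)%:R) => t h; field.
  rewrite mulrBr c1 mulrDr addrA addrACA (theta_kfps xy) tLK /H; ring.
have HE : H = fps_tsum (fun x => fpsC (weight x / 2) * (fpsX ^+ x * (ffps x * E x))).
  pose P x : fps := fpsC (weight x / 2) * (fpsX ^+ x * kfps x y).
  pose Q x z : fps := fpsC (weight z / (x + z)%:R) * (fpsX ^+ z * ffps z).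
  have step x : fpsC (weight x / 2) * (fpsX ^+ x * (ffps x * E x)) =
      ffps x * P x + fps_tsum (fun z => P z * Q z x) - Q y x.
    have tri : triangular (fun z => fpsC (weight z / (x + z)%:R) * (fpsX ^+ z * kfps z y)).
      exact: triangularCX.
    have -> : fps_tsum (fun z => P z * Q z x) =
        fpsC (weight x / 2) * (fpsX ^+ x * ffps x) * LK x.
      rewrite /LK fps_tsumM//; congr fps_tsum; apply/funext => z; rewrite /P /Q.
      have -> : fpsC (weight z / 2) * (fpsX ^+ z * kfps z y) *
          (fpsC (weight x / (z + x)%:R) * (fpsX ^+ x * ffps x)) =
        fpsC (weight z / 2) * fpsC (weight x / (z + x)%:R) *
          ((fpsX ^+ z * kfps z y) * (fpsX ^+ x * ffps x)) by ring.
      rewrite [(z + x)%N]addnC -rmorphM.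
      have -> : weight z / 2 * (weight x / (x + z)%:R) =
         weight x / 2 * (weight z / (x + z)%:R) by ring.
      by rewrite rmorphM; ring.
    have -> : Q y x = fpsC (weight x / 2) * fpsC (2 / (x + y)%:R) * (fpsX ^+ x * ffps x).
      by rewrite /Q -rmorphM [(y + x)%N]addnC [weight x / 2 * _]mulrA divfK ?natC_neq0.
    by rewrite /P /E; ring.
  have -> : (fun x => fpsC (weight x / 2) * (fpsX ^+ x * (ffps x * E x))) =
      (fun x => ffps x * P x + fps_tsum (fun z => P z * Q z x) - Q y x).
    by apply/funext.
  rewrite fps_tsumB fps_tsumD fps_tsum_exchange.
  have -> : fps_tsum (Q y) = 1 - ffps y by rewrite -(ffps_equation y0) [ffps y + _]addrC addrK.
  have -> : (fun z => fps_tsum (fun x => P z * Q z x)) = (fun z => P z * (1 - ffps z)).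
    apply/funext => z; rewrite -fps_tsumM; last exact: triangularCX.
    have [->|z0] := posnP z; first by rewrite /P weight0 mul0r rmorph0 !mul0r.
    by rewrite -[in RHS](ffps_equation z0) [ffps z + _]addrC addrK.
  rewrite -fps_tsumD (_ : (fun z => _) = P); last first.
    by apply/funext => z; ring.
  have -> : fps_tsum P = M by [].
  by rewrite /H; ring.
(* weight 0 = 0, hence X^x raises the order: the coefficient n of H involves
   only coefficients of E of lower order. *)
suff E0 n : forall x, (0 < x)%N -> E x n = 0.
  by move=> x x0; apply: fps_ext => n; have := E0 n x x0; rewrite /E fpsB => /eqP;
    rewrite subr_eq0 => /eqP.
elim/ltn_ind: n => n IH x x0.
have xy : (0 < x + y)%N by rewrite addn_gt0 x0.
apply: (mulfI (half_shift_neq0 n xy)); rewrite mulr0.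
have := congr1 (fun f : fps => f n) (EH x x0); rewrite fpsD fpsCM /theta -mulrDl => ->.
rewrite HE /fps_tsum big1// => -[z zn] _ /=; rewrite fpsCM fpsXnM.
case: z zn => [|z] zn; first by rewrite weight0 !mul0r.
have zn' : (z < n)%N by rewrite -ltnS.
case: ifP => _; first by rewrite mulr0.
rewrite fpsM big1 ?mulr0// => -[i /= ni] _.
by rewrite IH ?mulr0//; lia.
Qed.

End KernelEquation.

(** * Growth of the coefficients *)

Section Bounds.
Variable R : realType.
Local Notation C := R[i].
Local Notation fps := (fps R[i]).
Variable nu : C.
Hypothesis hnu : 0 <= nu < 2^-1 \/ complex.Re nu = 0.
Let a0 : C := 2^-1 - nu.
Let b0 : C := 2^-1 + nu.

Lemma half_half : (2^-1 : C) = (2^-1 : R)%:C.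
Proof. by rewrite rmorphV ?unitfE ?pnatr_eq0// rmorph_nat. Qed.

Lemma natCR n : (n%:R : C) = (n%:R : R)%:C.
Proof. by rewrite rmorph_nat. Qed.

(** For real nu the left sides are at most m + 1/2 + nu; for nu = iy the square
    of the modulus is (m + 1/2)^2 + y^2, less than (m + 1)^2 once m > y^2. *)
Lemma shifted_mag : exists N, forall m, (N <= m)%N ->
  mag (a0 + m%:R) <= m.+1%:R /\ mag (b0 + m%:R) <= m.+1%:R.
Proof.
case: hnu => [/andP[n0 n1]|n0].
  have [r nr] : exists r : R, nu = r%:C by apply/complex_realP; rewrite realE n0.
  exists 0%N => m _; move: n0 n1; rewrite /a0 /b0 nr half_half lecR ltcR => r0 r1.
  rewrite natCR -rmorphB -!rmorphD !mag_real -[m.+1%:R]natr1.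
  by have m0 : 0 <= m%:R :> R by []; split; rewrite ger0_norm; lra.
exists (Num.truncn (complex.Im nu ^+ 2)).+1 => m hm.
have h : complex.Im nu ^+ 2 < m%:R.
  by rewrite (lt_le_trans (truncnS_gt _))// ler_nat.
have m0 : 0 <= m%:R :> R by [].
have key (z : C) : complex.Re z = 2^-1 + m%:R -> complex.Im z ^+ 2 = complex.Im nu ^+ 2 ->
    mag z <= m.+1%:R.
  move=> rz iz; rewrite -(ler_pXn2r (n := 2))// ?nnegrE ?mag_ge0// mag_sqr rz iz.
  by rewrite -[m.+1%:R]natr1; lra.
have [y ey] : exists y, nu = 0 +i* y.
  by exists (complex.Im nu); case: nu n0 => ? ? /= ->.
rewrite /a0 /b0; split; apply: key; rewrite ey half_half natCR /=.
- by rewrite subr0.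
- by rewrite sub0r addr0 sqrrN.
- by rewrite addr0.
- by rewrite add0r addr0.
Qed.

(** The factors exceed those of the factorials for finitely many indices only,
    and there by a bounded ratio. *)
Lemma poch_growth : exists2 M : R, 0 <= M & forall p n,
  mag (pochhammer (a0 + p%:R) n) <= M * ((p + n)`!%:R / p`!%:R) /\
  mag (pochhammer (b0 + p%:R) n) <= M * ((p + n)`!%:R / p`!%:R).
Proof.
have [N hN] := shifted_mag.
pose K : R := 1 + mag nu; have K1 : 1 <= K by rewrite lerDl mag_ge0.
pose c m : R := if (m < N)%N then K else 1.
have c1 m : 1 <= c m by rewrite /c; case: ifP.
have half : mag (2^-1 : C) = 2^-1 :> R by rewrite half_half mag_real ger0_norm.
have step m : mag (a0 + m%:R) <= m.+1%:R * c m /\ mag (b0 + m%:R) <= m.+1%:R * c m.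
  rewrite /c; case: ltnP => [_|/hN]; last by rewrite mulr1.
  have m0 : 0 <= m%:R :> R by []; have n0 := mag_ge0 nu; have mn := mulr_ge0 m0 n0.
  rewrite /K -[m.+1%:R]natr1; split; rewrite (le_trans (magD _ _))// mag_nat.
    by have := magB 2^-1 nu; rewrite half -/a0; lra.
  by have := magD 2^-1 nu; rewrite half -/b0; lra.
have cprod L : \prod_(0 <= m < L) c m <= K ^+ N.
  suff h : \prod_(0 <= m < L) c m <= K ^+ minn L N.
    by rewrite (le_trans h)// ler_weXn2l// geq_minr.
  elim: L => [|L IH]; first by rewrite big_geq// min0n.
  rewrite big_nat_recr//=; apply: le_trans (ler_wpM2r _ IH) _.
    by rewrite (le_trans ler01).
  rewrite /c; case: ltnP => LN.
    by rewrite (minn_idPl LN) exprSr.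
  by rewrite mulr1 (minn_idPr _)// leqW.
have cp0 p n : \prod_(0 <= k < n) c (p + k)%N <= K ^+ N.
  apply: le_trans (cprod (p + n)%N).
  have -> : \prod_(0 <= m < p + n) c m =
      \prod_(0 <= m < p) c m * \prod_(0 <= k < n) c (p + k)%N.
    rewrite (@big_cat_nat _ _ _ p)//= ?leq_addr//; congr (_ * _).
    by rewrite -{1}[p]add0n big_addn addKn; apply: eq_bigr => k _; rewrite addnC.
  rewrite ler_peMl//; last by elim/big_rec: _ => // i x _ x1; rewrite mulr_ege1.
  by rewrite prodr_ge0// => i _; rewrite (le_trans ler01).
have fprod p n : \prod_(0 <= k < n) (p + k).+1%:R = (p + n)`!%:R / p`!%:R :> R.
  elim: n => [|n IH]; first by rewrite big_geq// addn0 divff// pnatr_eq0 -lt0n fact_gt0.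
  by rewrite big_nat_recr//= IH addnS factS natrM; ring.
exists (K ^+ N) => [|p n]; first by rewrite exprn_ge0// (le_trans ler01).
have gen (a : C) : (forall m, mag (a + m%:R) <= m.+1%:R * c m) ->
    mag (pochhammer (a + p%:R) n) <= K ^+ N * ((p + n)`!%:R / p`!%:R).
  move=> ha; rewrite mag_poch -fprod mulrC.
  apply: le_trans (ler_wpM2l _ (cp0 p n)); last by rewrite prodr_ge0.
  rewrite -big_split /=; apply: ler_prod => k _.
  by rewrite mag_ge0 -addrA -natrD ha.
by split; apply: gen => m; have [] := step m.
Qed.

End Bounds.

Section GrowthConsequences.
Variable R : realType.
Local Notation C := R[i].
Local Notation fps := (fps R[i]).

Lemma vandermonde_fact p q n : \sum_(k < n.+1) 'C(n, k)%:R *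
   (((p + k)`!%:R / p`!%:R) * ((q + (n - k))`!%:R / q`!%:R)) =
   ((p + q).+1 + n)`!%:R / (p + q).+1`!%:R :> R.
Proof.
apply: (@complexI R); rewrite rmorph_sum.
have := vandermonde_poch (p.+1%:R : C) q.+1%:R n.
rewrite -natrD addSn addnS poch_fact => h.
have e (u v : nat) : ((u`!%:R / v`!%:R : R)%:C) = u`!%:R / v`!%:R :> C.
  by rewrite rmorphM fmorphV !rmorph_nat.
rewrite e -h; apply: eq_bigr => k _.
by rewrite rmorphM rmorph_nat rmorphM /= !e !poch_fact.
Qed.

Lemma fact_cross j x n : ((j + n)`! * (x + n)`! <= (x + j + n)`! * n`!)%N.
Proof.
elim: x => [|x IH]; first by rewrite !add0n.
rewrite !addSn !factS; have : ((x + n).+1 <= (x + j + n).+1)%N by lia.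
by move=> h; have := leq_mul h IH; lia.
Qed.

Lemma fact_gt0R n : 0 < n`!%:R :> R.
Proof. by rewrite ltr0n fact_gt0. Qed.

Variable nu : C.
Let a0 : C := 2^-1 - nu.
Let b0 : C := 2^-1 + nu.
Variable M : R.
Hypothesis M0 : 0 <= M.
Hypothesis growth : forall p n,
  mag (pochhammer (a0 + p%:R) n) <= M * ((p + n)`!%:R / p`!%:R) /\
  mag (pochhammer (b0 + p%:R) n) <= M * ((p + n)`!%:R / p`!%:R).

(** Each moment is at most a ratio of factorials, and the sum over k of these is
    evaluated by the Vandermonde identity. *)
Lemma moment_growth j x l : \sum_(k < l.+1) 'C(l, k)%:R *
   mag (beta_moment (b0 + j%:R) (x + j).+1%:R k (l - k)) <= M ^+ 2 * l.+1%:R.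
Proof.
have f0 := fact_gt0R.
have cb : (x + j).+1%:R - (b0 + j%:R) = a0 + x%:R :> C.
  have -> : (x + j).+1%:R = x%:R + j%:R + (2^-1 + 2^-1) :> C.
    by rewrite half_sum -natrD natr1.
  by rewrite /a0 /b0; ring.
have pc k : mag (pochhammer (x + j).+1%:R k : C) = (x + j + k)`!%:R / (x + j)`!%:R.
  by rewrite poch_fact magM magV !mag_nat.
apply: (@le_trans _ _ (\sum_(k < l.+1) M ^+ 2 / ((x + j + l)`!%:R / (x + j)`!%:R) *
   ('C(l, k)%:R * (((j + k)`!%:R / j`!%:R) * ((x + (l - k))`!%:R / x`!%:R))))).
  apply: ler_sum => -[k /= kl] _; rewrite mulrCA ler_wpM2l//.
  rewrite /beta_moment cb magM magV magM pc subnKC//.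
  rewrite [leRHS]mulrAC ler_wpM2r ?invr_ge0 ?divr_ge0 ?(ltW (f0 _))//.
  have [_ h1] := growth j k; have [h2 _] := growth x (l - k).
  by apply: le_trans (ler_pM (mag_ge0 _) (mag_ge0 _) h1 h2) _; rewrite expr2 mulrACA.
rewrite -mulr_sumr vandermonde_fact [(j + x)%N]addnC -mulrA ler_wpM2l ?exprn_ge0//.
rewrite addSn !factS !natrM.
set F := (x + j + l)`!%:R; set G := (x + j)`!%:R.
have F0 : F != 0 by apply: lt0r_neq0 (f0 _).
have G0 : G != 0 by apply: lt0r_neq0 (f0 _).
have s0 : (x + j).+1%:R != 0 :> R by rewrite pnatr_eq0.
have -> : (F / G)^-1 * ((x + j + l).+1%:R * F / ((x + j).+1%:R * G)) =
    (x + j + l).+1%:R / (x + j).+1%:R.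
  by move: F G F0 G0 ((x + j).+1%:R) s0 => F G F0 G0 t s0; field; rewrite F0 G0 s0.
rewrite ler_pdivrMr// -natrM ler_nat; nia.
Qed.

Lemma rfps_bound j x n : mag (rfps nu j x n) <= M ^+ 2 / j`!%:R.
Proof.
have f0 := fact_gt0R.
rewrite /rfps magM magV !magM !mag_nat ler_pdivrMr ?mulr_gt0//.
have [h1 _] := growth j n; have [h2 _] := growth x n.
rewrite [x%:R + _]addrC.
apply: le_trans (ler_wpM2l _ (ler_pM (mag_ge0 _) (mag_ge0 _) h1 h2)) _; first exact: ltW.
have x0 := lt0r_neq0 (f0 x); have j0 := lt0r_neq0 (f0 j).
have -> : x`!%:R * (M * ((j + n)`!%:R / j`!%:R) * (M * ((x + n)`!%:R / x`!%:R))) =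
   M ^+ 2 / j`!%:R * ((j + n)`! * (x + n)`!)%:R :> R.
  by rewrite natrM; field; rewrite x0 j0.
rewrite ler_wpM2l ?divr_ge0 ?exprn_ge0 ?(ltW (f0 _))//.
by rewrite -natrM ler_nat fact_cross.
Qed.

Lemma alpha_bound j : mag (alpha nu j) <= M ^+ 2 * j`!%:R ^+ 2.
Proof.
have [h1 h2] := growth 0 j; move: h1 h2; rewrite add0n addr0 divr1 addr0 => h1 h2.
rewrite /alpha magM; apply: le_trans (ler_pM (mag_ge0 _) (mag_ge0 _) h1 h2) _.
by rewrite -exprMn expr2.
Qed.

Lemma weight_bound z : mag (weight nu z) <= M ^+ 2 * z%:R.
Proof.
have f0 := fact_gt0R z.
rewrite /weight magM magV magX !mag_nat magM mag_nat ler_pdivrMr ?exprn_gt0//.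
by rewrite mulrAC [leRHS]mulrC ler_wpM2l// alpha_bound.
Qed.

Variable xi : R.
Hypothesis xi01 : 0 < xi < 1.

Let xi0 : 0 <= xi. Proof. by case/andP: xi01 => /ltW. Qed.

Lemma bnd_const (a : fps) (B : R) : 0 <= B -> (forall n, mag (a n) <= B) ->
  bnd a xi (B * (1 - xi)^-1).
Proof.
move=> B0 h.
have b1 : mag (1 : C) * xi < 1 by rewrite mag1 mul1r; case/andP: xi01.
have hg := bndZ B%:C (bnd_geom xi0 b1).
rewrite mag_real ger0_norm// mag1 mul1r in hg.
apply: bnd_le hg => n; rewrite fpsCM /fps_geom expr1n mulr1 mag_real.
by rewrite ger0_norm.
Qed.

Lemma bnd_rfps j x : bnd (rfps nu j x) xi (M ^+ 2 / j`!%:R * (1 - xi)^-1).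
Proof.
apply: bnd_const (rfps_bound j x).
by rewrite divr_ge0 ?exprn_ge0// ltW ?fact_gt0R.
Qed.

End GrowthConsequences.

(** * The kernel at a given xi *)

Section Numerics.
Variable R : realType.
Local Notation C := R[i].
Local Notation fps := (fps R[i]).
Variables (nu : C) (xi : R).
Hypothesis hnu : 0 <= nu < 2^-1 \/ complex.Re nu = 0.
Hypothesis xi01 : 0 < xi < 1.
Let a0 : C := 2^-1 - nu.
Let b0 : C := 2^-1 + nu.

Lemma rfpsE j x n : rfps nu j x n = x`!%:R * (pochhammer (a0 + j%:R) n *
  pochhammer (x%:R + a0) n) / ((x + j + n)`!%:R * n`!%:R).
Proof. by []. Qed.

Lemma fps_geom1 (w : C) n : fps_geom w n = w ^+ n. Proof. by []. Qed.

#[local] Opaque fps_mul fps_add fps_geom fpsX fpsC fpsZ fpsU pfps rfps hfps.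

Let xi_gt0 : 0 < xi. Proof. by case/andP: xi01. Qed.
Let xi_ge0 : 0 <= xi. Proof. exact: ltW. Qed.
Let xi_lt1 : xi < 1. Proof. by case/andP: xi01. Qed.
Let mag_xi : mag xi%:C <= xi. Proof. by rewrite mag_real ger0_norm. Qed.

Lemma bnd_afps : exists B, bnd (afps nu) xi B.
Proof. by apply: bnd_bin => //; rewrite mag1 mul1r. Qed.

Lemma hfpsE0 j x : hfps nu j x = (1 - fpsX) ^+ j * (afps nu * rfps nu j x).
Proof. by []. Qed.

Lemma ffps_bound : exists B, forall x, bnd (ffps nu x) xi B.
Proof.
have [B hB] := bnd_afps; have [M M0 hM] := poch_growth hnu.
exists (B * (M ^+ 2 / 0`!%:R * (1 - xi)^-1)) => x; rewrite /ffps hfpsE0 expr0 mul1r.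
exact: (bndM hB (bnd_rfps M0 hM xi01 0 x)).
Qed.

Lemma kfps_bound : exists B, forall x y, (0 < x + y)%N -> bnd (kfps nu x y) xi B.
Proof.
have [B hB] := ffps_bound; exists (mag (2 : C) * (B * B)) => x y xy.
apply: bnd_le (bndZ 2 (bndM (hB x) (hB y))) => n.
rewrite fpsCM /kfps !magM mulrC ler_wpM2r ?mag_ge0// magV mag_nat.
have -> : n%:R + (x + y)%:R / 2 = (n%:R + (x + y)%:R / 2 : R)%:C :> C.
  by rewrite half_half (natCR R n) (natCR R (x + y)) -rmorphM -rmorphD.
have xy1 : 1 <= (x + y)%:R :> R by rewrite ler1n.
have n0 : 0 <= n%:R :> R by [].
rewrite mag_real ger0_norm; last by lra.
by rewrite -[leRHS]invrK lef_pV2 ?posrE//; lra.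
Qed.

(** The power (1 - X)^(2j) of the two factors h_j cancels the one in p^j: only
    X^j remains, whose decay makes the series converge for every xi < 1. *)
Lemma kfps_term_normal x y j : kfps_term nu x y j =
  fpsC ((if j == 0%N then 2^-1 else 1) * alpha nu j) *
  (fpsX ^+ j * (afps nu * rfps nu j x * (afps nu * rfps nu j y))).
Proof.
rewrite kfps_termE [_ * (hfps _ _ _ * _)]mulrA pfps_h hfpsE0.
have -> : fpsX ^+ j = fpsZ R ^+ j * (1 - fpsX) ^+ j :> fps.
  rewrite -exprMn; congr (_ ^+ _); rewrite fpsZE.
  have -> : fpsX * fpsU R * (1 - fpsX) = fpsX * ((1 - fpsX) * fpsU R) :> fps by ring.
  by rewrite fpsUE mulr1.
rewrite [fpsC (_ * alpha _ _)]rmorphM; have -> : (if j == 0%N then fpsC 2^-1 else 1) =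
    fpsC (if j == 0%N then 2^-1 else 1) :> fps.
  by case: eqP => // _; rewrite rmorph1.
by ring.
Qed.

(** alpha_j grows like j!^2, which the factors 1/j! of the two series r_j
    compensate. *)
Lemma kfps_term_bound : exists2 B, 0 <= B &
  forall x y j, bnd (kfps_term nu x y j) xi (B * xi ^+ j).
Proof.
have [B hB] := bnd_afps; have [M M0 hM] := poch_growth hnu.
have B0 := bnd_ge0 hB.
pose D := (1 - xi)^-1; have D0 : 0 <= D by rewrite invr_ge0 subr_ge0 ltW.
exists (M ^+ 2 * (B * (M ^+ 2 * D) * (B * (M ^+ 2 * D)))) => [|x y j].
  by rewrite !mulr_ge0 ?exprn_ge0.
rewrite kfps_term_normal.
have hr x' := bndM hB (bnd_rfps M0 hM xi01 j x').
apply: bndW (bndZ _ (bndXnM j xi_ge0 (bndM (hr x) (hr y)))).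
have f0 := fact_gt0R R j.
rewrite -/D magM; set d := mag (if _ then _ else _).
have d1 : d <= 1.
  rewrite /d; case: eqP => _; last by rewrite mag1.
  by rewrite half_half mag_real ger0_norm//; lra.
have := ler_pM (mag_ge0 _) (mag_ge0 _) d1 (alpha_bound hM j); rewrite -/d mul1r => h.
have BX : 0 <= B * (M ^+ 2 / j`!%:R * D).
  by rewrite mulr_ge0// mulr_ge0// divr_ge0 ?exprn_ge0// ltW.
apply: le_trans (ler_wpM2r _ h) _.
  exact: mulr_ge0 (exprn_ge0 j xi_ge0) (mulr_ge0 BX BX).
rewrite le_eqVlt; apply/orP; left; apply/eqP.
by field; rewrite lt0r_neq0.
Qed.

Definition kappa x y : C := ev (kfps nu x y) xi%:C.

Lemma kappa_bound : exists B, forall x y, (0 < x + y)%N -> mag (kappa x y) <= B.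
Proof.
by have [B hB] := kfps_bound; exists B => x y /hB /ev_le h; apply: h.
Qed.

(** Twice x psi(x). *)
Definition wt z : C := weight nu z * xi%:C ^+ z.

Lemma wt_summable : exists B, abs_bound wt B.
Proof.
have [M M0 hM] := poch_growth hnu.
have x1 : 1 * xi < 1 by rewrite mul1r.
have := abs_boundZ (M ^+ 2)%:C (bnd_binomial 1 xi_ge0 ler01 x1).
set B := _ * _ => h; exists B; apply: abs_bound_le h => z.
rewrite /wt magM [leRHS]magM [mag (_%:C * _)]magM.
rewrite mulrA ler_wpM2r ?mag_ge0// mag_real ger0_norm ?exprn_ge0// mag_real.
rewrite expr1n mulr1 bin1 ger0_norm// addn1.
by apply: le_trans (weight_bound hM z) _; rewrite ler_wpM2l ?exprn_ge0// ler_nat.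
Qed.

Lemma natC_inv_le x z : (0 < x)%N -> mag ((x + z)%:R^-1 : C) <= 1.
Proof.
by move=> x0; rewrite magV mag_nat invf_le1 ?ltr0n ?ler1n addn_gt0 x0.
Qed.

(** The equation K + L K = L at the given xi; the bounds are uniform in z, so
    that the sum over z may be evaluated term by term. *)
Lemma kappa_equation x y : (0 < x)%N -> (0 < y)%N ->
  has_sum (fun z => wt z / (x + z)%:R * kappa z y) (2 / (x + y)%:R - kappa x y).
Proof.
move=> x0 y0; have [Bk hBk] := kfps_bound; have [Bw hBw] := wt_summable.
pose G z := fpsC (weight nu z / (x + z)%:R) * (fpsX ^+ z * kfps nu z y).
have zy z : (0 < z + y)%N by rewrite addn_gt0 y0 orbT.
have Bk0 := bnd_ge0 (hBk x y (zy x)).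
have GB z : bnd (G z) xi (mag (wt z) * Bk).
  apply: bndW (bndZ _ (bndXnM z xi_ge0 (hBk z y (zy z)))).
  rewrite mulrA ler_wpM2r// /wt [mag (_ * _ ^+ _)]magM [mag (_ / _)]magM.
  rewrite magX mag_real ger0_norm// mulrAC; move: (mag (weight nu z)) (mag_ge0 (weight nu z)) => m m0.
  by rewrite ler_piMr ?natC_inv_le// mulr_ge0// exprn_ge0.
have BN N : \sum_(z < N) mag (wt z) * Bk <= Bw * Bk.
  rewrite -mulr_suml ler_wpM2r//; apply: le_trans (hBw [fset i | i in iota 0 N]%fset).
  by rewrite -sum_fset_iota -[in iota _ _](subn0 N) -/(index_iota _ _) big_mkord.
have := ev_csum xi_gt0 GB BN mag_xi.
have -> : fps_csum G = fpsC (2 / (x + y)%:R) - kfps nu x y.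
  rewrite -(kfps_equation nu x0 y0) [kfps _ _ _ + _]addrC addrK.
  by apply: fps_ext => n; rewrite fps_csumE//; apply: triangularCX.
have -> : ev (fpsC (2 / (x + y)%:R) - kfps nu x y) xi%:C = 2 / (x + y)%:R - kappa x y.
  have xy : (0 < x + y)%N by rewrite addn_gt0 x0.
  have -> : fpsC (2 / (x + y)%:R) - kfps nu x y =
      fpsC (2 / (x + y)%:R) + fpsC (- 1) * kfps nu x y by rewrite rmorphN rmorph1 mulN1r.
  rewrite (evD (bndC _ xi_ge0) (bndZ _ (hBk x y xy)) mag_xi) evC.
  by rewrite (evZ _ (hBk x y xy) mag_xi) mulN1r.
congr has_sum; apply/funext => z; rewrite /G.
rewrite (evZ _ (bndXnM z xi_ge0 (hBk z y (zy z))) mag_xi).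
by rewrite (evXnM z xi_ge0 (hBk z y (zy z)) mag_xi) /wt /kappa; ring.
Qed.

(** Up to a factor independent of j, the terms are those of the theorem. *)
Lemma kappa_sum x y : (0 < x + y)%N ->
  has_sum (fun j => ev (kfps_term nu x y j) xi%:C) ((x + y)%:R / 4 * kappa x y).
Proof.
move=> xy; have [B B0 hB] := kfps_term_bound; have [Bk hBk] := kfps_bound.
have BN N : \sum_(j < N) B * xi ^+ j <= B * (1 - xi)^-1.
  rewrite -mulr_sumr ler_wpM2l//.
  have b1 : mag (1 : C) * xi < 1 by rewrite mag1 mul1r.
  have := bnd_geom xi_ge0 b1; rewrite mag1 mul1r => h.
  apply: le_trans (h [fset i | i in iota 0 N]%fset).
  rewrite -sum_fset_iota -[in iota _ _](subn0 N) -/(index_iota _ _) big_mkord.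
  apply: ler_sum => j _; rewrite magM magX mag_real ger0_norm//.
  by rewrite fps_geom1 expr1n mag1 mul1r.
have := ev_csum xi_gt0 (hB x y) BN mag_xi.
suff -> : ev (fps_csum (kfps_term nu x y)) xi%:C = (x + y)%:R / 4 * kappa x y by [].
have e : fps_csum (kfps_term nu x y) = fps_tsum (kfps_term nu x y).
  by apply: fps_ext => n; rewrite fps_csumE//; apply: kfps_term_triangular.
have tb := bnd_csum xi_gt0 (hB x y) BN; rewrite e in tb *.
rewrite /kappa kfps_sum// (evZ _ tb mag_xi) mulrA.
have t0 := natC_gt0 R xy; move: ((x + y)%:R) t0 => t t0.
have -> : t / 4 * (4 / t) = 1 by field.
by rewrite mul1r.
Qed.

Lemma bnd_hfps j x : exists B, bnd (hfps nu j x) xi B.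
Proof.
have [B hB] := bnd_afps; have [M M0 hM] := poch_growth hnu.
have h1 : bnd (1 - fpsX : fps) xi (mag (1 : C) + mag (- 1 : C) * xi).
  have -> : 1 - fpsX = fpsC 1 + fpsC (- 1) * fpsX :> fps by rewrite rmorphN rmorph1 mulN1r.
  by apply: bndD; [apply: bndC|apply: bndZ; apply: bnd_X].
eexists; rewrite hfpsE0.
exact: (bndM (bnd_exp j xi_ge0 h1) (bndM hB (bnd_rfps M0 hM xi01 j x))).
Qed.

Lemma ev_alt (g : fps) z : ev (fps_alt g) z = ev g (- z).
Proof.
rewrite /ev; congr csum; apply/funext => n; rewrite /fps_alt.
by rewrite -[- z]mulN1r exprMn; ring.
Qed.

Lemma one_subX_exp j : (1 - fpsX) ^+ j = bin_fps (- j%:R) 1 :> fps.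
Proof.
have h : (1 - fpsX) ^+ j * fpsU R ^+ j = 1 :> fps by rewrite -exprMn fpsUE expr1n.
have h2 : fpsU R ^+ j * bin_fps (- j%:R) 1 = 1 :> fps.
  by rewrite fpsU_geom -bin_fps_nat bin_fpsD subrr bin_fps_0.
have : (1 - fpsX) ^+ j * (fpsU R ^+ j * bin_fps (- j%:R) 1) = bin_fps (- j%:R) 1 :> fps.
  by rewrite mulrA h mul1r.
by rewrite h2 mulr1.
Qed.

(** For q = 1 the variable v = z/(1 - z) at z = xi/(xi - 1) is - xi, so the
    expansion of the continuation in v converges for all xi < 1. *)
Lemma phi_ev j x : (0 < x)%N ->
  phi nu xi j.+1 x = (x + j)`!%:R / x`!%:R * ev (hfps nu j x) xi%:C.
Proof.
move=> x0; pose z : C := (xi / (xi - 1))%:C.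
have d0 : 0 < 1 - xi by rewrite subr_gt0.
have d1 : xi - 1 != 0 by rewrite subr_eq0 lt_eqF.
have zE : z = - xi%:C / (1 - xi%:C).
  by rewrite /z rmorphM fmorphV rmorphB rmorph1 -opprB invrN mulrN mulNr.
have xC1 : 1 - xi%:C != 0 :> C.
  by rewrite -[1](rmorph1 (@real_complex R)) -rmorphB -mag_eq0 mag_real normr_eq0 gt_eqF.
have z1 : 1 - z = (1 - xi%:C)^-1 by rewrite zE; field.
have slit : z \in @slit_plane R.
  rewrite inE /slit_plane /= lecE /= => /andP[_].
  rewrite ler_ndivlMr; last by rewrite subr_lt0.
  by rewrite mul1r; apply/negP; rewrite -ltNge; lra.
have mr : mob_rate (1 : C) = 1.
  by rewrite /mob_rate subrr mag0 mag1 max_l.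
have dom : hyp_dom (1 : C) z.
  rewrite /hyp_dom mr !mulr1 z1 zE magM magN mag_real ger0_norm//.
  by rewrite gtr_pMl// mag_gt0 invr_eq0.
have [M M0 hM] := poch_growth hnu.
have jE : j.+1%:R = j%:R + (2^-1 + 2^-1) :> C by rewrite half_sum natr1.
have ea : - 2^-1 - nu + j.+1%:R = a0 + j%:R :> C.
  by rewrite jE /a0; ring.
have eb : - 2^-1 + nu + j.+1%:R = b0 + j%:R :> C.
  by rewrite jE /b0; ring.
rewrite /phi ea eb addnS -/z.
rewrite (hyp2F1E (a0 + j%:R) (poch_nat_neq0 R (x + j)) (moment_growth M0 hM j x) slit dom).
have -> : z / (1 - z * 1) = - xi%:C by rewrite mulr1 z1 invrK zE divfK.
rewrite -ev_alt pfaff_alt; last exact: poch_nat_neq0.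
have [B hB] := bnd_hfps j x.
rewrite -(evZ _ hB mag_xi); congr ev.
rewrite hfpsE0 one_subX_exp.
have -> : - (a0 + j%:R) = - j%:R - a0 by ring.
rewrite -bin_fpsD -/(afps nu) -mulrA [RHS]mulrCA; congr (_ * _).
rewrite [RHS]mulrCA; congr (_ * _).
apply: fps_ext => l; rewrite fpsCM rfpsE poch_fact.
have -> : (x + j).+1%:R - (b0 + j%:R) = x%:R + a0.
  have -> : (x + j).+1%:R = x%:R + j%:R + (2^-1 + 2^-1) :> C.
    by rewrite half_sum -natrD natr1.
  by rewrite /a0 /b0; ring.
move: (fact_neq0 R x) (fact_neq0 R (x + j)) (fact_neq0 R (x + j + l)) (fact_neq0 R l).
move: (pochhammer _ _) (pochhammer _ _) => P Q.
move: (x`!%:R) ((x + j)`!%:R) ((x + j + l)`!%:R) (l`!%:R) => u v w t u0 v0 w0 t0.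
by field; rewrite u0 v0 w0 t0.
Qed.

End Numerics.

(** * Estimates for the exponential *)

Section RealEstimates.
Variable R : realType.

Lemma le_of_derive (f df : R -> R) (a b : R) : a <= b ->
  (forall x : R, is_derive x 1 f (df x)) -> (forall x, a <= x <= b -> 0 <= df x) ->
  f a <= f b.
Proof.
move=> ab hf df0.
have cf : {within `[a, b], continuous f}.
  apply: continuous_subspaceT => x; apply: differentiable_continuous.
  by apply/derivable1_diffP; case: (hf x).
have [c + e] := MVT_segment ab (fun x _ => hf x) cf.
rewrite in_itv /= => /df0 h.
by rewrite -subr_ge0 e mulr_ge0// subr_ge0.
Qed.

Lemma sin_le (q : R) : 0 <= q -> sin q <= q.
Proof.
move=> q0; have : 0 - sin 0 <= q - sin q; last by rewrite sin0 subr0 subr_ge0.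
apply: (@le_of_derive (fun x => x - sin x) (fun x => 1 - cos x)) => // x _.
Qed.

Lemma abs_sin_le (q : R) : `|sin q| <= `|q|.
Proof.
have aux (x : R) : 0 <= x -> `|sin x| <= x.
  move=> x0; have [x1|/ltW x1] := leP x 1.
    by rewrite ger0_norm ?sin_le// sin_ge0_pi// x0 (le_trans x1)// (le_trans _ (pi_ge2 R))// ler1n.
  exact: le_trans (sin_max x) x1.
have [q0|/ltW q0] := leP 0 q; first by rewrite (ger0_norm q0) aux.
by rewrite -normrN -sinN (ler0_norm q0) aux// oppr_ge0.
Qed.

Lemma cos_ge (q : R) : 1 - q ^+ 2 / 2 <= cos q.
Proof.
have e : q = (q / 2) *+ 2 by rewrite -mulr_natr divfK ?pnatr_eq0.
rewrite {2}e cos_mulr2n -[cos _ ^+ 2]opprK -[- cos _ ^+ 2](addKr 1) -sin2cos2.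
have := abs_sin_le (q / 2); rewrite -(ler_pXn2r (n := 2)) ?nnegrE// !real_normK ?num_real//.
by rewrite exprMn; lra.
Qed.

Lemma sin_sub_le (q : R) : `|sin q - q| <= q ^+ 2.
Proof.
have aux (x : R) : 0 <= x -> `|sin x - x| <= x ^+ 2.
  move=> x0; rewrite ler0_norm ?subr_le0 ?sin_le// opprB lerBlDr addrC -lerBlDr.
  have [x1|/ltW x1] := leP x 1; last first.
    have [x2|/ltW x2] := leP x 2; last by have := sin_geN1 x; nra.
    have : 0 <= sin x by rewrite sin_ge0_pi// x0 (le_trans x2)// pi_ge2.
    by nra.
  suff : sin 0 - 0 + 0 ^+ 2 <= sin x - x + x ^+ 2 by rewrite sin0; lra.
  apply: (@le_of_derive (fun x => sin x - x + x ^+ 2) (fun x => cos x - 1 + 2 * x)).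
  - by [].
  - by move=> y; apply: is_derive_eq; rewrite /GRing.scale /=; ring.
  - move=> y /andP[y0 yx].
  by have := cos_ge y; nra.
have [q0|/ltW q0] := leP 0 q; first exact: aux.
by rewrite -normrN opprD -sinN -sqrrN aux// oppr_ge0.
Qed.

Lemma exp_le_quad (p : R) : `|p| <= 2^-1 -> 0 <= expR p - 1 - p <= 2 * p ^+ 2.
Proof.
rewrite ler_norml => /andP[p1 p2].
have h1 := expR_ge1Dx p; have h2 := expR_ge1Dx (- p).
have h3 : expR p * expR (- p) = 1 by rewrite -expRD subrr expR0.
have e0 := expR_gt0 p; have f0 := expR_gt0 (- p).
apply/andP; split; first by lra.
have : expR p * (1 - p) <= 1 by rewrite -h3 ler_pM2l//; lra.
move: (expR p) e0 h1 => E e0 h1 h; clear h2 h3 f0; nra.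
Qed.

End RealEstimates.

Section Exponential.
Variable R : realType.
Local Notation C := R[i].

Lemma cexpD (z w : C) : cexp (z + w) = cexp z * cexp w.
Proof.
case: z w => a b [c d]; rewrite /cexp /= expRD rmorphM.
rewrite [RHS]mulrACA; congr (_ * _).
by apply/eqP; rewrite eq_complex /= cosD sinD addrC; apply/andP; split=> //; rewrite addrC.
Qed.

Lemma cexp_real (r : R) : cexp r%:C = (expR r)%:C.
Proof. by rewrite /cexp /= cos0 sin0 mulr1. Qed.

(** Real and imaginary parts are estimated separately; the constant 5 is not
    sharp. *)
Lemma cexp_taylor (w : C) : mag w <= 2^-1 -> mag (cexp w - 1 - w) <= 5 * mag w ^+ 2.
Proof.
move=> w1; have p1 := le_trans (mag_Re w) w1.
apply: le_trans (mag_le_ReIm _) _.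
rewrite mag_sqr; case: w {w1} p1 => p q /= p1.
have /andP[e1 e2] := exp_le_quad p1.
move: p1; rewrite ler_norml => /andP[p1 p2].
rewrite !(mul0r, subr0, addr0).
have -> : expR p * cos q - 1 - p = (expR p - 1 - p) + expR p * (cos q - 1) by ring.
have -> : expR p * sin q - q = (expR p - 1) * sin q + (sin q - q) by ring.
have c1 := cos_ge q; have c2 := cos_le1 q; have s1 := abs_sin_le q; have s2 := sin_sub_le q.
have E0 := expR_gt0 p.
have A : `|expR p - 1 - p + expR p * (cos q - 1)| <= 2 * p ^+ 2 + q ^+ 2.
  rewrite (le_trans (ler_normD _ _))// ger0_norm// lerD// normrM (gtr0_norm E0).
  rewrite ler0_norm ?subr_le0//.
  have E2 : expR p <= 2.
    have : p ^+ 2 <= 4^-1 by clear -p1 p2; nra.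
    by move=> ?; lra.
  have h1 : 0 <= - (cos q - 1) by lra.
  have h2 : - (cos q - 1) <= q ^+ 2 / 2 by lra.
  by have h := ler_pM (ltW E0) h1 E2 h2; lra.
have B : `|(expR p - 1) * sin q + (sin q - q)| <= p ^+ 2 + q ^+ 2 *+ 2.
  rewrite (le_trans (ler_normD _ _))// mulr2n addrA lerD// normrM.
  have h : `|expR p - 1| <= 2 * `|p|.
    have -> : expR p - 1 = (expR p - 1 - p) + p by ring.
    rewrite (le_trans (ler_normD _ _))// (ger0_norm e1).
    have pp : p ^+ 2 = `|p| ^+ 2 by rewrite real_normK// num_real.
    have np : `|p| <= 2^-1 by rewrite ler_norml p1.
    have n0 := normr_ge0 p.
    by move: e2 np n0; rewrite pp; clear; move: (expR p - 1 - p) => v; nra.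
  rewrite (le_trans (ler_pM _ _ h s1))//.
  have -> : p ^+ 2 = `|p| ^+ 2 by rewrite real_normK// num_real.
  have -> : q ^+ 2 = `|q| ^+ 2 by rewrite real_normK// num_real.
  by have := sqr_ge0 (`|p| - `|q|); rewrite sqrrB; lra.
rewrite (le_trans (lerD A B))//.
by have := sqr_ge0 p; have := sqr_ge0 q; lra.
Qed.

End Exponential.

(** * Convergence of the Euler product for Gamma *)

Section GammaSequence.
Variable R : realType.
Local Notation C := R[i].

(** The product of the ratios 1 + O(1/k^2) keeps d bounded, hence its increments
    are absolutely summable. The majorant is a telescoping difference, of the
    size of 1/k^2, so that its partial sums are explicit. *)
Lemma cvg_of_ratio (d : nat -> C) (c : R) : 0 <= c ->
  (forall k, mag (d k.+1 - d k) <= mag (d k) * (c * (k.+1%:R^-1 - k.+2%:R^-1))) ->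
  exists l : C, d @ \oo --> l.
Proof.
move=> c0 hd.
have dec k : 0 <= k.+1%:R^-1 - k.+2%:R^-1 :> R.
  by rewrite subr_ge0 lef_pV2 ?posrE// ler_nat.
have bd k : mag (d k) <= mag (d 0%N) * expR (c * (1 - k.+1%:R^-1)).
  elim: k => [|k IH]; first by rewrite invr1 subrr mulr0 expR0 mulr1.
  have -> : d k.+1 = d k + (d k.+1 - d k) by rewrite addrC subrK.
  rewrite (le_trans (magD _ _))// (le_trans (lerD (lexx _) (hd k)))//.
  have -> : c * (1 - k.+2%:R^-1) = c * (1 - k.+1%:R^-1) + c * (k.+1%:R^-1 - k.+2%:R^-1) :> R.
    by rewrite -mulrDr addrA subrK.
  rewrite expRD [leRHS]mulrA -{1}[mag (d k)]mulr1 -mulrDr.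
  apply: ler_pM; [exact: mag_ge0 | | exact: IH | exact: expR_ge1Dx].
  by rewrite addr_ge0// mulr_ge0.
pose M := mag (d 0%N) * expR c.
have bdM k : mag (d k) <= M.
  rewrite (le_trans (bd k))// ler_wpM2l ?mag_ge0// ler_expR ler_piMr//.
have ab : abs_bound (fun k => d k.+1 - d k) (M * c).
  apply: abs_bound_nat => N.
  have : \sum_(n < N) mag (d n.+1 - d n) <= M * (c * (1 - N.+1%:R^-1)).
    elim: N => [|N IH]; first by rewrite big_ord0 invr1 subrr !mulr0.
    rewrite big_ord_recr /=.
    have h : mag (d N.+1 - d N) <= M * (c * (N.+1%:R^-1 - N.+2%:R^-1)).
      by rewrite (le_trans (hd N))// ler_wpM2r// mulr_ge0.
    by rewrite (le_trans (lerD IH h))// -!mulrDr addrA subrK.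
  move/le_trans; apply; rewrite ler_wpM2l ?mulr_ge0 ?mag_ge0 ?expR_ge0//.
  by rewrite ler_piMr.
have [l hl] := has_sum_ex ab.
exists (d 0%N + l).
have := has_sum_series hl; move/cvgCP => h; apply/cvgCP => e /h[N hN].
exists N => n /hN; rewrite /series /= telescope_sumr//.
by congr (mag _ < _); ring.
Qed.

Definition gam_seq (z : C) (n : nat) : C :=
  n`!%:R * cexp (z * (ln (n%:R : R))%:C) / pochhammer z n.+1.

Lemma GammaE z : Gamma z = limn (gam_seq z). Proof. by []. Qed.

Lemma ln_step n : (0 < n)%N ->
  n.+1%:R^-1 <= ln (n.+1%:R : R) - ln n%:R <= n%:R^-1.
Proof.
move=> n0; have n0R : 0 < n%:R :> R by rewrite ltr0n.
rewrite -ln_div ?posrE//; apply/andP; split; last first.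
  have -> : n.+1%:R / n%:R = 1 + n%:R^-1 :> R.
    by rewrite -[n.+1%:R]natr1 mulrDl divff ?gt_eqF// mul1r.
  by apply: le_ln1Dx; rewrite (lt_trans (ltrN10 _))// invr_gt0.
rewrite -lerN2 -lnV ?posrE ?divr_gt0// invf_div.
have -> : n%:R / n.+1%:R = 1 + - n.+1%:R^-1 :> R.
  have e : n%:R + 1 = n.+1%:R :> R := natr1 n.
  by rewrite -e; field; rewrite e pnatr_eq0.
apply: le_ln1Dx; rewrite ltrN2 invf_lt1// ltr1n.
by case: n n0 {n0R}.
Qed.

Lemma gam_seqS z n : gam_seq z n.+1 =
  gam_seq z n * (n.+1%:R * cexp (z * (ln (n.+1%:R : R) - ln n%:R)%:C) / (z + n.+1%:R)).
Proof.
rewrite /gam_seq.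
have -> : z * (ln (n.+1%:R : R))%:C =
    z * (ln (n%:R : R))%:C + z * (ln (n.+1%:R : R) - ln n%:R)%:C.
  by rewrite -mulrDr -rmorphD addrC subrK.
rewrite (pochS z n.+1) cexpD factS natrM invfM.
by move: (_^-1) (_^-1) => P Q; ring.
Qed.

(** The ratio of consecutive terms is (n+1) e^(z d) / (z+n+1) with d = ln (n+1)
    - ln n = 1/(n+1) + O(1/n^2), that is 1 + O(1/n^2). *)
Lemma gam_seq_cvg (z : C) : 0 < complex.Re z -> exists l : C, gam_seq z @ \oo --> l.
Proof.
move=> z0; pose Z := mag z; have Z0 : 0 <= Z := mag_ge0 z.
pose N := (Num.truncn (2 * Z)).+1.
have [|k|l hl] := @cvg_of_ratio (fun k => gam_seq z (k + N)) (10 * Z ^+ 2 + Z).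
- by have := sqr_ge0 Z; lra.
- rewrite addSn; move en : (k + N)%N => n.
  have n0 : (0 < n)%N by rewrite -en addnS.
  have kn : (k.+1 <= n)%N by rewrite -en addnS ltnS leq_addr.
  have nZ : 2 * Z <= n%:R.
    rewrite (le_trans (ltW (truncnS_gt _)))// ler_nat -en; exact: leq_addl.
  have n0R : 0 < n%:R :> R by rewrite ltr0n.
  have /andP[] := ln_step n0.
  rewrite gam_seqS; move: (ln _ - ln _) => dl d1 d2.
  have zn : n.+1%:R <= mag (z + n.+1%:R).
    rewrite (le_trans _ (mag_Re _))// natCR; case: z z0 {Z Z0 N nZ en} => a b /= a0.
    by rewrite ger0_norm; lra.
  have zn0 : z + n.+1%:R != 0 by rewrite -mag_gt0 (lt_le_trans _ zn).
  have -> : gam_seq z n * (n.+1%:R * cexp (z * dl%:C) / (z + n.+1%:R)) - gam_seq z n =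
     gam_seq z n * ((cexp (z * dl%:C) - 1 - z * dl%:C + z * (dl%:C - n.+1%:R^-1)) *
       (n.+1%:R / (z + n.+1%:R))).
    move: zn0 (natC_neq0 R n); move: (n.+1%:R) => m zm m0.
    by field; rewrite m0 zm.
  rewrite [mag (gam_seq z n * _)]magM ler_wpM2l ?mag_ge0//.
  rewrite [mag (_ * (_ / _))]magM.
  have h1 : mag (n.+1%:R / (z + n.+1%:R)) <= 1.
    by rewrite [mag _]magM magV mag_nat ler_pdivrMr ?mul1r// (lt_le_trans _ zn).
  rewrite (le_trans (ler_pM (mag_ge0 _) (mag_ge0 _) (lexx _) h1))// mulr1.
  have dl0 : 0 <= dl by rewrite (le_trans _ d1).
  have iE : n%:R^-1 - n.+1%:R^-1 = (n%:R * n.+1%:R)^-1 :> R.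
    have e : n%:R + 1 = n.+1%:R :> R := natr1 n.
    by rewrite -e; field; rewrite e !pnatr_eq0 -?lt0n ?n0.
  have h2 : mag (z * dl%:C) <= Z * n%:R^-1.
    by rewrite [mag _]magM mag_real ger0_norm// ler_wpM2l.
  have h3 : mag (z * (dl%:C - n.+1%:R^-1)) <= Z * (n%:R * n.+1%:R)^-1.
    rewrite [mag _]magM ler_wpM2l// natCR -fmorphV -rmorphB mag_real ger0_norm ?subr_ge0//.
    by rewrite -iE lerD2r.
  have h4 : mag (z * dl%:C) <= 2^-1.
    by rewrite (le_trans h2)// ler_pdivrMr//; lra.
  have h5 : Z ^+ 2 * n%:R^-1 ^+ 2 <= 2 * Z ^+ 2 * (n%:R * n.+1%:R)^-1.
    have i2 : n%:R^-1 <= 2 * n.+1%:R^-1 :> R.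
      rewrite -[_^-1 in leLHS]mul1r ler_pdivrMr// mulrAC ler_pdivlMr//.
      by rewrite mul1r -[n.+1%:R]natr1; have : 1 <= n%:R :> R by [rewrite ler1n]; lra.
    have i0 : 0 <= n%:R^-1 :> R by rewrite invr_ge0.
    rewrite invfM; have := ler_wpM2l (mulr_ge0 (sqr_ge0 Z) i0) i2.
    move: (n%:R^-1) (n.+1%:R^-1) (Z ^+ 2) => i m Z2; clear=> h.
    have -> : 2 * Z2 * (i * m) = Z2 * i * (2 * m) by ring.
    by rewrite expr2 mulrA.
  rewrite (le_trans (magD _ _))// (le_trans (lerD (cexp_taylor h4) h3))//.
  have h6 : mag (z * dl%:C) ^+ 2 <= Z ^+ 2 * n%:R^-1 ^+ 2.
    by rewrite -exprMn ler_pXn2r// ?nnegrE ?mag_ge0// mulr_ge0 ?invr_ge0.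
  have h8 : ((n%:R * n.+1%:R)^-1 : R) <= k.+1%:R^-1 - k.+2%:R^-1.
    have -> : k.+1%:R^-1 - k.+2%:R^-1 = (k.+1%:R * k.+2%:R)^-1 :> R.
      have e : k.+1%:R + 1 = k.+2%:R :> R := natr1 k.+1.
      rewrite -e; field.
      have k0 : 0 <= k%:R :> R by [].
      by apply/andP; split; apply: lt0r_neq0; lra.
    rewrite lef_pV2 ?posrE ?mulr_gt0//.
    by rewrite ler_pM// ler_nat.
  have Q0 : 0 <= 10 * Z ^+ 2 + Z by have := sqr_ge0 Z; lra.
  apply: le_trans (ler_wpM2l Q0 h8).
  rewrite [leRHS]mulrDl lerD2r; move: h5 h6; move: ((n%:R * n.+1%:R)^-1) (Z ^+ 2) (n%:R^-1 ^+ 2).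
  by move: (mag _ ^+ 2); clear; move=> s t Z2 u h5 h6; lra.
by exists l; rewrite -(cvg_shiftn N).
Qed.

Lemma inv_nat_cvg0 (c : C) : (fun n : nat => c / n%:R) @ \oo --> (0 : C).
Proof.
apply/cvgCP => e e0; exists (Num.truncn (mag c / e)).+1 => n hn.
have n0 : 0 < n%:R :> R by rewrite ltr0n (leq_trans _ hn).
rewrite subr0 magM magV mag_nat ltr_pdivrMr// mulrC -ltr_pdivrMr//.
by rewrite (lt_le_trans (truncnS_gt _))// ler_nat.
Qed.

Lemma cvgCM (u v : nat -> C) (a b : C) : u @ \oo --> a -> v @ \oo --> b ->
  (fun n => u n * v n) @ \oo --> a * b.
Proof. exact: cvgM. Qed.

Lemma cvgC_eq (u v : nat -> C) (l : C) : (forall n, (0 < n)%N -> u n = v n) ->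
  u @ \oo --> l -> v @ \oo --> l.
Proof.
move=> uv /cvgCP h; apply/cvgCP => e /h[N hN]; exists N.+1 => n nN.
by rewrite -uv ?(leq_ltn_trans _ nN)//; apply: hN; apply: ltnW.
Qed.

Lemma cvgC_cst (a : C) : (fun _ : nat => a) @ \oo --> a.
Proof. exact: cvg_cst. Qed.

Lemma gam_seq_shift (z : C) n : z != 0 -> (0 < n)%N -> z + n.+1%:R != 0 ->
  z * gam_seq z n = gam_seq (z + 1) n * (1 + (z + 1) / n%:R).
Proof.
move=> z0 n0 zn; rewrite /gam_seq.
have -> : cexp ((z + 1) * (ln (n%:R : R))%:C) = cexp (z * (ln (n%:R : R))%:C) * n%:R.
  by rewrite mulrDl cexpD mul1r cexp_real lnK ?posrE ?ltr0n// -natCR.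
have -> : (pochhammer (z + 1) n.+1)^-1 = (pochhammer z n.+1)^-1 * (z + n.+1%:R)^-1 * z.
  have := pochS z n.+1; rewrite pochSl => h.
  have -> : pochhammer (z + 1) n.+1 = z^-1 * (pochhammer z n.+1 * (z + n.+1%:R)).
    by rewrite -h mulKf.
  by rewrite !invfM invrK mulrC.
have nn := natC_gt0 R n0.
rewrite -[n.+1%:R]natr1 in zn *.
move: (_^-1 : C) => P; move: nn zn; move: (n%:R : C) => m m0 zm.
by field; rewrite m0 -?addrA zm.
Qed.

(** The shift by 1 multiplies the n-th term by a factor that tends to z.
    Convergence at z + 1 therefore gives convergence at z. *)
Lemma gam_cvg_down (z l : C) : (forall k, z + k%:R != 0) ->
  gam_seq (z + 1) @ \oo --> l -> gam_seq z @ \oo --> l / z.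
Proof.
move=> hz hl; have z0 := hz 0%N; rewrite addr0 in z0.
have h1 : (fun n : nat => 1 + (z + 1) / n%:R) @ \oo --> (1 : C).
  apply/cvgCP => e e0; have /cvgCP/(_ e e0)[N hN] := inv_nat_cvg0 (z + 1).
  by exists N => n /hN; rewrite subr0 [1 + _]addrC addrK.
have h := cvgCM (cvgCM hl h1) (@cvgC_cst z^-1).
rewrite mulr1 in h.
apply: cvgC_eq h => n n0.
by rewrite -gam_seq_shift// mulrC mulKf.
Qed.

Lemma gam_cvg_poch (z l : C) n : (forall k, z + k%:R != 0) ->
  gam_seq (z + n%:R) @ \oo --> l -> gam_seq z @ \oo --> l / pochhammer z n.
Proof.
move=> hz; elim: n l => [|n IH] l; first by rewrite addr0 poch0 divr1.
rewrite -[n.+1%:R]natr1 addrA pochS => h.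
rewrite [_ * (z + _)]mulrC invfM mulrA; apply: IH; apply: gam_cvg_down => // k.
by rewrite -addrA -natrD.
Qed.

Lemma pochhammer_neq0 (z : C) n : (forall k, z + k%:R != 0) -> pochhammer z n != 0.
Proof.
by move=> hz; elim: n => [|n IH]; [rewrite poch0 oner_neq0 | rewrite pochS mulf_neq0].
Qed.

Lemma Gamma_poch (z : C) n : (forall k, z + k%:R != 0) -> 0 < complex.Re (z + n%:R) ->
  Gamma (z + n%:R) = pochhammer z n * Gamma z.
Proof.
move=> hz zn; have [l hl] := gam_seq_cvg zn.
rewrite !GammaE (cvgC_lim hl) (cvgC_lim (gam_cvg_poch hz hl)).
by rewrite mulrC divfK// pochhammer_neq0.
Qed.

End GammaSequence.

(** * Products of two values of Gamma *)

Section GammaProducts.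
Variable R : realType.
Local Notation C := R[i].
Variable nu : C.
Hypothesis hnu : 0 <= nu < 2^-1 \/ complex.Re nu = 0.
Let a0 : C := 2^-1 - nu.
Let b0 : C := 2^-1 + nu.

Lemma Re_half_nu : 0 < complex.Re a0 < 1 /\ 0 < complex.Re b0 < 1.
Proof.
rewrite /a0 /b0 half_half; case: hnu => [/andP[n0 n1]|n0].
  have [r nr] : exists r : R, nu = r%:C by apply/complex_realP; rewrite realE n0.
  move: n0 n1; rewrite nr half_half lecR ltcR /= => r0 r1.
  by split; apply/andP; split; lra.
case: nu n0 => p q /= ->; rewrite subr0 addr0.
by split; apply/andP; split; lra.
Qed.

(** A zero would make the real part of z an integer strictly between 0 and 1. *)
Lemma off_lattice (z : C) j k : 0 < complex.Re z < 1 -> z - j%:R + k%:R != 0.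
Proof.
move=> /andP[z0 z1]; apply/eqP => h.
have : complex.Re z = j%:R - k%:R.
  have -> : z = (j%:R - k%:R : R)%:C.
    rewrite rmorphB !rmorph_nat; apply/eqP; rewrite -subr_eq0 -h.
    by apply/eqP; ring.
  by [].
move: z0 z1; move=> + + e; rewrite e subr_gt0 ltr_nat ltrBlDr nat1r ltr_nat ltnS.
by move=> h1 h2; move: (leq_trans h1 h2); rewrite ltnn.
Qed.

Lemma half_sum_nu : a0 + b0 = 1.
Proof. by rewrite /a0 /b0 addrACA addNr addr0 half_sum. Qed.

Lemma Gamma_up x : Gamma (a0 + x%:R) * Gamma (b0 + x%:R) =
  alpha nu x * (Gamma a0 * Gamma b0).
Proof.
have [ha hb] := Re_half_nu.
have aux (z : C) : 0 < complex.Re z < 1 -> Gamma (z + x%:R) = pochhammer z x * Gamma z.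
  move=> hz; apply: Gamma_poch => [k|]; first by have := off_lattice 0 k hz; rewrite subr0.
  by rewrite natCR; case: z hz => p q /= /andP[p0 _]; rewrite ltr_wpDr.
by rewrite !aux// /alpha -/a0 -/b0; ring.
Qed.

(** (1 - b - j)_j = (-1)^j (b)_j, so descending j steps from a0 and b0 costs
    the same factor alpha j as climbing j steps, the two signs cancelling. *)
Lemma Gamma_down j : alpha nu j * (Gamma (a0 - j%:R) * Gamma (b0 - j%:R)) =
  Gamma a0 * Gamma b0.
Proof.
have [ha hb] := Re_half_nu.
have aux (z : C) : 0 < complex.Re z < 1 ->
    Gamma z = pochhammer (z - j%:R) j * Gamma (z - j%:R).
  move=> hz; rewrite -{1}[z](subrK j%:R); apply: Gamma_poch => [k|].
    exact: off_lattice.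
  by rewrite subrK; case/andP: hz.
have aux2 (z w : C) : z + w = 1 -> pochhammer (z - j%:R) j = (- 1) ^+ j * pochhammer w j.
  move=> zw; rewrite /pochhammer big_nat_rev /= -[X in (- 1) ^+ X]subn0 -prodr_const_nat -big_split /=.
  rewrite !big_nat; apply: eq_bigr => k kj.
  have -> : w = 1 - z by rewrite -zw; ring.
  by rewrite add0n natrB// -[k.+1%:R]natr1; ring.
rewrite (aux a0)// (aux b0)// (aux2 a0 b0) ?half_sum_nu// (aux2 b0 a0); last first.
  by rewrite addrC half_sum_nu.
rewrite /alpha -/a0 -/b0.
have := sqrr_sign C j; rewrite expr2 => s.
by move: s; move: ((- 1) ^+ j) => e s; rewrite -[LHS]mul1r -s; ring.
Qed.

(** The powers n^(1/2 - nu) and n^(1/2 + nu) in the two Euler products multiply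
    to n. *)
Lemma Gamma_half_lim (l : C) :
  (fun n : nat => n`!%:R ^+ 2 * n%:R / alpha nu n.+1) @ \oo --> l ->
  Gamma a0 * Gamma b0 = l.
Proof.
move=> hl.
have [/andP[ha _] /andP[hb _]] := Re_half_nu.
have [la hla] := gam_seq_cvg ha; have [lb hlb] := gam_seq_cvg hb.
rewrite !GammaE (cvgC_lim hla) (cvgC_lim hlb).
rewrite -(cvgC_lim (cvgCM hla hlb)); apply: cvgC_lim.
apply: cvgC_eq hl => n n0.
rewrite /gam_seq /alpha -/a0 -/b0 invfM [RHS]mulrACA.
have -> : n%:R = cexp (a0 * (ln (n%:R : R))%:C) * cexp (b0 * (ln (n%:R : R))%:C) :> C.
  by rewrite -cexpD -mulrDl half_sum_nu mul1r cexp_real lnK ?posrE ?ltr0n// -natCR.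
by rewrite expr2; congr (_ * _); exact: mulrACA.
Qed.

End GammaProducts.

(** * Wallis integrals *)

Section DerivativeRules.
Variable R : realType.
Implicit Types (f g : R -> R) (t a b c : R).

Lemma derE f t a b : is_derive t 1 f a -> a = b -> is_derive t 1 f b.
Proof. by move=> h <-. Qed.

Lemma derD f g t a b : is_derive t 1 f a -> is_derive t 1 g b -> is_derive t 1 (fun x => f x + g x) (a + b).
Proof. exact: is_deriveD. Qed.

Lemma derM f g t a b : is_derive t 1 f a -> is_derive t 1 g b ->
  is_derive t 1 (fun x => f x * g x) (a * g t + f t * b).
Proof.
move=> hf hg; have := is_deriveM hf hg; rewrite /GRing.scale /= => h.
by apply: is_derive_eq; ring.
Qed.
Lemma derZ c f t a : is_derive t 1 f a -> is_derive t 1 (fun x => c * f x) (c * a).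
Proof. exact: is_deriveZ. Qed.

Lemma derX f t a n : is_derive t 1 f a -> is_derive t 1 (fun x => f x ^+ n.+1) (n.+1%:R * f t ^+ n * a).
Proof.
move=> hf; elim: n => [|n IH]; first by rewrite expr0 mulr1 mul1r.
have := derM hf IH.
under [X in is_derive _ _ X _]funext do rewrite -exprS.
move=> h; apply: is_derive_eq.
by rewrite -[n.+2%:R]natr1; rewrite !exprS; ring.
Qed.
End DerivativeRules.

Section Wallis.
Variable R : realType.
Local Notation hpi := (pi / 2 : R).

Lemma hpi_ge0 : 0 <= hpi. Proof. by rewrite divr_ge0// pi_ge0. Qed.

Lemma cos_ge0_quarter (t : R) : 0 <= t <= hpi -> 0 <= cos t.
Proof.
move=> /andP[t0 t1]; apply: cos_ge0_pihalf; rewrite t1 andbT (le_trans _ t0)//.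
by rewrite oppr_le0 hpi_ge0.
Qed.

Lemma sin_ge0_quarter (t : R) : 0 <= t <= hpi -> 0 <= sin t.
Proof.
move=> /andP[t0 t1]; apply: sin_ge0_pi; rewrite t0 (le_trans t1)//.
by rewrite ler_pdivrMr// ler_peMr ?pi_ge0// ler1n.
Qed.

(** A primitive of cos^n, from the recursion given by integration by parts. *)
Fixpoint cos_prim (n : nat) (t : R) : R :=
  match n with
  | 0 => t
  | n'.+1 => match n' with
             | 0 => sin t
             | m.+1 => m.+2%:R^-1 * (m.+1%:R * cos_prim m t + cos t ^+ m.+1 * sin t)
             end
  end.

Lemma is_derive_cos_prim n (t : R) : is_derive t 1 (cos_prim n) (cos t ^+ n).
Proof.
suff [] : is_derive t 1 (cos_prim n) (cos t ^+ n) /\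
  is_derive t 1 (cos_prim n.+1) (cos t ^+ n.+1) by [].
elim: n => [|n [IH1 IH2]]; first by split; [exact: is_derive_id | exact: is_derive_sin].
split=> //.
apply: (derE (derZ n.+2%:R^-1 (derD (derZ n.+1%:R IH1)
  (derM (derX n (is_derive_cos t)) (is_derive_sin t))))).
have -> : n.+1%:R * cos t ^+ n * - sin t * sin t = - (n.+1%:R * cos t ^+ n) * sin t ^+ 2 by ring.
rewrite sin2cos2 !exprS -[n.+2%:R]natr1.
by field; have h : 0 <= n%:R :> R by []; apply: lt0r_neq0; lra.
Qed.

Definition wallis n : R := cos_prim n hpi.

Lemma wallis0 : wallis 0 = hpi. Proof. by []. Qed.

Lemma wallis1 : wallis 1 = 1. Proof. by rewrite /wallis /= sin_pihalf. Qed.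

Lemma wallisS n : wallis n.+2 = n.+1%:R / n.+2%:R * wallis n.
Proof. by rewrite /wallis /= cos_pihalf expr0n /= mul0r addr0 mulrCA mulrA. Qed.

Lemma cos_prim0 n : cos_prim n 0 = 0.
Proof.
suff [] : cos_prim n 0 = 0 /\ cos_prim n.+1 0 = 0 by [].
elim: n => [|n [h1 h2]]; first by rewrite /= sin0.
by split=> //=; rewrite h1 sin0 !mulr0 addr0 mulr0.
Qed.

Lemma wallis_decr n : wallis n.+1 <= wallis n.
Proof.
rewrite -subr_ge0 /wallis.
have : cos_prim n 0 + - 1 * cos_prim n.+1 0 <= cos_prim n hpi + - 1 * cos_prim n.+1 hpi.
  apply: (@le_of_derive _ (fun t => cos_prim n t + - 1 * cos_prim n.+1 t)
    (fun t => cos t ^+ n + - 1 * cos t ^+ n.+1)); first exact: hpi_ge0.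
    by move=> t; exact: derD (is_derive_cos_prim n t) (derZ _ (is_derive_cos_prim n.+1 t)).
  move=> t ht; rewrite mulN1r subr_ge0 exprS ler_piMl ?exprn_ge0 ?cos_ge0_quarter ?cos_le1//.
by rewrite !cos_prim0 mulr0 addr0 mulN1r.
Qed.

Lemma wallis_mul n : wallis n.+1 * wallis n = hpi / n.+1%:R.
Proof.
elim: n => [|n IH]; first by rewrite wallis1 wallis0 mul1r divr1.
rewrite wallisS -[LHS]mulrA (mulrC (wallis n)) IH.
by field; rewrite -!natr1; have h : 0 <= n%:R :> R by []; apply/andP; split; apply: lt0r_neq0; lra.
Qed.

Lemma wallis_gt0 n : 0 < wallis n.
Proof.
suff [] : 0 < wallis n /\ 0 < wallis n.+1 by [].
elim: n => [|n [h1 h2]]; first by rewrite wallis0 wallis1 divr_gt0 ?pi_gt0.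
by split=> //; rewrite wallisS mulr_gt0// divr_gt0.
Qed.

Lemma wallis_odd m : wallis m.*2.+1 = 4 ^+ m * m`!%:R ^+ 2 / (m.*2.+1)`!%:R.
Proof.
elim: m => [|m IH]; first by rewrite wallis1 !fact0 expr0 mul1r expr1n divr1.
rewrite doubleS wallisS IH !factS !natrM -[m.*2.+3%:R]natr1 -[m.*2.+2%:R]natr1 -muln2 -[(m * 2).+1%:R]natr1 natrM.
have h := fact_gt0R R (m * 2); have h0 : 0 <= m%:R :> R by [].
rewrite [4 ^+ m.+1]exprS -[m.+1%:R]natr1; move: (4 ^+ m) (m`!%:R) ((m * 2)`!%:R) h => u v w w0.
field; rewrite (gt_eqF w0)/=.
by repeat (apply/andP; split); apply: lt0r_neq0; lra.
Qed.

(** 4 m W_(2m+1)^2 is squeezed between neighbouring products W_(n+1) W_n. *)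
Lemma wallis_square m : `|4 * m%:R * wallis m.*2.+1 ^+ 2 - pi| <= pi / m.+1%:R.
Proof.
have h1 : wallis m.*2.+1 ^+ 2 <= hpi / m.*2.+1%:R.
  by rewrite -wallis_mul expr2 ler_pM2l ?wallis_gt0// wallis_decr.
have h2 : hpi / m.*2.+2%:R <= wallis m.*2.+1 ^+ 2.
  by rewrite -wallis_mul expr2 ler_pM2r ?wallis_gt0// wallis_decr.
have m0 : 0 <= m%:R :> R by [].
have p0 := pi_gt0 R.
move: h1 h2; rewrite -[m.*2.+2%:R]natr1 -[m.*2.+1%:R]natr1 -[m.+1%:R]natr1 -muln2 natrM.
rewrite ler_pdivlMr; last by lra.
rewrite ler_pdivrMr; last by lra.
move: (sqr_ge0 (wallis m.*2.+1)); rewrite -muln2.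
move: (wallis _ ^+ 2) (m%:R) m0 => w x x0 w0 h1 h2.
rewrite ler_norml ler_pdivlMr; last by lra.
rewrite -mulNr ler_pdivrMr; last by lra.
have h3 := ler_wpM2l x0 h2; have h4 := mulr_ge0 w0 x0.
apply/andP; split; first by lra.
by have := ler_wpM2l x0 h1; nra.
Qed.

(** sin t - t cos t vanishes at 0 and has derivative t sin t. *)
Lemma sqr_cos_le_sin (t : R) : 0 <= t <= hpi -> t ^+ 2 * cos t ^+ 2 <= sin t ^+ 2.
Proof.
move=> /andP[t0 t1]; rewrite -exprMn ler_pXn2r// ?nnegrE.
- have : sin 0 + - 1 * (0 * cos 0) <= sin t + - 1 * (t * cos t).
    apply: (@le_of_derive _ (fun t => sin t + - 1 * (t * cos t)) (fun t => t * sin t)) => // [x|x /andP[x0 x1]].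
      apply: (derE (derD (is_derive_sin x) (derZ (- 1) (derM (is_derive_id x 1) (is_derive_cos x))))).
      by ring.
    by rewrite mulr_ge0// sin_ge0_quarter// x0 (le_trans x1).
  by rewrite sin0 mul0r; lra.
- by rewrite mulr_ge0// cos_ge0_quarter// t0.
- by rewrite sin_ge0_quarter// t0.
Qed.

End Wallis.

(** * Wallis integrals with a cosine factor *)

(** The functions cs and sn stand for cos (2 nu t) and its derivative, with
    s = nu^2; only the differential equation is used, which treats the
    trigonometric and the hyperbolic case at once. *)
Section TwistedWallis.
Variable R : realType.
Local Notation hpi := (pi / 2 : R).
Variables (s B : R) (cs sn : R -> R).
Hypothesis s_lt : 4 * s < 1.
Hypothesis dcs : forall t : R, is_derive t 1 cs (sn t).
Hypothesis dsn : forall t : R, is_derive t 1 sn (- (4 * s) * cs t).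
Hypothesis cs0 : cs 0 = 1.
Hypothesis sn0 : sn 0 = 0.
Hypothesis cs_bound : forall t : R, 0 <= t <= hpi -> `|cs t| <= B.
Hypothesis cs_gt0 : 0 < cs hpi.

Let K : R := 2 * `|s| * B.

Lemma twist_bound_ge0 : 0 <= B.
Proof.
by apply: le_trans (normr_ge0 (cs 0)) (cs_bound _); rewrite lexx; exact: hpi_ge0.
Qed.

Lemma sn_bound (t : R) : 0 <= t <= hpi -> `|sn t| <= 2 * K * t.
Proof.
move=> /andP[t0 t1].
have key e : e ^+ 2 = 1 -> e * sn t <= 2 * K * t.
  move=> e1.
  have : 2 * K * 0 + - e * sn 0 <= 2 * K * t + - e * sn t; last by rewrite sn0; lra.
  apply: (@le_of_derive _ (fun t => 2 * K * t + - e * sn t)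
      (fun t => 2 * K + - e * (- (4 * s) * cs t))) => // [x|x /andP[x0 x1]].
    apply: (derE (derD (derZ (2 * K) (is_derive_id x 1)) (derZ (- e) (dsn x)))).
    by rewrite mulr1.
  have h : `|e * (s * cs x)| <= `|s| * B.
    rewrite normrM normrM (_ : `|e| = 1) ?mul1r.
      by rewrite ler_wpM2l// cs_bound// x0 (le_trans x1).
    by apply/eqP; rewrite -sqrp_eq1// real_normK ?num_real// e1.
  by move: h; rewrite ler_norml /K => /andP[h1 h2]; lra.
rewrite ler_norml; apply/andP; split.
  by have := key (- 1); rewrite sqrrN expr1n => /(_ erefl); lra.
by have := key 1; rewrite expr1n => /(_ erefl); lra.
Qed.

Lemma cs_sub1 (t : R) : 0 <= t <= hpi -> `|cs t - 1| <= K * t ^+ 2.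
Proof.
move=> /andP[t0 t1].
have key e : e ^+ 2 = 1 -> e * (cs t - 1) <= K * t ^+ 2.
  move=> e1.
  have : K * 0 ^+ 2 + - e * cs 0 <= K * t ^+ 2 + - e * cs t; last by rewrite cs0 expr0n /=; lra.
  apply: (@le_of_derive _ (fun t => K * t ^+ 2 + - e * cs t)
      (fun t => 2 * K * t + - e * sn t)) => // [x|x /andP[x0 x1]].
    apply: (derE (derD (derZ K (derX 1 (is_derive_id x 1))) (derZ (- e) (dcs x)))).
    by rewrite expr1 mulr1; ring.
  have h : `|e * sn x| <= 2 * K * x.
    rewrite normrM (_ : `|e| = 1) ?mul1r ?sn_bound ?x0 ?(le_trans x1)//.
    by apply/eqP; rewrite -sqrp_eq1// real_normK ?num_real// e1.
  by move: h; rewrite ler_norml => /andP[h1 h2]; lra.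
rewrite ler_norml; apply/andP; split.
  by have := key (- 1); rewrite sqrrN expr1n => /(_ erefl); lra.
by have := key 1; rewrite expr1n => /(_ erefl); lra.
Qed.

(** A primitive of cs t cos^(2m+1) t, where cs'' = - 4 s cs. Twofold integration
    by parts gives the recursion, with the denominators n^2 - 4 s in place of
    n^2. *)
Fixpoint twist_prim (m : nat) (t : R) : R :=
  match m with
  | 0 => (1 - 4 * s)^-1 * (cs t * sin t + sn t * cos t)
  | m'.+1 => let n := m'.*2.+3 in
      (n%:R ^+ 2 - 4 * s)^-1 * (n%:R * n.-1%:R * twist_prim m' t +
        (n%:R * (cs t * (cos t ^+ n.-1 * sin t)) + sn t * cos t ^+ n))
  end.

Lemma twist_den n : (0 < n)%N -> 0 < n%:R ^+ 2 - 4 * s.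
Proof.
move=> n0; rewrite subr_gt0 (lt_le_trans s_lt)//.
by rewrite exprn_ege1// ler1n.
Qed.

Lemma is_derive_twist_prim m (t : R) :
  is_derive t 1 (twist_prim m) (cs t * cos t ^+ m.*2.+1).
Proof.
have sc := sin2cos2 t.
elim: m => [|m IH].
  have d0 := twist_den (ltn0Sn 0); rewrite expr1n in d0.
  apply: (derE (derZ _ (derD (derM (dcs t) (is_derive_sin t)) (derM (dsn t) (is_derive_cos t))))).
  rewrite expr1; move: (sin t) (cos t) (cs t) (sn t) => S c u v.
  by field; rewrite gt_eqF.
rewrite doubleS; set n := m.*2.+3.
have d0 : 0 < n%:R ^+ 2 - 4 * s by exact: twist_den.
apply: (derE (derZ (n%:R ^+ 2 - 4 * s)^-1 (derD (derZ (n%:R * n.-1%:R) IH)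
  (derD (derZ n%:R (derM (dcs t) (derM (derX m.*2.+1 (is_derive_cos t)) (is_derive_sin t))))
        (derM (dsn t) (derX m.*2.+2 (is_derive_cos t))))))).
rewrite /= -/n; move: sc d0; rewrite (_ : m.*2.+2%:R = n%:R - 1 :> R); last first.
  by rewrite /n -[m.*2.+3%:R]natr1 addrK.
rewrite !exprS; move: (cos t ^+ m.*2) => p.
move: (n%:R : R) (sin t) (cos t) (cs t) (sn t) => N S c u v; rewrite expr0 !mulr1 => sc d0.
have -> : (N - 1) * (c * p) * - S * S = - ((N - 1) * (c * p)) * (S * S) by ring.
rewrite sc; apply: (mulfI (lt0r_neq0 d0)); rewrite mulVKf ?lt0r_neq0//.
by ring.
Qed.

Lemma twist_prim0 m : twist_prim m 0 = 0.
Proof. by elim: m => [|m IH] /=; rewrite ?IH sn0 sin0 !(mulr0, mul0r, addr0). Qed.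

Definition twisted m : R := twist_prim m hpi.

Lemma twisted0 : twisted 0 = cs hpi / (1 - 4 * s).
Proof. by rewrite /twisted /= sin_pihalf cos_pihalf mulr0 addr0 mulr1 mulrC. Qed.

Lemma twistedS m : twisted m.+1 =
  m.*2.+3%:R * m.*2.+2%:R / (m.*2.+3%:R ^+ 2 - 4 * s) * twisted m.
Proof.
rewrite /twisted /= cos_pihalf !expr0n /= mul0r !mulr0 !addr0.
by rewrite mulrA [_^-1 * _]mulrC.
Qed.

(** Near 0 the twist changes the integrand by O(t^2), and t^2 cos^n is
    dominated by cos^(n-2) sin^2 = cos^(n-2) - cos^n. *)
Lemma twisted_near m :
  `|twisted m.+1 - wallis R m.*2.+3| <= K * (wallis R m.*2.+1 - wallis R m.*2.+3).
Proof.
have key e : e ^+ 2 = 1 -> e * (twisted m.+1 - wallis R m.*2.+3) <=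
    K * (wallis R m.*2.+1 - wallis R m.*2.+3).
  move=> e1.
  pose F t := K * (cos_prim m.*2.+1 t + - 1 * cos_prim m.*2.+3 t)
     + - e * (twist_prim m.+1 t + - 1 * cos_prim m.*2.+3 t).
  have : F 0 <= F hpi.
    apply: (@le_of_derive _ F (fun t => K * (cos t ^+ m.*2.+1 + - 1 * cos t ^+ m.*2.+3)
     + - e * (cs t * cos t ^+ m.*2.+3 + - 1 * cos t ^+ m.*2.+3))).
    - exact: (hpi_ge0 R).
    - move=> t; rewrite /F.
      have h n := is_derive_cos_prim n t.
      have h2 := is_derive_twist_prim m.+1 t; rewrite doubleS in h2.
      exact: derD (derZ K (derD (h _) (derZ (- 1) (h _))))
        (derZ (- e) (derD h2 (derZ (- 1) (h _)))).
    - move=> t ht; have c0 := cos_ge0_quarter ht.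
      have h1 := cs_sub1 ht; have h2 := sqr_cos_le_sin ht; rewrite sin2cos2 in h2.
      have K0 : 0 <= K by rewrite /K mulr_ge0 ?twist_bound_ge0// mulr_ge0.
      have p0 : 0 <= cos t ^+ m.*2.+1 by rewrite exprn_ge0.
      have h3 : e * (cs t - 1) <= K * t ^+ 2.
        rewrite (le_trans _ h1)// (le_trans (ler_norm _))// normrM.
        rewrite (_ : `|e| = 1) ?mul1r//.
        by apply/eqP; rewrite -sqrp_eq1// real_normK ?num_real// e1.
      have -> : cos t ^+ m.*2.+3 = cos t ^+ m.*2.+1 * cos t ^+ 2.
        by rewrite -exprD addn2.
      have h4 := ler_wpM2r (sqr_ge0 (cos t)) h3.
      have h5 := ler_wpM2l K0 h2.
      have h6 : e * (cs t - 1) * cos t ^+ 2 <= K * (1 - cos t ^+ 2).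
        by rewrite (le_trans h4)// -mulrA.
      have := ler_wpM2l p0 h6; lra.
  rewrite /F !cos_prim0 twist_prim0 /twisted /wallis; lra.
rewrite ler_norml; apply/andP; split.
  by have := key (- 1); rewrite sqrrN expr1n => /(_ erefl); lra.
by have := key 1; rewrite expr1n => /(_ erefl); lra.
Qed.

Let A m : R := \prod_(0 <= k < m) ((2^-1 + k%:R) ^+ 2 - s).

Lemma half_sqr_gt0 k : 0 < (2^-1 + k%:R) ^+ 2 - s.
Proof.
have k0 : 0 <= k%:R :> R by [].
by have h := s_lt; nra.
Qed.

Lemma shifted_prod_gt0 m : 0 < A m.
Proof. by rewrite /A; apply: prodr_gt0 => k _; exact: half_sqr_gt0. Qed.

Lemma twistedE m : twisted m = cs hpi * (m.*2.+1)`!%:R / (4 ^+ m.+1 * A m.+1).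
Proof.
elim: m => [|m IH].
  rewrite twisted0 /A big_nat1 addr0 (_ : (0.*2.+1)`! = 1%N)// mulr1 expr1; congr (_ / _).
  by field.
have A0 := shifted_prod_gt0 m.+1; have h0 := half_sqr_gt0 m.+1.
have AS : A m.+2 = A m.+1 * ((2^-1 + m.+1%:R) ^+ 2 - s) by rewrite /A big_nat_recr.
rewrite twistedS IH AS doubleS !factS [4 ^+ m.+2]exprS.
have e : m.*2.+3%:R ^+ 2 - 4 * s = 4 * ((2^-1 + m.+1%:R) ^+ 2 - s).
  rewrite -[m.*2.+3%:R]natr1 -[m.*2.+2%:R]natr1 -[m.*2.+1%:R]natr1 -muln2 natrM -[m.+1%:R]natr1.
  by field.
rewrite e !natrM; move: (A m.+1) A0 (_ - s) h0 => a a0 b b0.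
move: (4 ^+ m.+1) (gt_eqF (exprn_gt0 m.+1 (ltr0n R 4))) => f f0.
by field; rewrite f0 (gt_eqF a0) (gt_eqF b0).
Qed.

Lemma twisted_wallis_mul m :
  4 * m%:R * twisted m * wallis R m.*2.+1 = cs hpi * (m`!%:R ^+ 2 * m%:R / A m.+1).
Proof.
rewrite twistedE wallis_odd exprS.
have A0 := shifted_prod_gt0 m.+1; have h := fact_gt0R R (m.*2.+1).
move: (4 ^+ m) (gt_eqF (exprn_gt0 m (ltr0n R 4))) => f f0.
move: (A _) A0 => a a0; move: ((m.*2.+1)`!%:R : R) h => w w0.
by field; rewrite f0 (gt_eqF a0) (gt_eqF w0).
Qed.

(** By the two recursions the product of the twisted and the plain integral of
    order 2m+1 is, up to cs(pi/2)/(4m), the expression on the left, whereas it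
    is close to the square of the plain integral, and 4 m W_(2m+1)^2 tends to
    pi. *)
Lemma wallis_limit : exists c, forall m, (0 < m)%N ->
  `|m`!%:R ^+ 2 * m%:R / A m.+1 - pi / cs hpi| <= c / m%:R.
Proof.
have B0 := twist_bound_ge0; have p0 := pi_gt0 R.
have K0 : 0 <= K by rewrite /K mulr_ge0 ?twist_bound_ge0// mulr_ge0.
exists ((pi * K + pi) / cs hpi) => -[//|m] _.
have c0 := cs_gt0; set x := _ / A _.
have -> : x - pi / cs hpi = (cs hpi * x - pi) / cs hpi by field; rewrite gt_eqF.
rewrite normrM normfV (gtr0_norm cs_gt0) mulrAC ler_pM2r ?invr_gt0//.
rewrite /x -twisted_wallis_mul.
have m0 : 0 < m.+1%:R :> R by [].
have h1 := wallis_square R m.+1; have h2 := twisted_near m.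
have w0 := wallis_gt0 R m.*2.+3; have m2 : 0 < m.+2%:R :> R by [].
have h3 : wallis R m.*2.+1 - wallis R m.*2.+3 = wallis R m.*2.+3 / (2 * m.+1%:R).
  rewrite wallisS -[m.*2.+3%:R]natr1 -[m.*2.+2%:R]natr1 -[m.*2.+1%:R]natr1 -muln2 natrM -[m.+1%:R]natr1.
  have x0 : 0 <= m%:R :> R by [].
  by field; repeat (apply/andP; split); apply: lt0r_neq0; lra.
rewrite h3 in h2; rewrite doubleS in h1 *.
move: {h3 c0 x} h1 h2 w0 p0; move: (wallis R m.*2.+3) (twisted m.+1) (pi : R).
move=> w t p h1 h2 w0 p0.
have -> : 4 * m.+1%:R * t * w - p =
   4 * m.+1%:R * w * (t - w) + (4 * m.+1%:R * w ^+ 2 - p) by ring.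
rewrite (le_trans (ler_normD _ _))// [leRHS]mulrDl lerD//; last first.
  by rewrite (le_trans h1)// ler_pM2l// lef_pV2 ?posrE// ler_nat.
rewrite normrM ger0_norm ?mulr_ge0 ?(ltW w0)//.
have h4 : 4 * m.+1%:R * w ^+ 2 <= 2 * p.
  move: h1; rewrite ler_norml => /andP[_]; rewrite lerBlDr => /le_trans; apply.
  have -> : 2 * p = p + p by ring.
  by rewrite lerD2r ler_pdivrMr// ler_peMr ?ler1n// ltW.
have c0 : 0 <= 4 * m.+1%:R * w by rewrite !mulr_ge0 ?(ltW w0).
apply: le_trans (ler_wpM2l c0 h2) _.
rewrite ler_pdivlMr//.
have -> : 4 * m.+1%:R * w * (K * (w / (2 * m.+1%:R))) * m.+1%:R
  = K * (4 * m.+1%:R * w ^+ 2) / 2.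
  by move: (m.+1%:R) m0 => M M0; field; rewrite gt_eqF.
by have := ler_wpM2l K0 h4; lra.
Qed.

End TwistedWallis.

(** * The reflection formula *)

Section Reflection.
Variable R : realType.
Local Notation C := R[i].
Local Notation hpi := (pi / 2 : R).
Variable nu : C.
Hypothesis hnu : 0 <= nu < 2^-1 \/ complex.Re nu = 0.

Lemma der_scale (f : R -> R) (c t a : R) : is_derive (c * t) 1 f a ->
  is_derive t 1 (fun x => f (c * x)) (c * a).
Proof.
move=> hf; have h := derZ c (is_derive_id t 1); rewrite mulr1 in h.
by have := is_derive1_comp hf h; rewrite /GRing.scale /= mulrC.
Qed.

Definition shifted_prod (s : R) m : R := \prod_(0 <= k < m) ((2^-1 + k%:R) ^+ 2 - s).

Lemma alpha_sqr (s : R) j : nu ^+ 2 = s%:C -> alpha nu j = (shifted_prod s j)%:C.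
Proof.
move=> hs; elim: j => [|j IH].
  by rewrite /alpha /shifted_prod !poch0 big_geq// mulr1 rmorph1.
rewrite alphaS IH /shifted_prod [in RHS]big_nat_recr//= rmorphM; congr (_ * _).
have e : ((2^-1 + j%:R) ^+ 2 - s)%:C = (2^-1 + j%:R) ^+ 2 - nu ^+ 2 :> C.
  by rewrite hs rmorphB rmorphXn rmorphD fmorphV !rmorph_nat.
by rewrite [RHS]e; ring.
Qed.

(** In both ranges of nu the square of nu is a real number below 1/4, and cos (2
    nu t) is a real function of t: a cosine or a hyperbolic cosine. *)
Lemma twist_exists : exists (s B : R) (cs sn : R -> R),
  [/\ 4 * s < 1, nu ^+ 2 = s%:C, ccos (pi%:C * nu) = (cs hpi)%:C & 0 < cs hpi] /\
  [/\ forall t : R, is_derive t 1 cs (sn t),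
      forall t : R, is_derive t 1 sn (- (4 * s) * cs t), cs 0 = 1, sn 0 = 0 &
      forall t : R, 0 <= t <= hpi -> `|cs t| <= B].
Proof.
case: hnu => [/andP[n0 n1]|n0].
  have [r nr] : exists r : R, nu = r%:C by apply/complex_realP; rewrite realE n0.
  move: n0 n1; rewrite nr half_half lecR ltcR => r0 r1.
  exists (r ^+ 2), 1, (fun t => cos (2 * r * t)), (fun t => 2 * r * - sin (2 * r * t)).
  have e : 2 * r * hpi = pi * r by field.
  split; split.
  - by nra.
  - by rewrite rmorphXn.
  - rewrite e /ccos.
    have -> : 'i * (pi%:C * r%:C) = 0 +i* (pi * r) :> C.
      by apply/eqP; rewrite eq_complex /= !(mul0r, mulr0, mul1r, subr0, addr0, add0r, oppr0) !eqxx.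
    have -> : - (0 +i* (pi * r)) = 0 +i* - (pi * r) :> C by apply/eqP; rewrite eq_complex /= oppr0 !eqxx.
    rewrite /cexp /= cosN sinN expR0 rmorph1 !mul1r.
    have -> : cos (pi * r) +i* sin (pi * r) + (cos (pi * r) +i* - sin (pi * r)) = 2 * (cos (pi * r))%:C :> C.
      by rewrite mulr_natl mulr2n; apply/eqP; rewrite eq_complex /= addr0 subrr !eqxx.
    by rewrite mulrC mulKf// pnatr_eq0.
  - rewrite e cos_gt0_pihalf//; have p0 := pi_gt0 R; apply/andP; split; nra.
  - by move=> t; exact: der_scale.
  - by move=> t; apply: (derE (derZ (2 * r) _)); rewrite /GRing.scale /=; ring.
  - by rewrite mulr0 cos0.
  - by rewrite mulr0 sin0 oppr0 mulr0.
  - by move=> t _; exact: cos_max.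
have [y ey] : exists y, nu = 0 +i* y.
  by exists (complex.Im nu); case: nu n0 => ? ? /= ->.
pose cs (t : R) := 2^-1 * (expR (2 * y * t) + expR (- (2 * y) * t)).
pose sn (t : R) := y * (expR (2 * y * t) + - 1 * expR (- (2 * y) * t)).
have cs_pos t : 0 < cs t by rewrite mulr_gt0// addr_gt0// expR_gt0.
have d (t c : R) : is_derive t 1 (fun x => expR (c * x)) (c * expR (c * t)) by exact: der_scale.
exists (- (y ^+ 2)), (expR (`|y| * pi)), cs, sn.
split; split.
- by have := sqr_ge0 y; lra.
- by rewrite ey; apply/eqP; rewrite eq_complex expr2 /= !(mul0r, mulr0, sub0r, addr0) expr2 !eqxx.
- rewrite /ccos; have -> : 'i * (pi%:C * nu) = (- (pi * y))%:C.
    rewrite ey; apply/eqP; rewrite eq_complex /=.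
    by rewrite !(mul0r, mulr0, mul1r, subr0, addr0, add0r, sub0r, oppr0) !eqxx.
  rewrite -rmorphN !cexp_real opprK -rmorphD /cs.
  have -> : 2 * y * hpi = pi * y by field.
  have -> : - (2 * y) * hpi = - (pi * y) by field.
  by rewrite addrC rmorphM mulrC half_half.
- exact: cs_pos.
- move=> t; apply: (derE (derZ 2^-1 (derD (d t _) (d t _)))).
  by rewrite /sn; field.
- move=> t; apply: (derE (derZ y (derD (d t _) (derZ (- 1) (d t _))))).
  by rewrite /cs; field.
- by rewrite /cs !mulr0 expR0; field.
- by rewrite /sn !mulr0 expR0 mulr1 subrr mulr0.
- move=> t /andP[t0 t1]; rewrite ger0_norm ?(ltW (cs_pos _))// /cs.
  have h1 : expR (2 * y * t) <= expR (`|y| * pi).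
    rewrite ler_expR; apply: (@le_trans _ _ (2 * `|y| * t)).
      by rewrite ler_wpM2r// ler_wpM2l// ler_norm.
    by have := normr_ge0 y; nra.
  have h2 : expR (- (2 * y) * t) <= expR (`|y| * pi).
    rewrite ler_expR; apply: (@le_trans _ _ (2 * `|y| * t)).
      by rewrite ler_wpM2r// -mulrN ler_wpM2l// -normrN ler_norm.
    by have := normr_ge0 y; nra.
  by lra.
Qed.

Lemma alpha_gt0 j : 0 < alpha nu j.
Proof.
have [s [B [cs [sn [[s1 hs _ _] _]]]]] := twist_exists.
by rewrite (alpha_sqr j hs) ltcR shifted_prod_gt0.
Qed.

(** The Euler products give the limit of n!^2 n / alpha_(n+1) on the left, and
    alpha is the product of (k + 1/2)^2 - nu^2, as in the comparison of Wallis
    integrals. *)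
Lemma reflection : exists c : R, [/\ 0 < c, ccos (pi%:C * nu) = c%:C &
  Gamma (2^-1 - nu) * Gamma (2^-1 + nu) = (pi / c)%:C].
Proof.
have [s [B [cs [sn [[s1 hs hc c0] [h1 h2 h3 h4 h5]]]]]] := twist_exists.
exists (cs hpi); split=> //.
apply: (Gamma_half_lim hnu); apply/cvgCP => e e0.
have [c hcm] := wallis_limit s1 h1 h2 h3 h4 h5 c0.
exists (Num.truncn (c / e)).+1 => n hn.
have n0 : (0 < n)%N by exact: leq_trans hn.
have n0R : 0 < n%:R :> R by rewrite ltr0n.
rewrite (alpha_sqr n.+1 hs) -[n%:R](rmorph_nat (@real_complex R)) -[n`!%:R](rmorph_nat (@real_complex R)).
rewrite -rmorphXn -rmorphM -fmorphV -rmorphM -rmorphB mag_real.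
apply: le_lt_trans (hcm n n0) _.
rewrite ltr_pdivrMr// mulrC -ltr_pdivrMr//.
by rewrite (lt_le_trans (truncnS_gt _))// ler_nat.
Qed.

End Reflection.

(** * Square summable vectors *)

Section SquareSummable.
Variable R : realType.
Local Notation C := R[i].

Lemma mag_mul_le (a b : C) : mag (a * b) <= (mag a ^+ 2 + mag b ^+ 2) / 2.
Proof.
by rewrite magM; have := sqr_ge0 (mag a - mag b); rewrite sqrrB; lra.
Qed.

Lemma abs_bound_prod (I : choiceType) (u v : I -> C) A B :
  abs_bound (fun i => u i ^+ 2) A -> abs_bound (fun i => v i ^+ 2) B ->
  abs_bound (fun i => u i * v i) ((A + B) / 2).
Proof.
move=> uA vB s; rewrite ler_pdivlMr// mulr_suml.
apply: le_trans (lerD (uA s) (vB s)); rewrite -big_split ler_sum//= => i _.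
by rewrite !magX; have := mag_mul_le (u i) (v i); lra.
Qed.

(** The partial sums increase, so each of them is at most the modulus of the
    limit plus 1. *)
Lemma ell2_sqr (f : nat -> C) : ell2 f -> exists B, abs_bound (fun n => f n ^+ 2) B.
Proof.
case=> _ /cvg_ex[l /cvgCP/(_ 1 ltr01)[N hN]].
exists (mag l + 1); apply: abs_bound_nat => n.
pose F n : R := \sum_(k < n) mag (f k ^+ 2).
have FS m : series (fun n => (`|f n| ^+ 2 : C)) m = (F m)%:C.
  rewrite /series /= big_mkord /F rmorph_sum; apply: eq_bigr => k _.
  by rewrite magX rmorphXn normE.
have Fmono : F n <= F (n + N)%N.
  rewrite /F -!(big_mkord xpredT (fun k => mag (f k ^+ 2))).
  by rewrite (@big_cat_nat _ _ _ n 0 (n + N))// ?leq_addr//= lerDl sumr_ge0// => k _; exact: mag_ge0.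
apply: (le_trans Fmono); have := hN (n + N)%N (leq_addl _ _); rewrite FS => h.
have F0 : 0 <= F (n + N)%N by apply: sumr_ge0 => k _; exact: mag_ge0.
rewrite -[F _](ger0_norm F0) -mag_real -[(F _)%:C](subrK l).
by apply: le_trans (magD _ _) _; rewrite addrC lerD2l ltW.
Qed.

Lemma sqr_ell2 (f : nat -> C) B : f 0%N = 0 -> abs_bound (fun n => f n ^+ 2) B -> ell2 f.
Proof.
move=> f0 fB; split=> //.
have [|l hl] := @has_sum_ex _ _ (fun n => `|f n| ^+ 2 : C) B.
  apply: abs_bound_le fB => n; rewrite !magX (_ : mag `|f n| = mag (f n))//.
  by rewrite normE mag_real ger0_norm// mag_ge0.
by apply/cvg_ex; exists l; exact: has_sum_series hl.
Qed.

Lemma abs_bound_sqrD (I : choiceType) (u v : I -> C) A B :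
  abs_bound (fun i => u i ^+ 2) A -> abs_bound (fun i => v i ^+ 2) B ->
  abs_bound (fun i => (u i - v i) ^+ 2) (2 * (A + B)).
Proof.
move=> uA vB s; apply: le_trans (ler_wpM2l _ (lerD (uA s) (vB s))) => //.
rewrite -big_split mulr_sumr ler_sum//= => i _; rewrite !magX.
have h := magB (u i) (v i); have h0 := mag_ge0 (u i - v i).
apply: (@le_trans _ _ ((mag (u i) + mag (v i)) ^+ 2)); first by rewrite ler_pXn2r// nnegrE addr_ge0// mag_ge0.
by have := sqr_ge0 (mag (u i) - mag (v i)); rewrite sqrrB sqrrD; lra.
Qed.

Lemma ell2B (f g : nat -> C) : ell2 f -> ell2 g -> ell2 (f - g).
Proof.
move=> hf hg; have [A fA] := ell2_sqr hf; have [B gB] := ell2_sqr hg.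
apply: (@sqr_ell2 _ (2 * (A + B))); first by rewrite !fctE hf.1 hg.1 subr0.
exact: abs_bound_sqrD.
Qed.

Lemma has_sum_delta (y : nat) (c : nat -> C) : has_sum (fun z => c z * (z == y)%:R) (c y).
Proof.
have := @has_sum_fin _ _ (fun z => c z * (z == y)%:R) [fset y]%fset.
rewrite big_seq_fset1 eqxx mulr1; apply=> i.
by rewrite inE => /negbTE ->; rewrite mulr0.
Qed.

End SquareSummable.

(** * The resolvent kernel *)

Section Resolvent.
Variable R : realType.
Local Notation C := R[i].
Variables (nu : C) (xi : R).
Hypothesis hnu : 0 <= nu < 2^-1 \/ complex.Re nu = 0.
Hypothesis xi01 : 0 < xi < 1.

(** The reflection formula cancels the cosine and pi against the two values of
    Gamma. *)
Lemma psiE x : psi nu xi x = alpha nu x * xi%:C ^+ x / (2 * x`!%:R ^+ 2).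
Proof.
have [c [c0 hc hG]] := reflection hnu.
have {}hG : Gamma (2^-1 - nu) * Gamma (2^-1 + nu) = pi%:C / c%:C.
  by rewrite hG rmorphM fmorphV.
rewrite /psi (Gamma_up hnu) hG hc.
have cC : c%:C != 0 :> C by rewrite -mag_eq0 mag_real normr_eq0 gt_eqF.
have pC : pi%:C != 0 :> C by rewrite -mag_eq0 mag_real normr_eq0 gt_eqF// pi_gt0.
have f0 := fact_neq0 R x.
move: (alpha _ _) (xi%:C ^+ x) (c%:C) cC (pi%:C) pC (x`!%:R) f0 => a b c' c'0 p p0 f f0.
by field; rewrite f0 p0 c'0.
Qed.

Lemma psi_ge0 x : 0 <= psi nu xi x.
Proof.
rewrite psiE; apply: divr_ge0; last by apply: mulr_ge0 => //; apply: exprn_ge0.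
apply: mulr_ge0; first exact: ltW (alpha_gt0 hnu x).
by apply: exprn_ge0; rewrite lecR; case/andP: xi01 => /ltW.
Qed.

Definition root_wt x : C := sqrtC (x%:R * psi nu xi x).

Lemma root_wt_sqr x : 2 * root_wt x ^+ 2 = wt nu xi x.
Proof.
rewrite sqrtCK psiE /wt /weight; have f0 := fact_neq0 R x.
move: (alpha _ _) (xi%:C ^+ x) (x`!%:R) f0 => a b f f0.
by field.
Qed.

Lemma root_wt0 : root_wt 0 = 0.
Proof. by rewrite /root_wt mul0r sqrtC0. Qed.

Lemma LmxE x y : Lmx nu xi x y = 2 * (root_wt x * root_wt y) / (x + y)%:R.
Proof.
have -> : root_wt x * root_wt y = sqrtC (x%:R * psi nu xi x * (y%:R * psi nu xi y)).
  by rewrite rootCMl// mulr_ge0// psi_ge0.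
by rewrite /Lmx [x%:R * _ * (y%:R * _)]mulrACA mulrA.
Qed.

Lemma root_wt_summable : exists B, abs_bound (fun z => root_wt z ^+ 2) B.
Proof.
have [B hB] := wt_summable hnu xi01.
exists (mag (2^-1 : C) * B); have := abs_boundZ 2^-1 hB.
by apply: abs_bound_le => z; rewrite -root_wt_sqr mulKf// pnatr_eq0.
Qed.

Lemma Lop_has_sum (f : nat -> C) x l :
  has_sum (fun z => Lmx nu xi x z * f z) l -> Lop nu xi f x = l.
Proof.
move=> h; apply: cvgC_lim; apply: cvgC_eq (has_sum_series h) => -[//|n] _.
rewrite /series /= big_nat_recl// LmxE root_wt0 !(mulr0, mul0r) add0r.
by rewrite big_add1.
Qed.

Definition resolvent_kernel x y : C := root_wt x * root_wt y * kappa nu xi x y.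

(** The column y of 1 - K, which is the inverse of 1 + L. *)
Definition resolvent_vec y : nat -> C :=
  fun z => (z == y)%:R - resolvent_kernel z y.

(** L K_y = L delta_y - K_y by the equation K + L K = L. *)
Lemma Lop_resolvent x y : (0 < y)%N ->
  Lop nu xi (resolvent_vec y) x = resolvent_kernel x y.
Proof.
move=> y0; apply: Lop_has_sum; rewrite /resolvent_vec.
have [->|x0] := posnP x.
  rewrite /resolvent_kernel root_wt0 !mul0r.
  have := @has_sum0 R nat; congr has_sum; apply/funext => z.
  by rewrite LmxE root_wt0 !(mul0r, mulr0).
have h1 := has_sum_delta y (Lmx nu xi x).
have h2 := has_sumZ (- (root_wt x * root_wt y)) (kappa_equation hnu xi01 x0 y0).
have := has_sumD h1 h2.
have -> : Lmx nu xi x y + - (root_wt x * root_wt y) * (2 / (x + y)%:R - kappa nu xi x y) =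
  resolvent_kernel x y by rewrite LmxE /resolvent_kernel; ring.
congr has_sum; apply/funext => z; rewrite mulrBr; congr (_ + _).
rewrite -root_wt_sqr LmxE /resolvent_kernel.
by move: (kappa _ _ _ _) ((x + z)%:R^-1) (root_wt x) (root_wt y) (root_wt z) => *; ring.
Qed.

Lemma resolvent_vec_ell2 y : (0 < y)%N -> ell2 (resolvent_vec y).
Proof.
move=> y0; have [B hB] := root_wt_summable; have [Bk hk] := kappa_bound hnu xi01.
have hd : abs_bound (fun z => (z == y)%:R ^+ 2 : C) 1.
  apply: abs_bound_nat => N.
  have mb (b : bool) : mag (b%:R ^+ 2 : C) = b%:R.
    by case: b; rewrite ?expr1n ?mag1 ?expr0n ?mag0.
  under eq_bigr do rewrite mb.
  suff -> : \sum_(n < N) ((n == y :> nat)%:R : R) = (y < N)%N%:R by case: (y < N)%N.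
  elim: N => [|N IH]; first by rewrite big_ord0.
  rewrite big_ord_recr IH /= ltnS [N == y]eq_sym.
  by case: (ltngtP y N) => _ /=; rewrite ?addr0 ?add0r.
have [K hK] : exists K, abs_bound (fun z => resolvent_kernel z y ^+ 2) K.
  exists (mag (root_wt y ^+ 2 * (Bk ^+ 2)%:C) * B).
  apply: abs_bound_le (abs_boundZ (root_wt y ^+ 2 * (Bk ^+ 2)%:C) hB) => z.
  rewrite /resolvent_kernel.
  have zy : (0 < z + y)%N by rewrite addn_gt0 y0 orbT.
  have -> : (root_wt z * root_wt y * kappa nu xi z y) ^+ 2 =
    root_wt y ^+ 2 * kappa nu xi z y ^+ 2 * root_wt z ^+ 2 by ring.
  rewrite [leLHS]magM [leRHS]magM ler_wpM2r ?mag_ge0//.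
  rewrite [leLHS]magM [leRHS]magM ler_wpM2l ?mag_ge0//.
  rewrite [leLHS]magX mag_real ger0_norm ?sqr_ge0// ler_pXn2r ?nnegrE ?mag_ge0 ?hk//.
  by rewrite (le_trans (mag_ge0 _) (hk _ _ zy)).
apply: sqr_ell2 (abs_bound_sqrD hd hK).
by rewrite /resolvent_vec /resolvent_kernel root_wt0 !mul0r subr0; case: y y0 {hd hK}.
Qed.

Lemma ell2_row_summable x (f : nat -> C) : ell2 f ->
  exists B, abs_bound (fun z => Lmx nu xi x z * f z) B.
Proof.
move=> hf; have [A hA] := root_wt_summable; have [B hB] := ell2_sqr hf.
exists (mag (2 * root_wt x) * ((A + B) / 2)).
apply: abs_bound_le (abs_boundZ (2 * root_wt x) (abs_bound_prod hA hB)) => z.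
rewrite LmxE.
have -> : 2 * (root_wt x * root_wt z) / (x + z)%:R * f z =
  (2 * root_wt x * (root_wt z * f z)) * (x + z)%:R^-1 by ring.
rewrite [leLHS]magM ler_piMr ?mag_ge0//.
have [|xz] := posnP (x + z); first by move=> ->; rewrite invr0 mag0.
by rewrite magV mag_nat invf_le1 ?ltr0n// ler1n.
Qed.

(** For f + L f = 0, the pairing of f with the column y of the kernel, computed
    with f replaced by - L f and the two sums exchanged, becomes by K + L K = L
    the same pairing minus (L f)(y). Hence L f = 0, and f = 0. *)
Lemma resolvent_inj (f : nat -> C) : ell2 f ->
  (forall x, has_sum (fun z => Lmx nu xi x z * f z) (- f x)) -> forall y, f y = 0.
Proof.
move=> hf hL y; have [->|y0] := posnP y; first exact: hf.1.
have [A hA] := root_wt_summable; have [B hB] := ell2_sqr hf.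
have [Bw hBw] := wt_summable hnu xi01; have [Bk hk] := kappa_bound hnu xi01.
pose u (p : nat * nat) : C := kappa nu xi p.1 y * wt nu xi p.1 / (p.1 + p.2)%:R *
  (root_wt p.2 * f p.2).
have uB : abs_bound u (mag (Bk%:C : C) * (Bw * ((A + B) / 2))).
  apply: abs_bound_le (abs_boundZ Bk%:C (abs_bound_mul hBw (abs_bound_prod hA hB))) => -[x z].
  rewrite /u /=; have xy : (0 < x + y)%N by rewrite addn_gt0 y0 orbT.
  have -> : kappa nu xi x y * wt nu xi x / (x + z)%:R * (root_wt z * f z) =
    kappa nu xi x y * (x + z)%:R^-1 * (wt nu xi x * (root_wt z * f z)) by ring.
  rewrite [leLHS]magM [leRHS]magM ler_wpM2r ?mag_ge0// [leLHS]magM mag_real.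
  have Bk0 : 0 <= Bk by rewrite (le_trans (mag_ge0 _) (hk _ _ xy)).
  rewrite ger0_norm// -[leRHS]mulr1 ler_pM ?mag_ge0 ?hk//.
  have [->|xz] := posnP (x + z); first by rewrite invr0 mag0.
  by rewrite magV mag_nat invf_le1 ?ltr0n// ler1n.
have [l [hl1 hl2]] := csum_fubini uB.
have e1 x : csum (fun z => u (x, z)) = - (kappa nu xi x y * root_wt x * f x).
  apply: csum_unique.
  have := has_sumZ (kappa nu xi x y * root_wt x) (hL x); rewrite mulrN.
  congr has_sum; apply/funext => z; rewrite /u /= -root_wt_sqr LmxE.
  by move: (kappa _ _ _ _) ((x + z)%:R^-1) (root_wt x) (root_wt z) => *; ring.
have e2 z : csum (fun x => u (x, z)) =
    root_wt z * f z * (2 / (z + y)%:R - kappa nu xi z y).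
  apply: csum_unique; have [->|z0] := posnP z.
    rewrite root_wt0 !mul0r; have := @has_sum0 R nat; congr has_sum.
    by apply/funext => x; rewrite /u /= root_wt0 mul0r mulr0.
  have := has_sumZ (root_wt z * f z) (kappa_equation hnu xi01 z0 y0).
  congr has_sum; apply/funext => x; rewrite /u /= [(z + x)%N]addnC.
  by move: (kappa _ _ _ _) ((x + z)%:R^-1) (wt _ _ _) => *; ring.
rewrite (funext e1) in hl1; rewrite (funext e2) in hl2.
have := has_sumZ (root_wt y) (has_sumD hl2 (has_sumZ (- 1) hl1)).
have -> : root_wt y * (l + - 1 * l) = 0 by ring.
move=> h0; apply/eqP; rewrite -oppr_eq0; apply/eqP.
apply: has_sum_uniq (hL y) _; move: h0; congr has_sum; apply/funext => z.
rewrite LmxE [(y + z)%N]addnC.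
by move: (kappa _ _ _ _) ((z + y)%:R^-1) => *; ring.
Qed.

Lemma one_add_Lop_injective :
  {in @ell2 R &, injective (fun g : nat -> C => g + Lop nu xi g)}.
Proof.
move=> g g' /set_mem hg /set_mem hg' e.
have {}e x : g x + Lop nu xi g x = g' x + Lop nu xi g' x := congr1 (fun h => h x) e.
have hd := ell2B hg hg'.
suff h y : g y - g' y = 0.
  by apply/funext => y; apply/eqP; rewrite -subr_eq0; apply/eqP; exact: h.
move: y; apply: (resolvent_inj hd) => x.
have [B hB] := ell2_row_summable x hg; have [B' hB'] := ell2_row_summable x hg'.
have [l hl] := has_sum_ex hB; have [l' hl'] := has_sum_ex hB'.
have := e x; rewrite (Lop_has_sum hl) (Lop_has_sum hl') => exl.
have := has_sumD hl (has_sumZ (- 1) hl').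
have -> : l + - 1 * l' = - (g x - g' x).
  have -> : l = g' x + l' - g x by rewrite -exl; ring.
  by ring.
congr has_sum; apply/funext => z; rewrite mulN1r -mulrN -mulrDr.
by [].
Qed.

(** (1 + L)(delta_y - K_y) = delta_y, so the inverse of 1 + L sends delta_y to
    delta_y - K_y, which L maps to K_y. *)
Lemma KmxE x y : (0 < y)%N -> Kmx nu xi x y = resolvent_kernel x y.
Proof.
move=> y0; rewrite /Kmx /Kop.
have -> : (fun z => (z == y)%:R) = resolvent_vec y + Lop nu xi (resolvent_vec y) :> (nat -> C).
  by apply/funext => z; rewrite !fctE Lop_resolvent// /resolvent_vec subrK.
rewrite (pinvKV (fun=> (fun=> 0)) one_add_Lop_injective (mem_set (resolvent_vec_ell2 y0))).
exact: Lop_resolvent.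
Qed.

End Resolvent.

(** * The series of the theorem *)

Section KernelSeries.
Variable R : realType.
Local Notation C := R[i].
Variables (nu : C) (xi : R).
Hypothesis hnu : 0 <= nu < 2^-1 \/ complex.Re nu = 0.
Hypothesis xi01 : 0 < xi < 1.

#[local] Opaque fps_mul fps_add fps_geom fpsX fpsC fpsZ fpsU pfps rfps hfps ev.

Let xi_gt0 : 0 < xi. Proof. by case/andP: xi01. Qed.
Let xi_ge0 : 0 <= xi. Proof. exact: ltW. Qed.
Let mag_xi : mag xi%:C <= xi. Proof. by rewrite mag_real ger0_norm. Qed.
Let gamma0 : C := Gamma (2^-1 - nu) * Gamma (2^-1 + nu).

Lemma gamma0_gt0 : 0 < gamma0.
Proof.
have [c [c0 _ hG]] := reflection hnu.
by rewrite /gamma0 hG ltcR divr_gt0// pi_gt0.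
Qed.

Lemma ev_kfps_term x y (j : nat) : ev (kfps_term nu x y j) xi%:C =
  (if j == 0%N then 2^-1 else 1) * (alpha nu j *
    ((xi%:C * (1 - xi%:C)^-1 ^+ 2) ^+ j *
      (ev (hfps nu j x) xi%:C * ev (hfps nu j y) xi%:C))).
Proof.
have [Bx hBx] := bnd_hfps hnu xi01 j x; have [By hBy] := bnd_hfps hnu xi01 j y.
have w1 : mag (1 : C) * xi < 1 by rewrite mag1 mul1r; case/andP: xi01.
have bg := bnd_geom xi_ge0 w1.
have bU := bnd_exp 2 xi_ge0 bg.
have bp := bndM (bnd_X xi_ge0) bU.
have bpj := bnd_exp j xi_ge0 bp; have bh := bndM hBx hBy.
have bt := bndM bpj bh.
rewrite kfps_termE pfpsE fpsU_geom.
have -> : (if j == 0%N then fpsC 2^-1 else 1) =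
    fpsC (if j == 0%N then 2^-1 else 1) :> fps C.
  by case: eqP => // _; rewrite rmorph1.
rewrite (evZ _ (bndZ _ bt) mag_xi) (evZ _ bt mag_xi) (evM bpj bh mag_xi).
rewrite (evM hBx hBy mag_xi) (ev_exp _ xi_ge0 bp mag_xi).
rewrite (evM (bnd_X xi_ge0) bU mag_xi) evX (ev_exp _ xi_ge0 bg mag_xi).
by rewrite (ev_geom xi_ge0 w1 mag_xi) mul1r.
Qed.

(** The two values of Gamma in the denominator are Gamma(1/2 - nu) Gamma(1/2 +
    nu) / alpha_j, which puts alpha_j in the numerator. *)
Lemma kernel_termE x y (j : nat) : (0 < x)%N -> (0 < y)%N ->
  kernel_term nu xi x y j =
    (xi `^ ((x + y)%:R / 2))%:C / (x`!%:R * y`!%:R * gamma0) *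
    ev (kfps_term nu x y j) xi%:C.
Proof.
move=> x0 y0; rewrite ev_kfps_term /kernel_term !(phi_ev hnu xi01)//.
have g0 := lt0r_neq0 gamma0_gt0; move: g0.
rewrite /gamma0 -(Gamma_down hnu j); set D := Gamma _ * Gamma _ => g0.
have a0 := lt0r_neq0 (alpha_gt0 hnu j).
have D0 : D != 0 by apply: contraNneq g0 => ->; rewrite mulr0.
have -> : (xi `^ (j%:R + (x + y)%:R / 2) * (1 - xi) ^- (2 * j))%:C =
    (xi `^ ((x + y)%:R / 2))%:C * (xi%:C * (1 - xi%:C)^-1 ^+ 2) ^+ j.
  have -> : xi `^ (j%:R + (x + y)%:R / 2) = xi ^+ j * xi `^ ((x + y)%:R / 2).
    by rewrite powRD ?powR_mulrn// (gt_eqF xi_gt0) implybT.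
  rewrite -[1 - xi%:C](rmorphB (@real_complex R) 1) -fmorphV.
  rewrite -rmorphXn -rmorphM -rmorphXn -rmorphM; congr (_%:C).
  by rewrite exprMn -exprM exprVn; ring.
have f1 := fact_neq0 R x; have f2 := fact_neq0 R y.
have f3 := fact_neq0 R (x + j); have f4 := fact_neq0 R (y + j).
have -> : (if j == 0%N then 2^-1 else 1) = (2 ^+ (j == 0%N))^-1 :> C.
  by case: eqP => _; rewrite ?expr1// expr0 invr1.
have t0 : 2 ^+ (j == 0%N) != 0 :> C by rewrite expf_neq0// pnatr_eq0.
move: (2 ^+ _) t0 => t t0; move: (_ ^+ j) => p; move: (_%:C) => q.
clear g0; clearbody D; move: (alpha _ _) a0 => a a0.
move: (ev (hfps nu j x) _) => u; move: (ev (hfps nu j y) _) => v.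
move: ((x + j)`!%:R) f3 ((y + j)`!%:R) f4 (x`!%:R) f1 (y`!%:R) f2.
move=> n1 ? n2 ? n3 ? n4 ?.
by field; do ![apply/andP; split].
Qed.

Lemma kernel_sum x y : (0 < x)%N -> (0 < y)%N ->
  series (kernel_term nu xi x y) @ \oo -->
    (xi `^ ((x + y)%:R / 2))%:C / (x`!%:R * y`!%:R * gamma0) *
    ((x + y)%:R / 4 * kappa nu xi x y).
Proof.
move=> x0 y0; apply: has_sum_series.
have xy : (0 < x + y)%N by rewrite addn_gt0 x0.
have := has_sumZ ((xi `^ ((x + y)%:R / 2))%:C / (x`!%:R * y`!%:R * gamma0))
  (kappa_sum hnu xi01 xy).
by congr has_sum; apply/funext => j; rewrite kernel_termE.
Qed.

(** Both sides are nonnegative and have equal squares. *)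
Lemma root_wt_mul x y : root_wt nu xi x * root_wt nu xi y =
  Xi nu x y * sqrtC (x%:R * y%:R) *
  ((xi `^ ((x + y)%:R / 2))%:C / (x`!%:R * y`!%:R * gamma0)) / 2.
Proof.
have g0 := gamma0_gt0.
set r := RHS; rewrite /root_wt -rootCMl; last by rewrite mulr_ge0// psi_ge0.
have XiE : Gamma (2^-1 - nu + x%:R) * Gamma (2^-1 + nu + x%:R)
      * Gamma (2^-1 - nu + y%:R) * Gamma (2^-1 + nu + y%:R) =
    alpha nu x * alpha nu y * gamma0 ^+ 2.
  move: (Gamma_up hnu x) (Gamma_up hnu y).
  move: (Gamma _) (Gamma _) (Gamma (_ + y%:R)) (Gamma (_ + y%:R)) => p q u v h1 h2.
  have -> : q * p * v * u = (q * p) * (v * u) by ring.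
  rewrite h1 h2 -/gamma0; move: (alpha nu x) (alpha nu y) gamma0 => a b g.
  by ring.
have r0 : 0 <= r.
  have h1 : 0 <= Xi nu x y.
    rewrite /Xi XiE sqrtC_ge0; apply: mulr_ge0; last exact: exprn_ge0 (ltW g0).
    by apply: mulr_ge0; apply: ltW; exact: alpha_gt0.
  have h2 : 0 <= (xi `^ ((x + y)%:R / 2))%:C :> C by rewrite lecR powR_ge0.
  have h3 : 0 <= x`!%:R * y`!%:R * gamma0 by apply: mulr_ge0 (ltW g0).
  have h4 : 0 <= sqrtC (x%:R * y%:R) :> C by rewrite sqrtC_ge0 mulr_ge0.
  exact: divr_ge0 (mulr_ge0 (mulr_ge0 h1 h4) (divr_ge0 h2 h3)) (ler0n _ 2).
rewrite -[RHS](sqrCK r0); congr sqrtC.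
have -> : r ^+ 2 = Xi nu x y ^+ 2 * sqrtC (x%:R * y%:R) ^+ 2 *
    ((xi `^ ((x + y)%:R / 2))%:C ^+ 2 / (x`!%:R * y`!%:R * gamma0) ^+ 2) / 2 ^+ 2.
  by rewrite /r; move: (Xi _ _ _) (sqrtC _) => s t; rewrite !(exprMn, exprVn).
have -> : Xi nu x y ^+ 2 = alpha nu x * alpha nu y * gamma0 ^+ 2.
  by rewrite /Xi sqrtCK.
rewrite sqrtCK.
have -> : (xi `^ ((x + y)%:R / 2))%:C ^+ 2 = xi%:C ^+ x * xi%:C ^+ y :> C.
  rewrite -!rmorphXn -rmorphM; congr (_%:C).
  rewrite -exprD -powR_mulrn ?powR_ge0// -powRrM divfK ?pnatr_eq0//.
  by rewrite powR_mulrn.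
rewrite !psiE//.
have f1 := fact_neq0 R x; have f2 := fact_neq0 R y; have g1 := lt0r_neq0 g0.
move: gamma0 g1 (alpha nu x) (alpha nu y) (xi%:C ^+ x) (xi%:C ^+ y) => g g1 a b p q.
move: (x`!%:R) f1 (y`!%:R) f2 (x%:R) (y%:R) => n1 ? n2 ? u v.
by field; do ![apply/andP; split].
Qed.

End KernelSeries.

Theorem theorem2p1 (R : realType) (xi : R) (nu : R[i])
    (hxi : 0 < xi < 1)
    (hnu : 0 <= nu < 2^-1 \/ complex.Re nu = 0)
    (x y : nat) (hx : (0 < x)%N) (hy : (0 < y)%N) :
  cvgn (series (kernel_term nu xi x y)) /\
  Kmx nu xi x y =
    2 * Xi nu x y * sqrtC (x%:R * y%:R) / (x + y)%:R
    * limn (series (kernel_term nu xi x y)).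
Proof.
have hs := kernel_sum hnu hxi hx hy.
split; first by apply/cvg_ex; eexists; exact: hs.
rewrite (cvgC_lim hs) (KmxE hnu hxi x hy) /resolvent_kernel (root_wt_mul hnu hxi).
have xy0 : (x + y)%:R != 0 :> R[i] by rewrite natC_gt0// addn_gt0 hx.
move: (_ / (_ * _)) ((x + y)%:R) xy0 => c n n0.
by field.
Qed.
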